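(* Let $T>0$, $u\in\mathbb R$ and $0<\lambda<\infty$. Let $X(t)=Z(t)+J(t)$, $t\in[0,T]$, where $Z$ is a centered stationary Gaussian process with $C^1$ paths and covariance function $\Gamma(\tau)=\mathbb E Z(0)Z(\tau)$ satisfying $\Gamma(0)=1$, and $J$ is a compound Poisson process, independent of $Z$, with intensity $\lambda$ and standard Gaussian jumps. Then $$\mathbb E U^c_u=T\sqrt{\frac{-\Gamma''(0)}{2\pi}}\;p(u),\qquad \mathbb E U^d_u=\lambda T\int_{-\infty}^u\overline\Phi(u-x)\,p(x)\,dx.$$
   Context: $J(t)=\sum_{n=1}^{\nu_t}\xi_n$, where $(\xi_n)_{n\ge1}$ are independent standard Gaussian random variables and $\nu=(\nu_t)_{t\ge0}$ is a (simple, homogeneous) Poisson process with intensity $\lambda$, independent of $(\xi_n)$. $\varphi_n$ is the centered Gaussian density with variance $n$; $p_n=\frac1{\lambda T}\mathbb P(\nu_T\ge n)$ for $n\ge 1$; $p=\sum_{n=1}^\infty p_n\varphi_n$. $\Phi$ is the standard Gaussian distribution function and $\overline\Phi=1-\Phi$. Note that $-\Gamma''(0)$ is the variance of $\dot Z(0)$. $U^c_u$ is the number of continuous up-crossings of level $u$ by $X$ on $[0,T]$, i.e. of points $s\in(0,T)$ at which $X$ is continuous with $X(s)=u$ and $\dot X(s)>0$. $U^d_u$ is the number of discontinuous up-crossings, i.e. of points $s$ with $X(s^-)<u<X(s)$. *)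

(* Defs.v *)
From HB Require Import structures.
From mathcomp Require Import all_boot all_order all_algebra.
From mathcomp Require Import all_classical all_reals all_analysis.

Set Implicit Arguments.
Unset Strict Implicit.
Unset Printing Implicit Defensive.

Import Order.TTheory GRing.Theory Num.Theory.
Import numFieldNormedType.Exports.

Local Open Scope classical_set_scope.
Local Open Scope ring_scope.

Section Independence.
Context (d : measure_display) (Om : measurableType d) (R : realType)
  (P : probability Om R).

Definition sigma_family (d' : measure_display) (E : measurableType d')
    (I : Type) (D : set I) (X : I -> Om -> E) : set (set Om) :=
  <<s [set A | exists i (B : set E),
         [/\ D i, measurable B & A = X i @^-1` B]] >>.

Definition independent_systems (F G : set (set Om)) : Prop :=
  forall A B, F A -> G B -> P (A `&` B) = (P A * P B)%E.

Definition independent_family (d' : measure_display) (E : measurableType d')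
    (I : choiceType) (X : I -> Om -> E) : Prop :=
  forall (s : seq I) (B : I -> set E), uniq s ->
    (forall i, measurable (B i)) ->
    P (\bigcap_(i in [set` s]) (X i @^-1` B i)) =
    (\prod_(i <- s) P (X i @^-1` B i))%E.

End Independence.

Section GaussianProcesses.
Context (d : measure_display) (Om : measurableType d) (R : realType)
  (P : probability Om R).

(* Point masses count as Gaussian laws. They are treated apart because
   [normal_prob m 0] is the uniform law on [0, 1]. *)
Definition gaussian_variable (X : Om -> R) : Prop :=
  exists m s : R, 0 <= s /\
    forall B : set R, measurable B ->
      P (X @^-1` B) = if s == 0 then \d_m B else normal_prob m s B.

Definition gaussian_process (D : set R) (Z : R -> Om -> R) : Prop :=
  forall (n : nat) (t c : 'I_n -> R), (forall i, D (t i)) ->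
    gaussian_variable (fun w => \sum_(i < n) c i * Z (t i) w).

Definition centered_process (D : set R) (Z : R -> Om -> R) : Prop :=
  forall t, D t -> ('E_P[Z t] = 0)%E.

Definition stationary_process (D : set R) (Z : R -> Om -> R) : Prop :=
  forall (n : nat) (t : 'I_n -> R) (h : R) (B : 'I_n -> set R),
    (forall i, D (t i)) -> (forall i, D (t i + h)) ->
    (forall i, measurable (B i)) ->
    P [set w | forall i, B i (Z (t i + h) w)] =
    P [set w | forall i, B i (Z (t i) w)].

(* The time domain of the process may be [0, T] only, so the covariance at a
   negative lag is given by evenness. *)
Definition covariance_function (Z : R -> Om -> R) (tau : R) : R :=
  fine 'E_P[(fun w => Z 0 w * Z `|tau| w)%R]%E.

(* At an end point of D the derivative is one-sided. *)
Definition C1_on (D : set R) (f : R -> R) : Prop :=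
  exists df : R -> R, {within D, continuous df} /\
    forall s, D s ->
      (f x - f s) / (x - s) @[x --> within D s^'] --> df s.

End GaussianProcesses.

Section CompoundPoisson.
Context (d : measure_display) (Om : measurableType d) (R : realType)
  (P : probability Om R).

(* A simple counting process; [nu] is only constrained at times t >= 0. *)
Definition counting_path (f : R -> nat) : Prop :=
  [/\ f 0 = 0%N,
      forall s t, 0 <= s -> s <= t -> (f s <= f t)%N,
      forall t, 0 <= t -> \forall x \near t^'+, f x = f t
    & forall t, 0 < t -> \forall x \near t^'-, (f t <= (f x).+1)%N].

Definition poisson_process (lambda : R) (nu : R -> Om -> nat) : Prop :=
  [/\ forall w, counting_path (nu ^~ w),
      forall s t k, 0 <= s -> s < t ->
        P [set w | (nu t w - nu s w)%N = k] =
        (poisson_pmf (lambda * (t - s)) k)%:E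
    & forall t : nat -> R, 0 <= t 0%N -> {homo t : i j / (i <= j)%N >-> i <= j} ->
        independent_family P (fun i w => (nu (t i.+1) w - nu (t i) w)%N)].

Definition standard_gaussian (X : Om -> R) : Prop :=
  forall B : set R, measurable B -> P (X @^-1` B) = normal_prob 0 1 B.

(* [xi n] is the (n+1)-st jump. *)
Definition compound (nu : R -> Om -> nat) (xi : nat -> Om -> R)
    (t : R) (w : Om) : R := \sum_(n < nu t w) xi n w.

Definition p_coef (lambda T : R) (nu : R -> Om -> nat) (n : nat) : R :=
  (lambda * T)^-1 * fine (P [set w | (n <= nu T w)%N]).

(* The second parameter of [normal_pdf] is the standard deviation. *)
Definition mixture_pdf (lambda T : R) (nu : R -> Om -> nat) (x : R) : \bar R :=
  (\sum_(1 <= n <oo)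
     (p_coef lambda T nu n * normal_pdf 0 (Num.sqrt n%:R) x)%:E)%E.

End CompoundPoisson.

Section Crossings.
Context (R : realType).

Definition std_normal_cdf (x : R) : R := fine (normal_prob 0 1 `]-oo, x]).

Definition std_normal_ccdf (x : R) : R := 1 - std_normal_cdf x.

Definition continuous_upcrossings (T u : R) (f : R -> R) : \bar R :=
  counting [set s | [/\ 0 < s < T, {for s, continuous f}, f s = u,
                        derivable f s 1 & 0 < derive1 f s]].

(* The left limit f(s-) only makes sense on [0, T] at points s > 0. *)
Definition discontinuous_upcrossings (T u : R) (f : R -> R) : \bar R :=
  counting [set s | 0 < s <= T /\
              exists l : R, f x @[x --> s^'-] --> l /\ l < u < f s].

End Crossings.

(* Main.v *)
Require Import Defs.
From HB Require Import structures.
From mathcomp Require Import all_boot all_order all_algebra.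
From mathcomp Require Import all_classical all_reals all_analysis.
From mathcomp Require Import measurable_realfun.
From mathcomp Require Import ring lra.
Set Implicit Arguments.
Unset Strict Implicit.
Unset Printing Implicit Defensive.
Import Order.TTheory GRing.Theory Num.Theory.
Import numFieldNormedType.Exports.
Local Open Scope classical_set_scope.
Local Open Scope ring_scope.

(** Cut [0, T] by the grid t_i = i T / (n + 1) and count the cells in which X goes from below to
    above u, separately for the cells on which J does not change and for the others.  Almost surely X
    avoids u at the grid points, is never tangent to u, and does not touch u from either side of a
    jump.  On such a path the first count is at most U^c and eventually at least the size of any
    finite set of continuous crossings, while the second is bounded by nu_T and eventually equals U^d.
    So both means are limits of sums of cell probabilities.

    J is independent of Z, and given nu it is a sum of nu_t independent standard Gaussian variables.
    By stationarity a cell of length h only involves S = (Z_0 + Z_h) / 2 and D = (Z_h - Z_0) / 2,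
    which are independent Gaussian variables; a continuous crossing means |S + J - u| < D and has
    probability h (- Gamma''(0) / (2 pi))^(1/2) phi_(k+1)(u) + o(h), uniformly in k = nu, and a jump
    across u has probability lambda h int_(x < u) Phibar(u - x) phi_(k+1)(x) dx + o(h).  Telescoping
    sum_(j < nu_t) b(j) along the grid shows that sum_i lambda h E b(nu_(t_i)) tends to
    sum_k b(k) P(nu_T > k), which produces the mixture p.

    Centered Gaussian laws are encoded by the real characteristic identity
    E cos(t X + c) = cos c exp(- (t a)^2 / 2) for all t and c, called [charN]. *)

(** * Expectations of bounded random variables *)

(** The counts of crossings are not known to be measurable in w, and Z is not given as jointly
    measurable in time and w. So only grid values are handled as random variables, the integral of a
    count is a lower integral, and each exceptional event is enclosed in a measurable null event
    written with grid values. The two counts pass to the limit differently. A cell crossed without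
    change of J always contains a continuous up-crossing, so that count stays below U^c and Fatou's
    lemma gives the other inequality without a dominating variable. A cell with a jump may be
    crossed although no jump crosses u, so the second count can exceed U^d; it is dominated by nu_T
    instead. The second derivative of Gamma at 0 is obtained from the paths: (Z_h - Z_0) / h
    converges pointwise, pointwise limits of centered Gaussian variables are Gaussian, and their
    variances converge. Origin of the constant: D has standard deviation about h a / 2 with a^2 = -
    Gamma''(0), the window |S + J - u| < D has length 2 max(D, 0), and E max(D, 0) is the standard
    deviation of D divided by (2 pi)^(1/2). *)

Lemma measurable_pre d d' (T : measurableType d) (E : measurableType d') (X : T -> E)
  (A : set E) : measurable_fun setT X -> measurable A -> measurable (X @^-1` A).
Proof. by move=> mX mA; rewrite -[X in measurable X]setTI; exact: mX. Qed.

Section bounded_measurable.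
Context d (T : measurableType d) (R : realType).
Implicit Types (f g : T -> R).

(** On a probability space these functions are all integrable, so [bmf] is the single side condition
    behind linearity, Fubini and limits of the real-valued integral. *)
Definition bmf f := measurable_fun setT f /\ exists M : R, forall x, `|f x| <= M.

Lemma bmf_cst (c : R) : bmf (fun=> c).
Proof. by split; [exact: measurable_cst|exists `|c|]. Qed.

Lemma bmfD f g : bmf f -> bmf g -> bmf (fun x => f x + g x).
Proof.
move=> [mf [M fM]] [mg [N gN]]; split; first exact: measurable_funD.
by exists (M + N) => x; rewrite (le_trans (ler_normD _ _))// lerD.
Qed.

Lemma bmfM f g : bmf f -> bmf g -> bmf (fun x => f x * g x).
Proof.
move=> [mf [M fM]] [mg [N gN]]; split; first exact: measurable_funM.
by exists (M * N) => x; rewrite normrM ler_pM.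
Qed.

Lemma bmfN f : bmf f -> bmf (fun x => - f x).
Proof.
move=> [mf [M fM]]; split; first exact: measurableT_comp.
by exists M => x; rewrite normrN.
Qed.

Lemma bmfB f g : bmf f -> bmf g -> bmf (fun x => f x - g x).
Proof. by move=> bf bg; apply: bmfD => //; exact: bmfN. Qed.

Lemma bmf_cos f : measurable_fun setT f -> bmf (fun x => cos (f x)).
Proof.
move=> mf; split.
  by apply: measurableT_comp => //; apply: continuous_measurable_fun; exact: continuous_cos.
by exists 1 => x; rewrite ler_norml cos_geN1 cos_le1.
Qed.

Lemma bmf_sin f : measurable_fun setT f -> bmf (fun x => sin (f x)).
Proof.
move=> mf; split.
  by apply: measurableT_comp => //; apply: continuous_measurable_fun; exact: continuous_sin.
by exists 1 => x; rewrite ler_norml sin_geN1 sin_le1.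
Qed.

Lemma bmf_indic (A : set T) : measurable A -> bmf (\1_A : T -> R).
Proof.
move=> mA; split; first exact: measurable_indic.
by exists 1 => x; rewrite indicE normr_nat; case: (_ \in _).
Qed.

Lemma bmf_integrable (P : probability T R) f :
  bmf f -> P.-integrable setT (EFin \o f).
Proof.
move=> [mf [M fM]]; apply: measurable_bounded_integrable => //.
  by rewrite [X in (X < _)%E]probability_setT ltry.
by exists M; split; [exact: num_real|move=> x Mx y _ /=; rewrite (le_trans (fM y))// ltW].
Qed.

End bounded_measurable.

Lemma bmf_comp d d' (T : measurableType d) (T' : measurableType d') (R : realType)
  (f : T' -> R) (g : T -> T') : bmf f -> measurable_fun setT g -> bmf (fun x => f (g x)).
Proof.
by move=> [mf [M fM]] mg; split; [exact: measurableT_comp|exists M => x].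
Qed.

Section expectation_bounded.
Context d (T : measurableType d) (R : realType) (P : probability T R).
Implicit Types (f g : T -> R).

Lemma REFin f : bmf f -> (\int[P]_x f x)%:E = (\int[P]_x (f x)%:E)%E.
Proof.
move=> bf; rewrite /Rintegral fineK//; apply: integrable_fin_num => //.
exact: bmf_integrable.
Qed.

Lemma RED f g : bmf f -> bmf g ->
  \int[P]_x (f x + g x) = \int[P]_x f x + \int[P]_x g x.
Proof. by move=> bf bg; rewrite RintegralD//; exact: bmf_integrable. Qed.

Lemma REB f g : bmf f -> bmf g ->
  \int[P]_x (f x - g x) = \int[P]_x f x - \int[P]_x g x.
Proof. by move=> bf bg; rewrite RintegralB//; exact: bmf_integrable. Qed.

Lemma REZ (c : R) f : bmf f -> \int[P]_x (c * f x) = c * \int[P]_x f x.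
Proof. by move=> bf; rewrite RintegralZl//; exact: bmf_integrable. Qed.

Lemma REcst (c : R) : \int[P]_x c = c.
Proof. by rewrite Rintegral_cst// [X in fine X]probability_setT mulr1. Qed.

Lemma RE_le f g : bmf f -> bmf g -> (forall x, f x <= g x) ->
  \int[P]_x f x <= \int[P]_x g x.
Proof. by move=> bf bg fg; apply: le_Rintegral => //; exact: bmf_integrable. Qed.

Lemma RE_ext f g : (forall x, f x = g x) -> \int[P]_x f x = \int[P]_x g x.
Proof. by move=> fg; apply: eq_Rintegral => x _; exact: fg. Qed.

Lemma RE_norm_le f g : bmf f -> bmf g -> (forall x, `|f x| <= g x) ->
  `|\int[P]_x f x| <= \int[P]_x g x.
Proof.
move=> bf bg fg; rewrite ler_norml; apply/andP; split.
  rewrite -mulN1r -REZ//; apply: RE_le => //; first by apply: bmfM => //; exact: bmf_cst.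
  by move=> x; rewrite mulN1r lerNl (le_trans _ (fg x))// -normrN ler_norm.
by apply: RE_le => // x; rewrite (le_trans _ (fg x))// ler_norm.
Qed.

Lemma RE_norm_bound f (M : R) : bmf f -> (forall x, `|f x| <= M) -> `|\int[P]_x f x| <= M.
Proof.
by move=> bf fM; rewrite -[leRHS]REcst; apply: RE_norm_le => //; exact: bmf_cst.
Qed.

Lemma RE_indic (A : set T) : measurable A -> \int[P]_x \1_A x = fine (P A).
Proof. by move=> mA; rewrite /Rintegral integral_indic// setIT. Qed.

Lemma RE_ae f g (N : set T) : bmf f -> bmf g -> measurable N -> P N = 0%E ->
  (forall x, ~ N x -> f x = g x) -> \int[P]_x f x = \int[P]_x g x.
Proof.
move=> bf bg mN N0 fg; rewrite /Rintegral; congr fine.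
apply: ae_eq_integral => //.
- by apply/measurable_EFinP; case: bf.
- by apply/measurable_EFinP; case: bg.
exists N; split=> // x /= /not_implyP[_] h; apply: contrapT => /fg fgx.
by apply: h; rewrite fgx.
Qed.

Lemma RE_cvg (f_ : nat -> T -> R) f (M : R) :
  (forall n, measurable_fun setT (f_ n)) -> (forall n x, `|f_ n x| <= M) ->
  (forall x, f_ n x @[n --> \oo] --> f x) ->
  \int[P]_x f_ n x @[n --> \oo] --> \int[P]_x f x.
Proof.
move=> mf fM cf; apply: fine_cvg.
have mfl : measurable_fun setT f.
  by apply: (@measurable_fun_cvg _ _ _ _ f_) => // x _; exact: cf.
have bf : bmf f.
  split=> //; exists M => x.
  have cn : `|f_ n x| @[n --> \oo] --> `|f x| by apply: cvg_norm; exact: cf. rewrite -(cvg_lim _ cn)//; apply: limr_le; [exact: cvgP cn|exact: nearW].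
rewrite fineK; last by apply: integrable_fin_num => //; exact: bmf_integrable.
apply: (@dominated_cvg _ _ _ P setT _ (fun n x => (f_ n x)%:E) _ (cst M%:E)) => //=.
- by move=> n; apply/measurable_EFinP.
- by move=> x _; apply: cvg_EFin; [exact: nearW|exact: cf].
- by have := bmf_integrable P (@bmf_cst _ T R M).
- by move=> n x _; rewrite lee_fin.
Qed.

End expectation_bounded.

Section fubini_bounded.
Context d1 d2 (T1 : measurableType d1) (T2 : measurableType d2) (R : realType).
Context (P1 : probability T1 R) (P2 : probability T2 R).

Lemma bmf_fubini1 (f : T1 * T2 -> R) : bmf f -> bmf (fun x => \int[P2]_y f (x, y)).
Proof.
move=> bf; have [mf [M fM]] := bf.
have bfx x : bmf (fun y => f (x, y)).
  by apply: (bmf_comp bf); exact: measurable_pair1.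
split; last first.
  exists M => x; rewrite -(REcst P2 M); apply: RE_norm_le => //; exact: bmf_cst.
have ib := bmf_integrable (P1 \x P2)%E bf.
apply/measurable_EFinP.
rewrite (_ : _ \o _ = fubini_F P2 (EFin \o f)).
  exact: measurable_fubini_F ib.
by apply/funext => x /=; rewrite (REFin _ (bfx x)).
Qed.

Lemma RE_fubini1 (f : T1 * T2 -> R) : bmf f ->
  \int[(P1 \x P2)%E]_z f z = \int[P1]_x \int[P2]_y f (x, y).
Proof.
move=> bf; have ib := bmf_integrable (P1 \x P2)%E bf.
apply: EFin_inj; rewrite (REFin _ bf) (REFin _ (bmf_fubini1 bf)).
rewrite -integral12_prod_meas1//; apply: eq_integral => x _.
by rewrite REFin//; apply: (bmf_comp bf); exact: measurable_pair1.
Qed.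

End fubini_bounded.

Lemma bmf_swap d1 d2 (T1 : measurableType d1) (T2 : measurableType d2) (R : realType)
  (f : T1 * T2 -> R) : bmf f -> bmf (fun z : T2 * T1 => f (z.2, z.1)).
Proof. by move=> bf; apply: (bmf_comp bf); apply: measurable_fun_pair. Qed.

Lemma RE_fubini d1 d2 (T1 : measurableType d1) (T2 : measurableType d2) (R : realType)
  (P1 : probability T1 R) (P2 : probability T2 R) (f : T1 * T2 -> R) : bmf f ->
  \int[P1]_x \int[P2]_y f (x, y) = \int[P2]_y \int[P1]_x f (x, y).
Proof.
move=> bf; have ib := bmf_integrable (P1 \x P2)%E bf.
apply: EFin_inj; rewrite (REFin _ (bmf_fubini1 P1 P2 bf)).
rewrite (REFin _ (bmf_fubini1 P2 P1 (bmf_swap bf))).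
transitivity (\int[P1]_x \int[P2]_y (f (x, y))%:E)%E.
  apply: eq_integral => x _; rewrite REFin//; apply: (bmf_comp bf); exact: measurable_pair1.
rewrite (Fubini ib); apply: eq_integral => x _.
by rewrite REFin//; apply: (bmf_comp bf); exact: measurable_pair2.
Qed.

(** * Independence as integration over two copies of the sample space *)

Section independence.
Context d d1 d2 (T : measurableType d) (E1 : measurableType d1) (E2 : measurableType d2).
Context (R : realType) (P : probability T R).

Definition mfun_of d' (E : measurableType d') (X : T -> E) (mX : measurable_fun setT X) :
  {mfun T >-> E} := MeasurableFun.Pack (MeasurableFun.Class (isMeasurableFun.Build _ _ _ _ _ mX)).

Lemma RE_distribution d' (E : measurableType d') (X : T -> E) (mX : measurable_fun setT X)
  (f : E -> R) : bmf f ->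
  \int[distribution P (mfun_of mX)]_y f y = \int[P]_w f (X w).
Proof.
move=> bf; rewrite /Rintegral; congr fine.
have [mf _] := bf; rewrite integral_distribution//; first exact/measurable_EFinP.
by apply: bmf_integrable; exact: (bmf_comp bf).
Qed.

Definition indep_rv (X : T -> E1) (Y : T -> E2) := forall A B, measurable A -> measurable B ->
  P (X @^-1` A `&` Y @^-1` B) = (P (X @^-1` A) * P (Y @^-1` B))%E.

(** The joint law agrees with the product of the marginal laws on rectangles, hence everywhere. The
    second sample point w' replaces conditioning on X. *)
Lemma RE_indep (X : T -> E1) (Y : T -> E2) (f : E1 * E2 -> R) :
  measurable_fun setT X -> measurable_fun setT Y -> indep_rv X Y -> bmf f ->
  \int[P]_w f (X w, Y w) = \int[P]_w \int[P]_w' f (X w, Y w').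
Proof.
move=> mX mY iXY bf.
have mXY : measurable_fun setT (fun w => (X w, Y w)) by exact: measurable_fun_pair.
rewrite -(RE_distribution mXY bf).
have E : forall A, measurable A ->
    (distribution P (mfun_of mX) \x distribution P (mfun_of mY))%E A =
    distribution P (mfun_of mXY) A.
  apply: product_measure_unique => A B mA mB.
  by rewrite -[RHS]iXY.
transitivity (\int[(distribution P (mfun_of mX) \x distribution P (mfun_of mY))%E]_z f z).
  rewrite /Rintegral; congr fine; apply: eq_measure_integral => /= A mA _.
  by rewrite -E.
rewrite RE_fubini1//.
have b1 := bmf_fubini1 (distribution P (mfun_of mX)) (distribution P (mfun_of mY)) bf.
rewrite (RE_distribution mX b1).
apply: RE_ext => w.
by rewrite (RE_distribution mY)//; apply: (bmf_comp bf); exact: measurable_pair1.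
Qed.

End independence.

(** * Gaussian integrals *)

Section normal_integrals.
Context (R : realType).
Local Notation mu := (@lebesgue_measure R).
Implicit Types (m s x z c : R).

Lemma normal_pdf_measurable_EFin m s : measurable_fun setT (fun x => (normal_pdf m s x)%:E).
Proof. by apply/measurable_EFinP; exact: measurable_normal_pdf. Qed.

(** The change of variables is made with the Radon-Nikodym derivative, which equals [normal_pdf]
    almost everywhere because both have the same integral over every measurable set. *)
Lemma ge0_integral_normal m s (f : R -> \bar R) : measurable_fun setT f ->
  (forall x, 0 <= f x)%E ->
  (\int[normal_prob m s]_x f x = \int[mu]_x (f x * (normal_pdf m s x)%:E))%E.
Proof.
move=> mf f0; pose nu := normal_prob m s.
have numu : nu `<< mu by exact: normal_prob_dominates.
rewrite -(Radon_Nikodym_SigmaFinite.change_of_variables numu)//.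
have mRN : measurable_fun setT (Radon_Nikodym_SigmaFinite.f nu mu).
  exact: measurable_int (Radon_Nikodym_SigmaFinite.f_integrable numu).
apply: ge0_ae_eq_integral => //.
- exact: emeasurable_funM.
- by apply: emeasurable_funM => //; exact: normal_pdf_measurable_EFin.
- by move=> x _; rewrite mule_ge0// Radon_Nikodym_SigmaFinite.f_ge0.
- by move=> x _; rewrite mule_ge0// lee_fin normal_pdf_ge0.
have : ae_eq mu setT (Radon_Nikodym_SigmaFinite.f nu mu) (fun x => (normal_pdf m s x)%:E).
  apply: integral_ae_eq => //.
  - exact: Radon_Nikodym_SigmaFinite.f_integrable.
  - exact: normal_pdf_measurable_EFin.
  by move=> A _ mA; rewrite -Radon_Nikodym_SigmaFinite.f_integral.
by apply: filterS => x /= h _; rewrite h.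
Qed.

(** The fundamental theorem of calculus on [- (n + 1), n + 1], with dominated convergence for the
    integral and vanishing boundary terms. The Gaussian integrations by parts on the whole line
    reduce to this. *)
Lemma integral_deriv_eq0 (F f : R -> R) :
  (forall x, is_derive x 1 F (f x)) -> continuous f ->
  mu.-integrable setT (EFin \o f) ->
  F n%:R @[n --> \oo] --> 0 -> F (- n%:R) @[n --> \oo] --> 0 ->
  (\int[mu]_x (f x)%:E = 0)%E.
Proof.
move=> dF cf intf F1 F2.
have mf : measurable_fun setT (EFin \o f) by exact: measurable_int intf.
pose I n := `[- n.+1%:R, n.+1%:R]%classic : set R.
have E n : (\int[mu]_x ((EFin \o f) \_ (I n)) x = (F n.+1%:R - F (- n.+1%:R))%:E)%E.
  rewrite -integral_mkcond (@continuous_FTC2 _ f F)//.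
  - by rewrite (@lt_trans _ _ 0)// oppr_lt0.
  - by apply: continuous_subspaceT.
  - split.
    + by move=> x _; exact: ex_derive.
    + by apply: cvg_at_right_filter; apply: differentiable_continuous; apply/derivable1_diffP; exact: ex_derive.
    + by apply: cvg_at_left_filter; apply: differentiable_continuous; apply/derivable1_diffP; exact: ex_derive.
  - by move=> x _; rewrite derive1E; exact: derive_val.
have lim0 : (\int[mu]_x ((EFin \o f) \_ (I n)) x @[n --> \oo] --> 0)%E.
  rewrite (_ : (fun n => _) = EFin \o (fun n => F n.+1%:R - F (- n.+1%:R))); last by apply/funext.
  apply: cvg_EFin; first exact: nearW.
  rewrite -[0]subr0; apply: cvgB.
    by rewrite (cvg_shiftS (fun n => F n%:R)).
  by rewrite (cvg_shiftS (fun n => F (- n%:R))).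
have lim1 : (\int[mu]_x ((EFin \o f) \_ (I n)) x @[n --> \oo] --> \int[mu]_x (f x)%:E)%E.
  apply: (@dominated_cvg _ _ _ mu setT measurableT _ _ (fun x => `|(f x)%:E|%E)).
  - by move=> n; apply/(measurable_restrictT _ (measurable_itv _)); exact: measurable_funTS.
  - move=> x _; apply: cvg_near_cst.
    near=> n; rewrite patchE ifT// inE /I/= in_itv/= -ler_norml.
    rewrite (@le_trans _ _ n%:R)//; last by rewrite ler_nat.
    by near: n; exact: nbhs_infty_ger.
  - by move=> x _.
  - exact: integrable_abse.
  - move=> n x _; rewrite patchE; case: ifP => // _.
    by rewrite abse0 abse_ge0.
exact: cvg_unique lim1 lim0.
Unshelve. all: by end_near. Qed.

Local Notation phi := (normal_pdf (0:R) 1).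

Lemma stdpdfE x : phi x = normal_peak 1 * expR (- (x ^+ 2 / 2)).
Proof.
by rewrite normal_pdfE ?oner_neq0// /normal_fun subr0 expr1n mulNr mulr2n.
Qed.

Lemma is_derive_stdpdf x : is_derive x 1 (phi : R -> R) (- x * phi x).
Proof.
rewrite (_ : normal_pdf 0 1 = fun x => normal_peak 1 * expR (- (x ^+ 2 / 2))); last first.
  by apply/funext => y; exact: stdpdfE.
apply: is_derive_eq.
by rewrite /GRing.scale/=; field.
Qed.

(** From 1 + y <= exp y at y = x^2 / 4. Half of the exponent absorbs the square; what remains has
    the shape of the density of variance 2, which is the integrable bound of the next lemma. *)
Lemma sqr_expR_le x : x ^+ 2 * expR (- (x ^+ 2 / 2)) <= 4 * expR (- (x ^+ 2 / 4)).
Proof.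
have h : x ^+ 2 <= 4 * expR (x ^+ 2 / 4).
  by rewrite -ler_pdivrMl// mulrC (le_trans _ (expR_ge1Dx _))// lerDr.
have -> : expR (- (x ^+ 2 / 4)) = expR (x ^+ 2 / 4) * expR (- (x ^+ 2 / 2)).
  by rewrite -expRD; congr expR; field.
by rewrite mulrA ler_wpM2r ?expR_ge0.
Qed.

Lemma integrable_sqr_stdpdf : mu.-integrable setT (fun x => (x ^+ 2 * phi x)%:E).
Proof.
have s2 : Num.sqrt 2 != 0 :> R by rewrite sqrtr_eq0 -ltNge.
apply: (@le_integrable _ _ _ mu setT measurableT _
  (fun x => ((4 * normal_peak 1 / normal_peak (Num.sqrt 2))%:E * (normal_pdf 0 (Num.sqrt 2) x)%:E)%E)).
- apply/measurable_EFinP; apply: measurable_funM => //.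
  exact: measurable_normal_pdf.
- move=> x _ /=; rewrite lee_fin.
  rewrite [leLHS]ger0_norm; last by apply: mulr_ge0; [exact: sqr_ge0|exact: normal_pdf_ge0].
  rewrite [leRHS]ger0_norm; last first.
    by rewrite mulr_ge0 ?normal_pdf_ge0// divr_ge0 ?mulr_ge0// normal_peak_ge0.
  rewrite stdpdfE normal_pdfE// [leRHS]mulrA divfK ?gt_eqF ?normal_peak_gt0//.
  rewrite mulrCA (mulrC 4) -[leRHS]mulrA ler_wpM2l ?normal_peak_ge0//.
  rewrite (le_trans (sqr_expR_le _))// ler_wpM2l// ler_expR /normal_fun subr0.
  by rewrite sqr_sqrtr// mulNr (_ : 2 *+ 2 = 4)// -mulr_natr -natrM.
- by apply: integrableZl => //; exact: integrable_normal_pdf.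
Qed.

Lemma cvg_invS_0 (C : R) : C / n.+1%:R @[n --> \oo] --> 0.
Proof.
by rewrite -[X in _ --> X](mulr0 C); apply: cvgMr; exact: cvg_harmonic.
Qed.

Lemma cvg_stdpdf_tails (g : R -> R) : (forall x, `|g x| <= 1 + `|x|) ->
  (g n%:R * phi n%:R @[n --> \oo] --> 0) /\ (g (- n%:R) * phi (- n%:R) @[n --> \oo] --> 0).
Proof.
move=> gb.
(* Here |g x| <= 2 |x|, and x^2 phi(x) <= 4 phi(0), so the product is at most 8 phi(0) / |x|. *)
have key x (n : nat) : `|x| = n.+1%:R -> `|g x * phi x| <= (8 * normal_peak 1) / n.+1%:R.
  move=> xn.
  have n0 : (0 : R) < n.+1%:R by [].
  rewrite ler_pdivlMr// normrM (ger0_norm (normal_pdf_ge0 _ _ _)).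
  rewrite (@le_trans _ _ ((2 * n.+1%:R) * phi x * n.+1%:R))//.
    rewrite !ler_wpM2r ?normal_pdf_ge0// (le_trans (gb _))// xn mulr2n mulrDl mul1r lerD2r.
    by rewrite ler1n.
  have -> : 2 * n.+1%:R * phi x * n.+1%:R = 2 * normal_peak 1 * (x ^+ 2 * expR (- (x ^+ 2 / 2))).
    by rewrite stdpdfE -(real_normK (num_real x)) xn; ring.
  rewrite (_ : 8 * _ = 2 * normal_peak 1 * 4); last by ring.
  rewrite ler_wpM2l ?mulr_ge0 ?normal_peak_ge0// (le_trans (sqr_expR_le _))//.
  rewrite ler_piMr// -[leRHS]expR0 ler_expR oppr_le0.
  by rewrite divr_ge0// sqr_ge0.
split.
  rewrite -(cvg_shiftS (fun n => g n%:R * phi n%:R)).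
  apply: norm_cvg0; apply: (@squeeze_cvgr _ _ _ _ (cst 0) _ _ _ _ _ (cvg_invS_0 (8 * normal_peak 1))).
    by apply: nearW => n; rewrite normr_ge0 /= key// normr_nat.
  exact: cvg_cst.
rewrite -(cvg_shiftS (fun n => g (- n%:R) * phi (- n%:R))).
apply: norm_cvg0; apply: (@squeeze_cvgr _ _ _ _ (cst 0) _ _ _ _ _ (cvg_invS_0 (8 * normal_peak 1))).
  by apply: nearW => n; rewrite normr_ge0 /= key// normrN normr_nat.
exact: cvg_cst.
Qed.

Lemma integrable_stdpdf (g : R -> R) : measurable_fun setT g ->
  (forall x, `|g x| <= 1 + x ^+ 2) -> mu.-integrable setT (fun x => (g x * phi x)%:E).
Proof.
move=> mg gb.
apply: (@le_integrable _ _ _ mu setT measurableT _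
  (fun x => (phi x)%:E + (x ^+ 2 * phi x)%:E)%E).
- apply/measurable_EFinP; apply: measurable_funM => //.
  exact: measurable_normal_pdf.
- move=> x _ /=; rewrite lee_fin.
  rewrite normrM (ger0_norm (normal_pdf_ge0 _ _ _)) -[X in `|X + _|]mul1r -mulrDl [leRHS]ger0_norm; last first.
    by rewrite mulr_ge0 ?normal_pdf_ge0// addr_ge0// sqr_ge0.
  by rewrite ler_wpM2r// normal_pdf_ge0.
- by apply: integrableD => //; [exact: integrable_normal_pdf|exact: integrable_sqr_stdpdf].
Qed.

Lemma continuous_stdpdfM (g : R -> R) : continuous g -> continuous (fun x => g x * phi x).
Proof.
move=> cg x; apply: cvgM; first exact: cg.
by apply: continuous_normal_pdf; exact: oner_neq0.
Qed.

(** The function x phi(x) has derivative phi(x) - x^2 phi(x) and vanishes at infinity, so the two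
    terms have equal integrals. *)
Lemma normal01_sqr : (\int[normal_prob (0:R) 1]_x (x ^+ 2)%:E = 1)%E.
Proof.
rewrite ge0_integral_normal//; last 2 first.
- by apply/measurable_EFinP.
- by move=> x; rewrite lee_fin sqr_ge0.
have iphi : mu.-integrable setT (fun x => (phi x)%:E) by exact: integrable_normal_pdf.
have isq := integrable_sqr_stdpdf.
have h : (\int[mu]_x (phi x - x ^+ 2 * phi x)%:E = 0)%E.
  have [t1 t2] : _ := @cvg_stdpdf_tails id (fun x => ltac:(by rewrite lerDr)).
  have c2 := @continuous_stdpdfM (fun x => x ^+ 2) (@exprn_continuous _ 2).
  apply: (@integral_deriv_eq0 (fun x => x * phi x) _ _ _ _ t1 t2).
  - move=> x; have dp := is_derive_stdpdf x.
    apply: is_derive_eq; rewrite /GRing.scale/=; ring.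
  - move=> x; apply: cvgB; first by apply: continuous_normal_pdf; exact: oner_neq0.
    exact: c2.
  - rewrite (_ : _ \o _ = (fun x => (phi x)%:E) \- (fun x => (x ^+ 2 * phi x)%:E))%E//.
    exact: integrableB.
rewrite -(integral_normal_pdf (0:R) 1) -[RHS]sube0 -[X in (_ - X)%E]h.
rewrite -integralB//.
  by apply: eq_integral => x _; rewrite -EFinM -EFinB; congr (_%:E); ring.
rewrite (_ : (fun x => _) = (fun x => (phi x)%:E) \- (fun x => (x ^+ 2 * phi x)%:E))%E//.
exact: integrableB.
Qed.

(** On the half-line - phi is a primitive of x phi(x), so the value is phi(0) = (2 pi)^(-1/2). The
    factor (2 pi)^(-1/2) of the formula for continuous crossings comes from here. *)
Lemma normal01_pos : (\int[normal_prob (0:R) 1]_x (Num.max x 0)%:E = (normal_peak 1)%:E)%E.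
Proof.
rewrite ge0_integral_normal//; last 2 first.
- by apply/measurable_EFinP; exact: measurable_funrpos.
- by move=> x; rewrite lee_fin le_max lexx orbT.
transitivity (\int[mu]_(x in `[0%R, +oo[) (x * phi x)%:E)%E.
  rewrite [RHS]integral_mkcond; apply: eq_integral => x _; rewrite -EFinM patchE.
  case: ifPn; rewrite ?notin_setE ?inE/= in_itv/= andbT => x0.
    by rewrite max_l.
  by rewrite max_r ?mul0r// ltW// ltNge; apply/negP.
rewrite (@ge0_continuous_FTC2y _ _ (fun x => - phi x) 0 0) //.
- by rewrite -EFinB sub0r opprK stdpdfE expr0n/= mul0r oppr0 expR0 mulr1.
- by move=> x x0; rewrite mulr_ge0// normal_pdf_ge0.
- apply: continuous_subspaceT; apply: continuous_stdpdfM; exact: (fun=> cvg_id).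
- rewrite -[X in _ --> X]oppr0; apply: cvgN.
  apply/cvgrPdist_le => e e0; near=> x.
  have x0 : 0 < x by near: x; exact: nbhs_pinfty_gt.
  rewrite sub0r normrN ger0_norm ?normal_pdf_ge0//.
  rewrite (@le_trans _ _ (4 * normal_peak 1 / x ^+ 2))//.
    rewrite ler_pdivlMr ?exprn_gt0// stdpdfE mulrAC -mulrA mulrC ler_wpM2r ?normal_peak_ge0//.
    rewrite (le_trans (sqr_expR_le _))// ler_piMr// -[leRHS]expR0 ler_expR oppr_le0.
    by rewrite divr_ge0// sqr_ge0.
  have x1 : 1 <= x by near: x; exact: nbhs_pinfty_ge.
  rewrite (@le_trans _ _ (4 * normal_peak 1 / x))//.
    rewrite ler_wpM2l ?mulr_ge0 ?normal_peak_ge0// lef_pV2 ?posrE ?exprn_gt0//.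
    by rewrite ler_eXnr.
  have xe : e^-1 * (4 * normal_peak 1) <= x by near: x; apply: nbhs_pinfty_ge; rewrite num_real.
  by rewrite ler_pdivrMr// -ler_pdivrMl.
- move=> x _; have dp := is_derive_stdpdf x; exact: ex_derive.
- apply: cvg_at_right_filter; apply: cvgN; apply: continuous_normal_pdf; exact: oner_neq0.
- move=> x _; have dp := is_derive_stdpdf x; rewrite derive1E derive_val; ring.
Unshelve. all: by end_near. Qed.

Local Notation N01 := (normal_prob (0:R) 1).

Lemma normal01_integrable (g : R -> R) : measurable_fun setT g ->
  (forall x, `|g x| <= 1 + x ^+ 2) -> N01.-integrable setT (EFin \o g).
Proof.
move=> mg gb; apply/integrableP; split; first exact/measurable_EFinP.
apply: (@le_lt_trans _ _ (\int[N01]_x (1%:E + (x ^+ 2)%:E))%E).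
  apply: ge0_le_integral => //.
  - by apply/measurable_EFinP; apply: measurableT_comp => //; exact: normr_measurable.
  - by apply: emeasurable_funD => //; apply/measurable_EFinP.
  - by move=> x _ /=; rewrite lee_fin.
rewrite ge0_integralD//; last 2 first.
- by move=> x _; rewrite lee_fin sqr_ge0.
- by apply/measurable_EFinP.
by rewrite normal01_sqr integral_cst// mul1e [X in (X + _)%E]probability_setT ltry.
Qed.

(** The passage to the density for signed g: adding 1 + x^2 makes the integrand nonnegative, and the
    finite integral of 1 + x^2 is subtracted at the end. *)
Lemma integral_normal01 (g : R -> R) : measurable_fun setT g ->
  (forall x, `|g x| <= 1 + x ^+ 2) ->
  (\int[N01]_x (g x)%:E = \int[mu]_x (g x * phi x)%:E)%E.
Proof.
move=> mg gb.
have mq : measurable_fun setT (fun x : R => 1 + x ^+ 2) by apply: measurable_funD.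
have qb x : `|1 + x ^+ 2| <= 1 + x ^+ 2 by rewrite ger0_norm// addr_ge0// sqr_ge0.
have q0 x : 0 <= 1 + x ^+ 2 by rewrite addr_ge0// sqr_ge0.
have h0 x : 0 <= g x + (1 + x ^+ 2) by rewrite -lerBlDr sub0r lerNl (le_trans _ (gb x))// -normrN ler_norm.
have i1 := normal01_integrable mg gb; have i2 := normal01_integrable mq qb.
have j1 := integrable_stdpdf mg gb; have j2 := integrable_stdpdf mq qb.
have E1 : (\int[N01]_x (1 + x ^+ 2)%:E = \int[mu]_x ((1 + x ^+ 2) * phi x)%:E)%E.
  by rewrite ge0_integral_normal//; exact/measurable_EFinP.
have E2 : (\int[N01]_x (g x + (1 + x ^+ 2))%:E = \int[mu]_x ((g x + (1 + x ^+ 2)) * phi x)%:E)%E.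
  by rewrite ge0_integral_normal//; apply/measurable_EFinP; exact: measurable_funD.
move: E2; rewrite (_ : (fun x => (g x + (1 + x ^+ 2))%:E) = ((EFin \o g) \+ (EFin \o (fun x => (1 + x ^+ 2)%R)))%E)//.
rewrite integralD//= E1.
rewrite (_ : (fun x => ((g x + (1 + x ^+ 2)) * phi x)%:E) = (fun x => (g x * phi x)%:E) \+ (fun x => ((1 + x ^+ 2) * phi x)%:E))%E; last first.
  by apply/funext => x /=; rewrite mulrDl.
rewrite integralD// => /(congr1 (fun y => y - \int[mu]_x ((1 + x ^+ 2) * phi x)%:E)%E).
by rewrite !addeK//; exact: integrable_fin_num.
Qed.

(** Integration by parts: sin(z x + c) phi(x) vanishes at infinity, so its derivative has integral
    0. *)
Lemma normal01_sin_parts z c :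
  \int[N01]_x (- x * sin (z * x + c)) = - z * \int[N01]_x cos (z * x + c).
Proof.
have mz : measurable_fun setT (fun x : R => z * x + c).
  by apply: measurable_funD => //; exact: measurable_funM.
have [ms _] := bmf_sin mz; have [mc _] := bmf_cos mz.
have bs : forall x, `|- x * sin (z * x + c)| <= 1 + x ^+ 2.
  move=> x; rewrite normrM normrN (@le_trans _ _ `|x|)//.
    by rewrite ler_piMr// ler_norml sin_geN1 sin_le1.
  have [x1|x1] := leP `|x| 1; first by rewrite (le_trans x1)// lerDl sqr_ge0.
  by rewrite -real_normK ?num_real// (@le_trans _ _ (`|x| ^+ 2))// ?ler_eXnr ?lerDr// ltW.
have bc : forall x, `|cos (z * x + c)| <= 1 + x ^+ 2.
  by move=> x; rewrite (@le_trans _ _ 1)// ?lerDl ?sqr_ge0// ler_norml cos_geN1 cos_le1.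
have mxs : measurable_fun setT (fun x => - x * sin (z * x + c)).
  by apply: measurable_funM => //; exact: measurableT_comp.
have ix := normal01_integrable mxs bs; have ic := normal01_integrable mc bc.
have jx := integrable_stdpdf mxs bs; have jc := integrable_stdpdf mc bc.
have E1 : \int[N01]_x (- x * sin (z * x + c)) = \int[mu]_x (- x * sin (z * x + c) * phi x).
  by rewrite /Rintegral integral_normal01.
have E2 : \int[N01]_x cos (z * x + c) = \int[mu]_x (cos (z * x + c) * phi x).
  by rewrite /Rintegral integral_normal01.
rewrite E1 E2; apply/eqP; rewrite mulNr -addr_eq0; apply/eqP.
have jzc : mu.-integrable setT (fun x => (z * (cos (z * x + c) * phi x))%:E).
  by under eq_fun do rewrite EFinM; exact: integrableZl.
rewrite -RintegralZl// -RintegralD//.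
have dF (x : R) : is_derive x 1 (fun x : R => sin (z * x + c) * phi x)
    (- x * sin (z * x + c) * phi x + z * (cos (z * x + c) * phi x)).
  have dp := is_derive_stdpdf x.
  apply: is_derive_eq; rewrite /GRing.scale/=; ring.
rewrite /Rintegral (integral_deriv_eq0 dF)//.
- have c1 : continuous (fun x : R => - x * sin (z * x + c)).
    move=> x; apply: cvgM; first by apply: cvgN; exact: cvg_id.
    apply: (cvg_comp (fun x => z * x + c) sin); last exact: continuous_sin.
    by apply: cvgD; [apply: cvgM; [exact: cvg_cst|exact: cvg_id]|exact: cvg_cst].
  have c2 : continuous (fun x : R => cos (z * x + c)).
    move=> x; apply: (cvg_comp (fun x => z * x + c) cos); last exact: continuous_cos.
    by apply: cvgD; [apply: cvgM; [exact: cvg_cst|exact: cvg_id]|exact: cvg_cst].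
  move=> x; apply: cvgD; first exact: (continuous_stdpdfM c1).
  by apply: cvgM; [exact: cvg_cst|exact: (continuous_stdpdfM c2)].
- by rewrite /comp; under eq_fun do rewrite EFinD; exact: integrableD.
- have [] // := @cvg_stdpdf_tails (fun x => sin (z * x + c)).
  by move=> x; rewrite (@le_trans _ _ 1) ?lerDl// ler_norml sin_geN1 sin_le1.
- have [] // := @cvg_stdpdf_tails (fun x => sin (z * x + c)).
  by move=> x; rewrite (@le_trans _ _ 1) ?lerDl// ler_norml sin_geN1 sin_le1.
Qed.

(** As a function of z the integral solves h' = - z h, by differentiation under the integral and the
    previous lemma. So h(z) exp(z^2 / 2) is constant, with value cos c at z = 0. *)
Lemma normal01_cos z c :
  \int[N01]_x cos (z * x + c) = cos c * expR (- (z ^+ 2 / 2)).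
Proof.
pose f (z x : R) := cos (z * x + c).
have dcos (w x : R) : is_derive w 1 (f ^~ x) (- x * sin (w * x + c)).
  by rewrite /f; apply: is_derive_eq; rewrite /GRing.scale/=; ring.
have mz w : measurable_fun setT (fun x : R => w * x + c).
  by apply: measurable_funD => //; exact: measurable_funM.
have bf w : bmf (f w) by exact: bmf_cos.
have dg (w : R) : is_derive w 1 (fun w => \int[N01]_x f w x) (- w * \int[N01]_x f w x).
  have Iw : `]w - 1, w + 1[%classic w by rewrite /= in_itv/= ltrBlDr ltrDl ltr01.
  have iG : N01.-integrable setT (EFin \o (fun x : R => `|x|)).
    apply: normal01_integrable; first exact: normr_measurable.
    move=> x; rewrite normr_id.
    have [x1|x1] := leP `|x| 1; first by rewrite (le_trans x1)// lerDl sqr_ge0.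
    by rewrite -real_normK ?num_real// (@le_trans _ _ (`|x| ^+ 2))// ?ler_eXnr ?lerDr// ltW.
  have p1 (w' x : R) : partial1of2 f w' x = - x * sin (w' * x + c).
    by rewrite /partial1of2 derive1E derive_val.
  have i1 (w' : R) : `]w - 1, w + 1[%classic w' -> N01.-integrable setT (EFin \o f w').
    by move=> _; exact: (bmf_integrable N01 (bf w')).
  have d1 (w' x : R) : `]w - 1, w + 1[%classic w' -> setT x -> derivable (f ^~ x) w' 1.
    by move=> _ _; have := dcos w' x => ?; exact: ex_derive.
  have b1 (w' x : R) : `]w - 1, w + 1[%classic w' -> setT x -> `|partial1of2 f w' x| <= `|x|.
    by move=> _ _; rewrite p1 normrM normrN ler_piMr// ler_norml sin_geN1 sin_le1.
  split.
    exact: (derivable_under_integral measurableT Iw i1 d1 (fun x => normr_ge0 x) iG b1).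
  rewrite -derive1E.
  rewrite (differentiation_under_integral measurableT Iw i1 d1 (fun x => normr_ge0 x) iG b1).
  under eq_Rintegral do rewrite p1.
  exact: normal01_sin_parts.
have h : \int[N01]_x f z x * expR (z ^+ 2 / 2) = \int[N01]_x f 0 x * expR (0 ^+ 2 / 2).
  apply: (@is_derive_0_is_cst _ (fun w => \int[N01]_x f w x * expR (w ^+ 2 / 2))) => w.
  have ? := dg w.
  apply: is_derive_eq; rewrite /GRing.scale/=; field => //.
rewrite -[LHS](mulfK (lt0r_neq0 (expR_gt0 (z ^+ 2 / 2)))) h expRN.
rewrite expr0n/= mul0r expR0 mulr1; congr (_ / _).
rewrite -[RHS](REcst N01); apply: RE_ext => x; by rewrite /f mul0r add0r.
Qed.

Lemma normal_pdf_scale m s x : 0 < s -> s * normal_pdf m s (m + s * x) = phi x.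
Proof.
move=> s0; rewrite stdpdfE normal_pdfE ?gt_eqF// /normal_fun.
have -> : normal_peak 1 = s * normal_peak s :> R.
  rewrite /normal_peak expr1n mul1r -mulrnAr sqrtrM ?sqr_ge0// sqrtr_sqr ger0_norm ?ltW//.
  by rewrite invfM mulrA divff ?gt_eqF// mul1r.
by rewrite mulrA; congr (_ * expR _); rewrite addrC addKr; field; rewrite gt_eqF.
Qed.

Lemma integral_normal_scale m s (f : R -> R) : 0 < s -> continuous f -> (forall x, 0 <= f x) ->
  (\int[normal_prob m s]_x (f x)%:E = \int[N01]_x (f (m + x * s))%:E)%E.
Proof.
move=> s0 cf f0.
have mf : measurable_fun setT f by exact: continuous_measurable_fun.
have dF (x : R) : is_derive x 1 (fun x : R => m + x * s) s.
  by apply: is_derive_eq; rewrite /GRing.scale/=; ring.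
have F'E : ((fun x : R => m + x * s)^`())%classic = cst s.
  by apply/funext => x; rewrite derive1E derive_val.
have E1 : (\int[normal_prob m s]_x (f x)%:E = \int[mu]_x (f x * normal_pdf m s x)%:E)%E.
  by apply: ge0_integral_normal; [exact/measurable_EFinP|move=> x; rewrite lee_fin].
have E2 : (\int[N01]_x (f (m + x * s))%:E = \int[mu]_x (f (m + x * s) * phi x)%:E)%E.
  apply: (@ge0_integral_normal 0 1 (fun x => (f (m + x * s))%:E)); last by move=> x; rewrite lee_fin.
  apply/measurable_EFinP; apply: (measurableT_comp mf); apply: measurable_funD => //.
  exact: measurable_funM.
rewrite E1 E2.
rewrite (@increasing_ge0_integration_by_substitutionT _ (fun x => m + x * s)).
- apply: eq_integral => x _; rewrite F'E /=; congr (_%:E).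
  rewrite -(normal_pdf_scale m _ s0) !fctE /= (mulrC s x).
  rewrite -mulrA; congr (_ * _); exact: mulrC.
- by move=> x y xy; rewrite ltrD2l ltr_pM2r.
- by rewrite F'E => x; exact: cvg_cst.
- by rewrite F'E; exact: is_cvg_cst.
- by rewrite F'E; exact: is_cvg_cst.
- by move=> x; exact: ex_derive.
- apply: (cvg_comp (fun x => x * s) (fun x => m + x)); last exact: cvg_addrl_Ny.
  by apply: gt0_cvgMlNy => //; exact: cvg_id.
- apply: (cvg_comp (fun x => x * s) (fun x => m + x)); last exact: cvg_addrl.
  by apply: gt0_cvgMly => //; exact: cvg_id.
- move=> x; apply: cvgM; first exact: cf.
  by apply: continuous_normal_pdf; rewrite gt_eqF.
- by move=> x; rewrite mulr_ge0// normal_pdf_ge0.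
Qed.

End normal_integrals.

(** * Uniqueness of laws on the line *)

(** The Gaussian kernel is its own characteristic function: it is the mean of cos(y (x - X) / e)
    over a standard normal y. By Fubini the smoothed law of X, weighted by W, is expressed through
    the integrals of cos(t X + c) W alone. *)
Lemma fubini_kernel d (T : measurableType d) (R : realType) (P : probability T R)
  (X W : T -> R) (x e : R) : measurable_fun setT X -> bmf W ->
  \int[P]_w (expR (- (((x - X w) / e) ^+ 2 / 2)) * W w) =
  \int[normal_prob (0:R) 1]_y \int[P]_w (cos ((- y / e) * X w + y * x / e) * W w).
Proof.
move=> mX bW.
have mf : measurable_fun setT (fun z : T * R => - z.2 / e * X z.1 + z.2 * x / e).
  apply: measurable_funD; apply: measurable_funM => //.
  - by apply: measurable_funM => //; apply: measurableT_comp => //; exact: measurable_snd.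
  - by apply: measurableT_comp => //; exact: measurable_fst.
  - by apply: measurable_funM => //; exact: measurable_snd.
have bf : bmf (fun z : T * R => cos (- z.2 / e * X z.1 + z.2 * x / e) * W z.1).
  by apply: bmfM; [exact: bmf_cos|apply: (bmf_comp bW); exact: measurable_fst].
rewrite -(RE_fubini P (normal_prob (0:R) 1) bf) /=; apply: RE_ext => w.
have -> : expR (- (((x - X w) / e) ^+ 2 / 2)) =
    \int[normal_prob (0:R) 1]_y cos ((x - X w) / e * y + 0).
  by rewrite normal01_cos cos0 mul1r.
rewrite mulrC -REZ.
  apply: RE_ext => y; rewrite mulrC; congr (cos _ * _); ring.
apply: bmf_cos; apply: measurable_funD => //; exact: measurable_funM.
Qed.

Section uniqueness.
Context d1 d2 (T1 : measurableType d1) (T2 : measurableType d2) (R : realType).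
Context (P1 : probability T1 R) (P2 : probability T2 R).

(** If N is standard normal and independent of X, then X + e N has a density even if X has none,
    namely the mean of the normal density centered at X. The weight W is carried along. *)
Lemma smoothing_kernel d (T : measurableType d) (P : probability T R) (X W : T -> R) (g : R -> R) (e : R) :
  0 < e -> measurable_fun setT X -> bmf W -> (forall w, 0 <= W w) ->
  continuous g -> (exists M : R, forall x, `|g x| <= M) -> (forall x, 0 <= g x) ->
  (\int[P]_w (W w * \int[normal_prob (0:R) 1]_y g (X w + y * e)))%:E =
  (\int[lebesgue_measure]_x ((g x)%:E * (normal_peak e * \int[P]_w (expR (- (((x - X w) / e) ^+ 2 / 2)) * W w))%:E))%E.
Proof.
move=> e0 mX bW W0 cg gM g0.
have mg : measurable_fun setT g by exact: continuous_measurable_fun.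
have bg : bmf g by split.
have mXe : measurable_fun setT (fun z : T * R => X z.1 + z.2 * e).
  apply: measurable_funD; first by apply: measurableT_comp => //; exact: measurable_fst.
  by apply: measurable_funM => //; exact: measurable_snd.
have bgX : bmf (fun z : T * R => g (X z.1 + z.2 * e)) by exact: bmf_comp.
have b1 : bmf (fun w => \int[normal_prob (0:R) 1]_y g (X w + y * e)).
  exact: (bmf_fubini1 P (normal_prob (0:R) 1) bgX).
have bgs s : bmf (fun y : R => g (s + y * e)).
  by apply: (bmf_comp bg); apply: measurable_funD => //; exact: measurable_funM.
rewrite (REFin P (bmfM bW b1)).
transitivity (\int[P]_w \int[lebesgue_measure]_x (W w * g x * normal_pdf (X w) e x)%:E)%E.
  apply: eq_integral => w _; rewrite EFinM.
  have -> : (\int[normal_prob (0:R) 1]_y g (X w + y * e))%:E = (\int[normal_prob (X w) e]_x (g x)%:E)%E.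
    by rewrite integral_normal_scale// -(REFin (normal_prob (0:R) 1) (bgs (X w))).
  rewrite ge0_integral_normal; last 2 first.
  - by apply/measurable_EFinP.
  - by move=> x; rewrite lee_fin.
  rewrite -ge0_integralZl//.
  - by apply: eq_integral => x _; rewrite -!EFinM mulrA.
  - apply: emeasurable_funM; first exact/measurable_EFinP.
    by apply/measurable_EFinP; exact: measurable_normal_pdf.
  - by move=> x _; rewrite -EFinM lee_fin mulr_ge0// normal_pdf_ge0.
  - by rewrite lee_fin.
have pdfE s x : normal_pdf s e x = normal_peak e * expR (- (((x - s) / e) ^+ 2 / 2)).
  rewrite normal_pdfE ?gt_eqF// /normal_fun; congr (_ * expR _).
  by field; rewrite gt_eqF.
have mk : measurable_fun setT (fun z : T * R => expR (- (((z.2 - X z.1) / e) ^+ 2 / 2))).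
  apply: measurableT_comp => //; apply: measurableT_comp => //; apply: measurable_funM => //.
  apply: measurable_funX; apply: measurable_funM => //; apply: measurable_funB.
    exact: measurable_snd.
  by apply: measurableT_comp => //; exact: measurable_fst.
have mall : measurable_fun setT (fun z : T * R => W z.1 * g z.2 * normal_pdf (X z.1) e z.2).
  apply: measurable_funM.
    apply: measurable_funM; first by apply: measurableT_comp; [case: bW|exact: measurable_fst].
    by apply: measurableT_comp => //; exact: measurable_snd.
  under eq_fun do rewrite pdfE.
  exact: measurable_funM.
etransitivity.
  apply: (@fubini_tonelli _ _ _ _ _ P lebesgue_measure (fun z : T * R => (W z.1 * g z.2 * normal_pdf (X z.1) e z.2)%:E)).
  - exact/measurable_EFinP.
  - by move=> z; rewrite lee_fin !mulr_ge0// normal_pdf_ge0.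
apply: eq_integral => x _ /=.
have bk : bmf (fun w => expR (- (((x - X w) / e) ^+ 2 / 2)) * W w).
  apply: bmfM => //; split.
    by apply: (measurable_comp measurableT _ mk (measurable_pair2 x)) => //.
  exists 1 => w; rewrite ger0_norm ?expR_ge0// -expR0 ler_expR oppr_le0.
  by rewrite divr_ge0// sqr_ge0.
rewrite EFinM REFin// -ge0_integralZl//; last 3 first.
- by apply/measurable_EFinP; case: bk.
- by move=> w _; rewrite lee_fin mulr_ge0// expR_ge0.
- by rewrite lee_fin normal_peak_ge0.
rewrite -ge0_integralZl//; last 3 first.
- by apply: emeasurable_funM => //; apply/measurable_EFinP; case: bk.
- by move=> w _; rewrite -EFinM lee_fin !mulr_ge0 ?normal_peak_ge0 ?expR_ge0.
- by rewrite lee_fin.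
by apply: eq_integral => w _; rewrite -!EFinM pdfE; congr (_%:E); ring.
Qed.

Lemma smoothing_cvg d (T : measurableType d) (P : probability T R) (X W : T -> R) (g : R -> R) :
  measurable_fun setT X -> bmf W -> continuous g -> (exists M : R, forall x, `|g x| <= M) ->
  \int[P]_w (W w * \int[normal_prob (0:R) 1]_y g (X w + y * (n.+1%:R^-1))) @[n --> \oo] -->
  \int[P]_w (W w * g (X w)).
Proof.
move=> mX bW cg [M gM].
have mg : measurable_fun setT g by exact: continuous_measurable_fun.
have bg : bmf g by split => //; exists M.
have [mW [N WN]] := bW.
have mXe e : measurable_fun setT (fun z : T * R => X z.1 + z.2 * e).
  apply: measurable_funD; first by apply: measurableT_comp => //; exact: measurable_fst.
  by apply: measurable_funM => //; exact: measurable_snd.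
have bgs s e : bmf (fun y : R => g (s + y * e)).
  by apply: (bmf_comp bg); apply: measurable_funD => //; exact: measurable_funM.
have bI e := bmf_fubini1 P (normal_prob (0:R) 1) (bmf_comp bg (mXe e)).
apply: (@RE_cvg _ _ _ P _ _ (N * M)).
- by move=> n; apply: measurable_funM => //; case: (bI (n.+1%:R^-1)).
- move=> n w; rewrite normrM ler_pM//.
  exact: (RE_norm_bound (normal_prob (0:R) 1) (bgs _ _)).
move=> w; apply: cvgMr.
rewrite -(REcst (normal_prob (0:R) 1) (g (X w))).
apply: (@RE_cvg _ _ _ (normal_prob (0:R) 1) _ _ M).
- by move=> n; case: (bgs (X w) (n.+1%:R^-1)).
- by move=> n y.
move=> y; apply: (cvg_comp (fun n : nat => X w + y * n.+1%:R^-1) g); last exact: cg.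
have h : X w + y * n.+1%:R^-1 @[n --> \oo] --> X w + 0.
  by apply: cvgD; [exact: cvg_cst|exact: cvg_invS_0].
by rewrite addr0 in h.
Qed.

(** The smoothed integrals agree for e = 1 / (n + 1), and e tends to 0. The weights serve joint
    laws: W is a function of a second variable when independence is derived from cosines. *)
Lemma char_unique (X1 W1 : T1 -> R) (X2 W2 : T2 -> R) (g : R -> R) :
  measurable_fun setT X1 -> bmf W1 -> (forall w, 0 <= W1 w) ->
  measurable_fun setT X2 -> bmf W2 -> (forall w, 0 <= W2 w) ->
  (forall t c, \int[P1]_w (cos (t * X1 w + c) * W1 w) = \int[P2]_w (cos (t * X2 w + c) * W2 w)) ->
  continuous g -> (exists M : R, forall x, `|g x| <= M) -> (forall x, 0 <= g x) ->
  \int[P1]_w (W1 w * g (X1 w)) = \int[P2]_w (W2 w * g (X2 w)).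
Proof.
move=> mX1 bW1 W10 mX2 bW2 W20 H cg gM g0.
have c1 := smoothing_cvg (P := P1) mX1 bW1 cg gM.
have c2 := smoothing_cvg (P := P2) mX2 bW2 cg gM.
apply: cvg_unique c1 _ => //.
rewrite (_ : (fun n : nat => _) = (fun n : nat => \int[P2]_w (W2 w * \int[normal_prob (0:R) 1]_y g (X2 w + y * (n.+1%:R^-1))))) //.
apply/funext => n; apply: EFin_inj.
rewrite !smoothing_kernel//; apply: eq_integral => x _; congr (_ * (_ * _)%:E)%E.
rewrite !fubini_kernel//; apply: RE_ext => y; exact: H.
Qed.

End uniqueness.

Lemma measure_rays_unique (R : realType) (m1 m2 : {measure set R -> \bar R}) :
  (forall x : R, m1 `]-oo, x[%classic = m2 `]-oo, x[%classic) -> (m1 setT < +oo)%E ->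
  forall A, measurable A -> m1 A = m2 A.
Proof.
move=> H fin; apply: (@measure_unique _ _ _ (@RGenInftyO.G R) (fun n => `]-oo, n%:R[%classic)).
- exact: RGenInftyO.measurableE.
- move=> _ _ [x ->] [y ->]; exists (Num.min x y).
  by apply/seteqP; split => z /=; rewrite !in_itv/= lt_min => /andP.
- by move=> n; eexists.
- apply/seteqP; split => // x _ /=; near \oo => n; exists n => //=.
  rewrite in_itv/= (@lt_le_trans _ _ (x + 1)) ?ltrDl//.
  by near: n; exact: nbhs_infty_ger.
- by move=> _ [x ->].
- move=> k; apply: le_lt_trans fin; apply: le_measure; rewrite ?inE//.
Unshelve. all: by end_near. Qed.

Section ramp.
Context (R : realType).
Implicit Types (a s : R).

(** Continuous functions increasing to the indicator of the open ray []-oo, a[]. They carry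
    equalities of integrals of continuous functions over to probabilities of rays. *)
Definition ramp a (n : nat) s : R := Num.min 1 (n%:R * Num.max 0 (a - s)).

Lemma ramp_ge0 a n s : 0 <= ramp a n s.
Proof. by rewrite le_min ler01 mulr_ge0// le_max lexx. Qed.

Lemma ramp_le1 a n s : ramp a n s <= 1.
Proof. by rewrite ge_min lexx. Qed.

Lemma ramp_norm a n s : `|ramp a n s| <= 1.
Proof. by rewrite ger0_norm ?ramp_ge0 ?ramp_le1. Qed.

Lemma continuous_ramp a n : continuous (ramp a n).
Proof.
move=> s.
apply: (@continuous_min R R (cst 1) (fun s => n%:R * Num.max 0 (a - s))); first exact: cvg_cst.
apply: cvgM; first exact: cvg_cst.
apply: (@continuous_max R R (cst 0) (fun s => a - s)); first exact: cvg_cst.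
by apply: cvgB; [exact: cvg_cst|exact: cvg_id].
Qed.

Lemma measurable_ramp a n : measurable_fun setT (ramp a n).
Proof. by apply: continuous_measurable_fun; exact: continuous_ramp. Qed.

Lemma ramp_cvg a s : ramp a n s @[n --> \oo] --> (\1_(`]-oo, a[%classic) s : R).
Proof.
apply: cvg_near_cst; rewrite indicE; case: (ltP s a) => sa.
  rewrite mem_set/= ?in_itv//=.
  near=> n; rewrite /ramp max_r ?subr_ge0 ?ltW//.
  rewrite min_l// -ler_pdivrMr ?subr_gt0// mul1r.
  by near: n; exact: nbhs_infty_ger.
rewrite memNset/=; last by rewrite in_itv/= ltNge sa.
by apply: nearW => n; rewrite /ramp max_l ?subr_le0// mulr0 min_r.
Unshelve. all: by end_near. Qed.

End ramp.

Section law_unique.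
Context d1 d2 (T1 : measurableType d1) (T2 : measurableType d2) (R : realType).
Context (P1 : probability T1 R) (P2 : probability T2 R).

Lemma RE_ramp_cvg d (T : measurableType d) (P : probability T R) (X W : T -> R) a :
  measurable_fun setT X -> bmf W ->
  \int[P]_w (W w * ramp a n (X w)) @[n --> \oo] --> \int[P]_w (W w * \1_(`]-oo, a[%classic) (X w)).
Proof.
move=> mX [mW [M WM]]; apply: (@RE_cvg _ _ _ P _ _ (M * 1)).
- by move=> n; apply: measurable_funM => //; apply: measurableT_comp => //; exact: measurable_ramp.
- by move=> n w; rewrite normrM ler_pM ?ramp_norm.
- by move=> w; apply: cvgMr; exact: ramp_cvg.
Qed.

Lemma law_unique (X : T1 -> R) (Y : T2 -> R) :
  measurable_fun setT X -> measurable_fun setT Y ->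
  (forall t c, \int[P1]_w cos (t * X w + c) = \int[P2]_w cos (t * Y w + c)) ->
  forall A, measurable A -> P1 (X @^-1` A) = P2 (Y @^-1` A).
Proof.
move=> mX mY H A mA.
apply: (@measure_rays_unique _ (distribution P1 (mfun_of mX)) (distribution P2 (mfun_of mY))) => //; last first.
  by rewrite [ltLHS]probability_setT ltry.
move=> x.
have mx1 : measurable (X @^-1` `]-oo, x[) by exact: measurable_pre.
have mx2 : measurable (Y @^-1` `]-oo, x[) by exact: measurable_pre.
have H1 : \int[P1]_w (1 * \1_(`]-oo, x[%classic) (X w)) = \int[P2]_w (1 * \1_(`]-oo, x[%classic) (Y w)) :> R.
  have c1 := @RE_ramp_cvg _ _ P1 X (cst 1) x mX (@bmf_cst _ _ R 1).
  have c2 := @RE_ramp_cvg _ _ P2 Y (cst 1) x mY (@bmf_cst _ _ R 1).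
  apply: (cvg_unique _ c1) => //.
  rewrite (_ : (fun n : nat => _) = (fun n => \int[P2]_w (cst 1 w * ramp x n (Y w))))//.
  apply/funext => n; apply: char_unique => //; try exact: bmf_cst.
  - move=> t c; under eq_Rintegral do rewrite mulr1.
    by under [RHS]eq_Rintegral do rewrite mulr1.
  - exact: continuous_ramp.
  - by exists 1 => s; exact: ramp_norm.
  - by move=> s; exact: ramp_ge0.
move: H1; under eq_Rintegral do rewrite mul1r.
under [RHS]eq_Rintegral do rewrite mul1r.
rewrite (_ : \int[P1]_w _ = \int[P1]_w \1_(X @^-1` `]-oo, x[) w)//.
rewrite (_ : \int[P2]_w _ = \int[P2]_w \1_(Y @^-1` `]-oo, x[) w)//.
rewrite !RE_indic// => h.
by rewrite /distribution /pushforward -[LHS]fineK ?fin_num_measure// h fineK// fin_num_measure.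
Qed.

End law_unique.

Lemma integral_law d1 d2 (T1 : measurableType d1) (T2 : measurableType d2) d (E : measurableType d) (R : realType)
  (P1 : probability T1 R) (P2 : probability T2 R) (X : T1 -> E) (Y : T2 -> E) (f : E -> \bar R) :
  measurable_fun setT X -> measurable_fun setT Y ->
  (forall A, measurable A -> P1 (X @^-1` A) = P2 (Y @^-1` A)) ->
  measurable_fun setT f -> (forall x, (0 <= f x)%E) ->
  (\int[P1]_w f (X w) = \int[P2]_w f (Y w))%E.
Proof.
move=> mX mY H mf f0.
rewrite -(@ge0_integral_distribution _ _ _ _ _ P1 (mfun_of mX))//.
rewrite -(@ge0_integral_distribution _ _ _ _ _ P2 (mfun_of mY))//.
by apply: eq_measure_integral => A mA _; exact: H.
Qed.

Lemma RE_law d1 d2 (T1 : measurableType d1) (T2 : measurableType d2) d (E : measurableType d) (R : realType)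
  (P1 : probability T1 R) (P2 : probability T2 R) (X : T1 -> E) (Y : T2 -> E) (f : E -> R) :
  measurable_fun setT X -> measurable_fun setT Y ->
  (forall A, measurable A -> P1 (X @^-1` A) = P2 (Y @^-1` A)) ->
  bmf f -> \int[P1]_w f (X w) = \int[P2]_w f (Y w).
Proof.
move=> mX mY H bf.
rewrite -(RE_distribution P1 mX bf) -(RE_distribution P2 mY bf).
by rewrite /Rintegral; congr fine; apply: eq_measure_integral => A mA _; exact: H.
Qed.

(** One variable at a time: with the event of the other variable fixed, both sides are finite
    measures, and they agree on rays. *)
Lemma indep_rv_rays d (T : measurableType d) (R : realType) (P : probability T R) (X Y : T -> R) :
  measurable_fun setT X -> measurable_fun setT Y ->
  (forall a b, P (X @^-1` `]-oo, a[ `&` Y @^-1` `]-oo, b[) =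
    (P (X @^-1` `]-oo, a[) * P (Y @^-1` `]-oo, b[))%E) ->
  indep_rv P X Y.
Proof.
move=> mX mY H.
have step (U V : T -> R) (B : set T) : measurable_fun setT U -> measurable B ->
    (forall a, P (U @^-1` `]-oo, a[ `&` B) = (P (U @^-1` `]-oo, a[) * P B)%E) ->
    forall A, measurable A -> P (U @^-1` A `&` B) = (P (U @^-1` A) * P B)%E.
  move=> mU mB HU A mA.
  have PB0 : 0 <= fine (P B) by apply: fine_ge0.
  have PBE : (fine (P B))%:E = P B by rewrite fineK// fin_num_measure.
  pose m1 := pushforward (mrestr P mB) (mfun_of mU) : {measure set R -> \bar R}.
  pose m2 := mscale (NngNum PB0) (distribution P (mfun_of mU)) : {measure set R -> \bar R}.
  have m2E C : m2 C = (P (U @^-1` C) * P B)%E by rewrite muleC -PBE.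
  rewrite -m2E -[LHS]/(m1 mU A).
  apply: measure_rays_unique => //.
  - by move=> x; rewrite m2E -HU.
  - rewrite -[X in (X < _)%E]/(P (U @^-1` setT `&` B)) preimage_setT setTI.
    by rewrite (le_lt_trans (probability_le1 _ _))// ltry.
have mray (V : T -> R) x : measurable_fun setT V -> measurable (V @^-1` `]-oo, x[).
  by move=> mV; exact: measurable_pre.
move=> A B mA mB.
have mXA : measurable (X @^-1` A) by exact: measurable_pre.
rewrite setIC muleC; apply: (step Y) => // b.
rewrite setIC muleC; apply: (step X) => //; first exact: mray.
Qed.

(** [char_unique] is applied twice: in X with a cosine of Y as weight, then in Y with a ramp of X as
    weight. Letting the ramps tend to indicators gives the product formula on rays. *)
Lemma indep_rv_cos d (T : measurableType d) (R : realType) (P : probability T R) (X Y : T -> R) :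
  measurable_fun setT X -> measurable_fun setT Y ->
  (forall t c r e, \int[P]_w (cos (t * X w + c) * cos (r * Y w + e)) =
     \int[P]_w cos (t * X w + c) * \int[P]_w cos (r * Y w + e)) ->
  indep_rv P X Y.
Proof.
move=> mX mY H.
have mtX t c : measurable_fun setT (fun w => t * X w + c).
  by apply: measurable_funD => //; exact: measurable_funM.
have mtY t c : measurable_fun setT (fun w => t * Y w + c).
  by apply: measurable_funD => //; exact: measurable_funM.
have bX t c := bmf_cos (mtX t c); have bY t c := bmf_cos (mtY t c).
have bR (V : T -> R) a n : measurable_fun setT V -> bmf (fun w => ramp a n (V w)).
  move=> mV; split; first by apply: measurableT_comp => //; exact: measurable_ramp.
  by exists 1 => w; exact: ramp_norm.
have S1 r e a n : \int[P]_w (cos (r * Y w + e) * ramp a n (X w)) =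
    \int[P]_w cos (r * Y w + e) * \int[P]_w ramp a n (X w).
  (* The weight has to be nonnegative, hence 1 + cos; the contribution of 1 cancels in the end. *)
  have b1 : bmf (fun w => 1 + cos (r * Y w + e)) by apply: bmfD => //; exact: bmf_cst.
  have c0 w : 0 <= 1 + cos (r * Y w + e) by rewrite -lerBlDl sub0r cos_geN1.
  have C0 : 0 <= \int[P]_w (1 + cos (r * Y w + e)) by apply: Rintegral_ge0 => w _.
  have := @char_unique _ _ _ _ _ P P X (fun w => 1 + cos (r * Y w + e)) X
    (cst (\int[P]_w (1 + cos (r * Y w + e)))) (ramp a n) mX b1 c0 mX (bmf_cst _ _) (fun=> C0).
  have -> : \int[P]_w ((1 + cos (r * Y w + e)) * ramp a n (X w)) =
      \int[P]_w ramp a n (X w) + \int[P]_w (cos (r * Y w + e) * ramp a n (X w)).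
    rewrite -RED; [|exact: bR|by apply: bmfM => //; exact: bR].
    by apply: RE_ext => w; rewrite mulrDl mul1r.
  rewrite REZ; last exact: bR.
  rewrite RED//; last exact: bmf_cst.
  rewrite REcst mulrDl mul1r => h; apply: (addrI (\int[P]_w ramp a n (X w))); apply: h.
  - move=> t c; have -> : \int[P]_w (cos (t * X w + c) * (1 + cos (r * Y w + e))) =
      \int[P]_w cos (t * X w + c) + \int[P]_w (cos (t * X w + c) * cos (r * Y w + e)).
      rewrite -RED//; last exact: bmfM.
      by apply: RE_ext => w; rewrite mulrDr mulr1.
    rewrite H [RHS](_ : _ = (1 + \int[P]_w cos (r * Y w + e)) * \int[P]_w cos (t * X w + c)).
      by rewrite mulrDl mul1r [X in _ + X = _]mulrC.
    by rewrite -REZ//; apply: RE_ext => w /=; rewrite mulrC.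
  - exact: continuous_ramp.
  - by exists 1 => s; exact: ramp_norm.
  - by move=> s; exact: ramp_ge0.
have S2 a b n : \int[P]_w (ramp a n (X w) * ramp b n (Y w)) =
    \int[P]_w ramp a n (X w) * \int[P]_w ramp b n (Y w).
  rewrite -(REZ P _ (bR Y b n mY)).
  have C0 : 0 <= \int[P]_w ramp a n (X w) by apply: Rintegral_ge0 => w _; exact: ramp_ge0.
  apply: (@char_unique _ _ _ _ _ P P Y (fun w => ramp a n (X w)) Y
    (cst (\int[P]_w ramp a n (X w))) (ramp b n) mY (bR X a n mX) _ mY (bmf_cst _ _) (fun=> C0)).
  - by move=> w; exact: ramp_ge0.
  - move=> t c; rewrite S1 mulrC -REZ//.
    by apply: RE_ext => w; rewrite mulrC.
  - exact: continuous_ramp.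
  - by exists 1 => s; exact: ramp_norm.
  - by move=> s; exact: ramp_ge0.
apply: indep_rv_rays => // a b.
have ma : measurable (X @^-1` `]-oo, a[) by exact: measurable_pre.
have mb : measurable (Y @^-1` `]-oo, b[) by exact: measurable_pre.
  have cXY : \int[P]_w (ramp a n (X w) * ramp b n (Y w)) @[n --> \oo] -->
      \int[P]_w (\1_(X @^-1` `]-oo, a[ `&` Y @^-1` `]-oo, b[) w : R).
    apply: (@RE_cvg _ _ _ P _ _ 1).
    - by move=> n; case: (bmfM (bR X a n mX) (bR Y b n mY)).
    - by move=> n w; rewrite normrM -[leRHS]mulr1 ler_pM ?ramp_norm.
    - move=> w; rewrite indicI /=; apply: cvgM; exact: ramp_cvg.
  have cX V c : measurable_fun setT V -> \int[P]_w ramp c n (V w) @[n --> \oo] -->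
      \int[P]_w (\1_(V @^-1` `]-oo, c[) w : R).
    move=> mV; apply: (@RE_cvg _ _ _ P _ _ 1).
    - by move=> n; case: (bR V c n mV).
    - by move=> n w; rewrite ramp_norm.
    - move=> w; exact: ramp_cvg.
  have E : \int[P]_w (\1_(X @^-1` `]-oo, a[ `&` Y @^-1` `]-oo, b[) w : R) =
     \int[P]_w (\1_(X @^-1` `]-oo, a[) w : R) * \int[P]_w (\1_(Y @^-1` `]-oo, b[) w : R).
    apply: (cvg_unique _ cXY) => //.
    rewrite (_ : (fun n => _) = (fun n => \int[P]_w ramp a n (X w) * \int[P]_w ramp b n (Y w))).
      by apply: cvgM; exact: cX.
    by apply/funext => n; exact: S2.
move: E; rewrite !RE_indic//; last exact: measurableI.
by move=> h; rewrite -[LHS]fineK ?fin_num_measure ?h ?EFinM ?fineK ?fin_num_measure//; exact: measurableI.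
Qed.

(** * Characteristic identities of centered Gaussian variables *)

Section charN.
Context d (T : measurableType d) (R : realType) (P : probability T R).

(** The phase c makes one real identity carry both the real and the imaginary part of the
    characteristic function. The scale a = 0 is allowed and describes variables that are almost
    surely 0. *)
Definition charN (X : T -> R) (a : R) := [/\ measurable_fun setT X, 0 <= a &
  forall t c, \int[P]_w cos (t * X w + c) = cos c * expR (- ((t * a) ^+ 2 / 2))].

Lemma charN_scale (X : T -> R) a k : charN X a -> charN (fun w => k * X w) (`|k| * a).
Proof.
move=> [mX a0 H]; split; first exact: measurable_funM.
  exact: mulr_ge0.
move=> t c; under eq_Rintegral do rewrite mulrA.
by rewrite H !exprMn real_normK ?num_real// mulrA.
Qed.

Lemma charN_inj (X : T -> R) a b : charN X a -> charN X b -> a = b.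
Proof.
move=> [_ a0 Ha] [_ b0 Hb]; have := Ha 1 0; rewrite Hb cos0 !mul1r => /expR_inj.
by move=> h; apply/eqP; rewrite -(@eqrXn2 _ 2)// ; apply/eqP; lra.
Qed.

Lemma bmf_charN (X : T -> R) a t c : charN X a -> bmf (fun w => cos (t * X w + c)).
Proof.
by move=> [mX _ _]; apply: bmf_cos; apply: measurable_funD => //; exact: measurable_funM.
Qed.

(** The product of two cosines is half the sum of cosines of t X + r Y and t X - r Y, shifted in
    phase. The hypothesis gives the integrals of both with the same exponential, which factors, and
    the cosines of the phases recombine. *)
Lemma charN_indep (X Y : T -> R) a b : measurable_fun setT X -> measurable_fun setT Y ->
  (forall t r, charN (fun w => t * X w + r * Y w) (Num.sqrt ((t * a) ^+ 2 + (r * b) ^+ 2))) ->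
  indep_rv P X Y.
Proof.
move=> mX mY H.
have EX t c : \int[P]_w cos (t * X w + c) = cos c * expR (- ((t * a) ^+ 2 / 2)).
  have [_ _ H1] := H t 0; rewrite -[in RHS](mul1r ((t * a) ^+ 2 / 2)) -[in RHS](expr1n _ 2).
  have := H1 1 c; rewrite mul0r expr0n addr0 !exprMn sqr_sqrtr; last by rewrite mulr_ge0 ?sqr_ge0.
  by rewrite expr1n !mul1r => <-; apply: RE_ext => w; rewrite mul1r mul0r addr0.
have EY r c : \int[P]_w cos (r * Y w + c) = cos c * expR (- ((r * b) ^+ 2 / 2)).
  have [_ _ H1] := H 0 r.
  have := H1 1 c; rewrite mul0r expr0n add0r !exprMn sqr_sqrtr; last by rewrite mulr_ge0 ?sqr_ge0.
  by rewrite expr1n !mul1r => <-; apply: RE_ext => w; rewrite mul1r mul0r add0r.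
apply: indep_rv_cos => // t c r e; rewrite EX EY.
have b1 := bmf_charN 1 (c + e) (H t r).
have b2 := bmf_charN 1 (c - e) (H t (- r)).
transitivity (\int[P]_w (2^-1 * (cos (1 * (t * X w + r * Y w) + (c + e)) + cos (1 * (t * X w + - r * Y w) + (c - e))))).
  apply: RE_ext => w; rewrite !mul1r.
  rewrite (_ : t * X w + r * Y w + (c + e) = (t * X w + c) + (r * Y w + e)); last by ring.
  rewrite (_ : t * X w + - r * Y w + (c - e) = (t * X w + c) - (r * Y w + e)); last by ring.
  by rewrite [X in _ * (X + _)]cosD [X in _ * (_ + X)]cosB; field.
rewrite REZ; last exact: bmfD.
rewrite RED//; have [_ _ ->] := H t r; have [_ _ ->] := H t (- r).
rewrite !mul1r !sqr_sqrtr ?addr_ge0 ?sqr_ge0// mulNr sqrrN.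
rewrite (_ : - (((t * a) ^+ 2 + (r * b) ^+ 2) / 2) = - ((t * a) ^+ 2 / 2) + - ((r * b) ^+ 2 / 2)); last by field.
by rewrite expRD cosD cosB; field.
Qed.

(** At some t0 > 0 the limit of E cos(t0 X_n) is positive, and its logarithm turns convergence of
    the characteristic integrals into convergence of the variances. In this way the scales of
    difference quotients pass to derivatives. *)
Lemma charN_limit (X_ : nat -> T -> R) (a_ : nat -> R) (X : T -> R) :
  (forall n, charN (X_ n) (a_ n)) -> (forall w, X_ n w @[n --> \oo] --> X w) ->
  exists2 a, charN X a & a_ n @[n --> \oo] --> a.
Proof.
move=> HX cX.
have mX : measurable_fun setT X.
  by apply: (@measurable_fun_cvg _ _ _ _ X_) => [n|x _]; [case: (HX n)|exact: cX].
have cE t c : \int[P]_w cos (t * X_ n w + c) @[n --> \oo] --> \int[P]_w cos (t * X w + c).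
  apply: (@RE_cvg _ _ _ P _ _ 1).
  - by move=> n; have [] := bmf_charN t c (HX n).
  - by move=> n w; rewrite ler_norml cos_geN1 cos_le1.
  move=> w; apply: (cvg_comp (fun n => t * X_ n w + c) cos); last exact: continuous_cos.
  by apply: cvgD; [apply: cvgMr; exact: cX|exact: cvg_cst].
(* choose t0 > 0 with E cos (t0 X) > 0 *)
have [t0 t00 pos] : exists2 t0 : R, 0 < t0 & 0 < \int[P]_w cos (t0 * X w + 0).
  have c1 : \int[P]_w cos (n.+1%:R^-1 * X w + 0) @[n --> \oo] --> (1 : R).
    suff : \int[P]_w cos (n.+1%:R^-1 * X w + 0) @[n --> \oo] --> \int[P]_w (cos 0 : R).
      by rewrite REcst cos0.
    apply: (@RE_cvg _ _ _ P _ _ 1).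
    - move=> n; have [] // := @bmf_cos _ T R (fun w => n.+1%:R^-1 * X w + 0).
      by apply: measurable_funD => //; exact: measurable_funM.
    - by move=> n w; rewrite ler_norml cos_geN1 cos_le1.
    move=> w; apply: (cvg_comp (fun n : nat => n.+1%:R^-1 * X w + 0) cos); last exact: continuous_cos.
    under eq_fun do rewrite addr0 mulrC.
    exact: cvg_invS_0.
  have c0 := cvgr_gt _ c1 _ ltr01.
  near \oo => n; exists (n.+1%:R^-1) => //.
  by near: n; exact: c0.
set l := (\int[P]_w cos (t0 * X w + 0)) in pos.
have ca : (t0 * a_ n) ^+ 2 / 2 @[n --> \oo] --> - ln l.
  rewrite (_ : (fun n => _) = (fun n => - ln (\int[P]_w cos (t0 * X_ n w + 0)))).
    apply: cvgN; apply: (cvg_comp (fun n => \int[P]_w cos (t0 * X_ n w + 0)) (@ln R)).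
      exact: cE.
    exact: continuous_ln.
  by apply/funext => n; have [_ _ ->] := HX n; rewrite cos0 mul1r expRK opprK.
exists (Num.sqrt (- ln l * 2 / t0 ^+ 2)); last first.
  rewrite (_ : a_ = (fun n => Num.sqrt ((t0 * a_ n) ^+ 2 / 2 * 2 / t0 ^+ 2))); last first.
    apply/funext => n; have [_ an0 _] := HX n.
    rewrite (_ : (t0 * a_ n) ^+ 2 / 2 * 2 / t0 ^+ 2 = a_ n ^+ 2) ?sqrtr_sqr ?ger0_norm//.
    by field; rewrite gt_eqF.
  apply: (cvg_comp (fun n => (t0 * a_ n) ^+ 2 / 2 * 2 / t0 ^+ 2) Num.sqrt); last exact: sqrt_continuous.
  by apply: cvgMl; apply: cvgMl.
have ca2 : a_ n ^+ 2 @[n --> \oo] --> - ln l * 2 / t0 ^+ 2.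
  rewrite (_ : (fun n => _) = (fun n => ((t0 * a_ n) ^+ 2 / 2 * 2 / t0 ^+ 2))).
    by apply: cvgMl; apply: cvgMl.
  by apply/funext => n; field; rewrite gt_eqF.
have L0 : 0 <= - ln l * 2 / t0 ^+ 2.
  rewrite -(cvg_lim _ ca2)//; apply: limr_ge; first exact: cvgP ca2.
  by apply: nearW => n; exact: sqr_ge0.
split => // t c; apply: (cvg_unique _ (cE t c)) => //.
rewrite exprMn sqr_sqrtr//.
rewrite (_ : (fun n => _) = (fun n => cos c * expR (- (t ^+ 2 * a_ n ^+ 2 / 2)))).
  apply: cvgMr; apply: (cvg_comp (fun n => - (t ^+ 2 * a_ n ^+ 2 / 2)) expR); last exact: continuous_expR.
  by apply: cvgN; apply: cvgMl; exact: cvgMr.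
by apply/funext => n; have [_ _ ->] := HX n; rewrite exprMn.
Unshelve. all: by end_near. Qed.

End charN.

(** * Gaussian variables *)

Section charN_laws.
Context d (T : measurableType d) (R : realType) (P : probability T R).
Implicit Types (X : T -> R) (a m s : R).

Lemma RE_normal_cos m s t c : 0 < s ->
  \int[normal_prob m s]_x cos (t * (x - m) + c) = cos c * expR (- ((t * s) ^+ 2 / 2)).
Proof.
move=> s0.
have mm : measurable_fun setT (fun x : R => t * (x - m) + c).
  by apply: measurable_funD => //; apply: measurable_funM => //; exact: measurable_funB.
have b1 := bmf_cos mm.
have m2 : measurable_fun setT (fun x : R => t * s * x + c).
  by apply: measurable_funD => //; exact: measurable_funM.
have b2 := bmf_cos m2.
rewrite -normal01_cos.
(* Adding 1 makes the integrand nonnegative, as [integral_normal_scale] requires. *)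
have cf : continuous (fun x : R => 1 + cos (t * (x - m) + c)).
  move=> x; apply: cvgD; first exact: cvg_cst.
  apply: (cvg_comp (fun x => t * (x - m) + c) cos); last exact: continuous_cos.
  apply: cvgD; last exact: cvg_cst.
  by apply: cvgMr; apply: cvgB; [exact: cvg_id|exact: cvg_cst].
have f0 x : 0 <= 1 + cos (t * (x - m) + c) by rewrite -lerBlDl sub0r cos_geN1.
have := integral_normal_scale m s0 cf f0.
rewrite -(REFin (normal_prob m s) (bmfD (@bmf_cst _ _ R 1) b1)).
have -> : (\int[normal_prob (0:R) 1]_x (1 + cos (t * (m + x * s - m) + c))%:E =
   \int[normal_prob (0:R) 1]_x (1 + cos (t * s * x + c))%:E)%E.
  by apply: eq_integral => x _; congr ((1 + cos _)%:E); ring.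
rewrite -(REFin (normal_prob (0:R) 1) (bmfD (@bmf_cst _ _ R 1) b2)) => h; have {h} := EFin_inj h.
rewrite (RED (normal_prob m s) (@bmf_cst _ _ R 1) b1) (RED (normal_prob (0:R) 1) (@bmf_cst _ _ R 1) b2).
rewrite (REcst (normal_prob m s)) (REcst (normal_prob (0:R) 1)); exact: addrI.
Qed.

Lemma gaussian_variable_charN X : measurable_fun setT X -> gaussian_variable P X ->
  exists m s, charN P (fun w => X w - m) s.
Proof.
move=> mX [m [s [s0 H]]]; exists m, s; split => //; first exact: measurable_funB.
move=> t c.
have mm : measurable_fun setT (fun x : R => t * (x - m) + c).
  by apply: measurable_funD => //; apply: measurable_funM => //; exact: measurable_funB.
have b1 := bmf_cos mm.
case: (eqVneq s 0) H => [->|sn0] H.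
  rewrite mulr0 expr0n/= mul0r oppr0 expR0 mulr1 -[RHS](REcst P).
  transitivity (\int[P]_w cos (t * (cst m w - m) + c)).
    apply: (@RE_law _ _ _ _ _ _ _ P P X (cst m) (fun x => cos (t * (x - m) + c)) mX (measurable_cst _)) => // A mA.
    rewrite H// diracE preimage_cst; case: ifPn => _.
      by rewrite [RHS]probability_setT.
    by rewrite measure0.
  by apply: RE_ext => w /=; rewrite subrr mulr0 add0r.
rewrite -(@RE_normal_cos m) ?lt_def ?sn0//.
exact: (@RE_law _ _ _ _ _ _ _ P (normal_prob m s) X id (fun x => cos (t * (x - m) + c)) mX (@measurable_id _ _ _) H).
Qed.

Lemma charN_std a : 0 <= a -> charN (normal_prob (0:R) 1) (fun y => a * y) a.
Proof.
move=> a0; split => //; first exact: measurable_funM.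
by move=> t c; under eq_Rintegral do rewrite mulrA; rewrite normal01_cos.
Qed.

Lemma charN_law d' (T' : measurableType d') (P' : probability T' R) X (Y : T' -> R) a :
  charN P X a -> charN P' Y a -> forall A, measurable A -> P (X @^-1` A) = P' (Y @^-1` A).
Proof.
by move=> [mX _ HX] [mY _ HY]; apply: law_unique => // t c; rewrite HX HY.
Qed.

Lemma charN_integral X a (f : R -> \bar R) : charN P X a -> measurable_fun setT f ->
  (forall x, (0 <= f x)%E) -> (\int[P]_w f (X w) = \int[normal_prob (0:R) 1]_y f (a * y)%R)%E.
Proof.
move=> HX mf f0; have [mX a0 _] := HX; have HY := charN_std a0; have [mY _ _] := HY.
exact: (@integral_law _ _ _ _ _ _ _ P (normal_prob (0:R) 1) X (fun y => a * y) f mX mY (charN_law HX HY)).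
Qed.

Lemma charN_sqr X a : charN P X a -> (\int[P]_w (X w ^+ 2)%:E = (a ^+ 2)%:E)%E.
Proof.
move=> HX; rewrite (charN_integral (f := fun x => (x ^+ 2)%:E) HX).
- under eq_integral do rewrite exprMn EFinM.
  rewrite ge0_integralZl//.
  + by rewrite normal01_sqr mule1.
  + by apply/measurable_EFinP.
  + by move=> x _; rewrite lee_fin sqr_ge0.
  + by rewrite lee_fin sqr_ge0.
- by apply/measurable_EFinP.
- by move=> x; rewrite lee_fin sqr_ge0.
Qed.

Lemma charN_pos X a : charN P X a -> (\int[P]_w (Num.max (X w) 0)%:E = (a * normal_peak 1)%:E)%E.
Proof.
move=> HX; have [_ a0 _] := HX.
have mp : measurable_fun setT (fun x : R => Num.max x 0) by exact: measurable_funrpos.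
rewrite (charN_integral (f := fun x => (Num.max x 0)%:E) HX).
- under eq_integral => y _ do rewrite -[X in Num.max _ X](mulr0 a) -maxr_pMr// EFinM.
  rewrite ge0_integralZl//.
  + by rewrite normal01_pos.
  + by apply/measurable_EFinP.
  + by move=> x _; rewrite lee_fin le_max lexx orbT.
- by apply/measurable_EFinP.
- by move=> x; rewrite lee_fin le_max lexx orbT.
Qed.

Lemma charNN X a : charN P X a -> charN P (fun w => - X w) a.
Proof.
move=> /(charN_scale (-1)); rewrite normrN1 mul1r.
by rewrite (_ : (fun w => -1 * X w) = (fun w => - X w))//; apply/funext => w; rewrite mulN1r.
Qed.

Lemma charN_integrable X a : charN P X a -> P.-integrable setT (EFin \o X).
Proof.
move=> HX; have [mX _ _] := HX; apply/integrableP; split; first exact/measurable_EFinP.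
apply: (@le_lt_trans _ _ (\int[P]_w (1%:E + (X w ^+ 2)%:E))%E).
  apply: ge0_le_integral => //.
  - by apply/measurable_EFinP; apply: measurableT_comp => //; exact: normr_measurable.
  - by apply: emeasurable_funD => //; apply/measurable_EFinP; exact: measurable_funX.
  - move=> x _ /=; rewrite lee_fin.
    have [x1|x1] := leP `|X x| 1; first by rewrite (le_trans x1)// lerDl sqr_ge0.
    by rewrite -[X in 1 + X]real_normK ?num_real// (@le_trans _ _ (`|X x| ^+ 2))// ?ler_eXnr ?lerDr// ltW.
rewrite ge0_integralD//.
- by rewrite (charN_sqr HX) integral_cst// mul1e [X in (X + _)%E]probability_setT ltry.
- by move=> x _; rewrite lee_fin sqr_ge0.
- by apply/measurable_EFinP; exact: measurable_funX.
Qed.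

(** X and - X have the same scale, so the positive and the negative part have the same finite
    integral. *)
Lemma charN_mean X a : charN P X a -> \int[P]_w X w = 0.
Proof.
move=> HX; rewrite /Rintegral integralE.
have -> : (\int[P]_x ((fun x => (X x)%:E)^\+ x) = (a * normal_peak 1)%:E)%E.
  by rewrite -(charN_pos HX); apply: eq_integral => w _; rewrite funeposE EFin_max.
have -> : (\int[P]_x ((fun x => (X x)%:E)^\- x) = (a * normal_peak 1)%:E)%E.
  by rewrite -(charN_pos (charNN HX)); apply: eq_integral => w _; rewrite funenegE EFin_max.
by rewrite subee.
Qed.

Lemma charN_normal a : 0 < a -> charN (normal_prob (0:R) a) id a.
Proof.
move=> a0; split; [exact: measurable_id|exact: ltW|] => t c.
by rewrite -(RE_normal_cos 0 t c a0); apply: RE_ext => x; rewrite subr0.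
Qed.

Lemma charN_normal_prob X a : 0 < a -> charN P X a ->
  forall A, measurable A -> P (X @^-1` A) = normal_prob 0 a A.
Proof. by move=> a0 HX A mA; rewrite (charN_law HX (charN_normal a0)). Qed.

Lemma gaussian_centered_charN X : measurable_fun setT X -> gaussian_variable P X ->
  ('E_P[X] = 0)%E -> exists s, charN P X s.
Proof.
move=> mX gX EX; have [m [s Hs]] := gaussian_variable_charN mX gX.
have := charN_mean Hs; have i1 := charN_integrable Hs.
have i2 : P.-integrable setT (EFin \o cst m) by apply: finite_measure_integrable_cst.
have iX : P.-integrable setT (EFin \o X).
  rewrite (_ : EFin \o X = (EFin \o (fun w => X w - m)%R) \+ (EFin \o cst m))%E.
    exact: integrableD.
  by apply/funext => w /=; rewrite -EFinD subrK.
rewrite RintegralB// (REcst P) => /eqP; rewrite subr_eq0 => /eqP E.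
exists s; have : m = 0 by rewrite -E /Rintegral; move: EX; rewrite unlock => ->.
by move=> m0; move: Hs; rewrite m0; under eq_fun do rewrite subr0.
Qed.

End charN_laws.

Lemma cvgrX (R : realType) (f : nat -> R) (l : R) k : f n @[n --> \oo] --> l -> f n ^+ k @[n --> \oo] --> l ^+ k.
Proof. by move=> fl; apply: (@continuous_cvg _ _ _ _ _ f (fun x => x ^+ k)) => //; exact: exprn_continuous. Qed.

(** * Regular grids of [0, T] *)

Section grid.
Context (R : realType) (T : R).
Hypothesis (hT : 0 < T).

Definition mesh (n : nat) : R := T / n.+1%:R.

Definition grid (n i : nat) : R := i%:R * mesh n.

Lemma mesh_gt0 n : 0 < mesh n. Proof. exact: divr_gt0. Qed.

Lemma mesh_le n : mesh n <= T.
Proof. by rewrite /mesh ler_pdivrMr// -[leLHS]mulr1 ler_pM2l// ler1n. Qed.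

Lemma mesh_mul n : n.+1%:R * mesh n = T.
Proof. by rewrite /mesh mulrCA mulfV ?mulr1// pnatr_eq0. Qed.

Lemma cvg_mesh : mesh n @[n --> \oo] --> 0.
Proof. exact: cvg_invS_0. Qed.

Lemma grid0 n : grid n 0 = 0. Proof. by rewrite /grid mul0r. Qed.

Lemma gridT n : grid n n.+1 = T. Proof. exact: mesh_mul. Qed.

Lemma gridS n i : grid n i.+1 = grid n i + mesh n.
Proof. by rewrite /grid -natr1 mulrDl mul1r. Qed.

Lemma grid_ge0 n i : 0 <= grid n i.
Proof. by rewrite mulr_ge0// ltW// mesh_gt0. Qed.

Lemma grid_le n i j : (i <= j)%N -> grid n i <= grid n j.
Proof. by move=> ij; rewrite ler_wpM2r ?ler_nat// ltW// mesh_gt0. Qed.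

Lemma grid_leT n i : (i <= n.+1)%N -> grid n i <= T.
Proof. by move=> /(@grid_le n); rewrite gridT. Qed.

Lemma gridS_gt n i : grid n i < grid n i.+1.
Proof. by rewrite gridS ltrDl mesh_gt0. Qed.

End grid.

(** * The stationary Gaussian process *)

Section product_law.
Context d (T : measurableType d) d1 d2 (E1 : measurableType d1) (E2 : measurableType d2) (R : realType).
Context (P : probability T R).

Lemma pair_law_unique (X X' : T -> E1) (Y Y' : T -> E2) :
  measurable_fun setT X -> measurable_fun setT X' ->
  measurable_fun setT Y -> measurable_fun setT Y' ->
  (forall A B, measurable A -> measurable B ->
    P (X @^-1` A `&` Y @^-1` B) = P (X' @^-1` A `&` Y' @^-1` B)) ->
  forall C, measurable C ->
    P ((fun w => (X w, Y w)) @^-1` C) = P ((fun w => (X' w, Y' w)) @^-1` C).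
Proof.
move=> mX mX' mY mY' H C mC.
have m1 : measurable_fun setT (fun w => (X w, Y w)) by exact: measurable_fun_pair.
have m2 : measurable_fun setT (fun w => (X' w, Y' w)) by exact: measurable_fun_pair.
apply: (@measure_unique _ _ _ [set A `*` B | A in @measurable _ E1 & B in @measurable _ E2] (fun=> setT) _ _ _ _
  (distribution P (mfun_of m1)) (distribution P (mfun_of m2))) => //.
- by rewrite measurable_prod_measurableType.
- move=> _ _ [A mA [B mB <-]] [A' mA' [B' mB' <-]].
  exists (A `&` A'); first exact: measurableI.
  by exists (B `&` B'); [exact: measurableI|rewrite setXI].
- by move=> _; exists setT => //; exists setT => //; rewrite setXTT.
- by apply/seteqP; split => // x _; exists 0%N.
- by move=> _ [A mA [B mB <-]]; rewrite /distribution /pushforward; exact: H.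
- by move=> _; rewrite [ltLHS]probability_setT ltry.
Qed.

End product_law.

(** Limits at 0 are tested on arbitrary sequences u, whose first terms may lead out of the time
    domain. Replacing the terms larger than r by r keeps every term admissible and leaves the tail
    unchanged. *)
Lemma clip_near (R : realType) (u : nat -> R) (r : R) : 0 < r -> u n @[n --> \oo] --> 0 ->
  \forall n \near \oo, (if `|u n| <= r then u n else r) = u n.
Proof.
move=> r0 /cvgrPdist_le/(_ _ r0); apply: filterS => n.
by rewrite sub0r normrN => ->.
Qed.

Section gaussian_process_facts.
Context d (Om : measurableType d) (R : realType) (P : probability Om R) (T : R).
Context (Z : R -> {RV P >-> R}).
Hypotheses (hT : 0 < T) (Zg : gaussian_process P `[0, T] Z)
  (Zc : centered_process P `[0, T] Z) (Zs : stationary_process P `[0, T] Z)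
  (ZC1 : forall w, C1_on `[0, T] (fun t => Z t w))
  (Zv : covariance_function P Z 0 = 1).

Local Notation Gamma := (covariance_function P Z).

Lemma stationary_pair s t : 0 <= s -> s <= t -> t <= T ->
  forall C, measurable C -> P ((fun w => (Z s w, Z t w)) @^-1` C) =
    P ((fun w => (Z 0 w, Z (t - s) w)) @^-1` C).
Proof.
move=> s0 st tT; apply: pair_law_unique => // A B mA mB.
have D1 (i : 'I_2) : `[0, T]%classic (nth 0 [:: 0; t - s] i).
  by case: i => -[|[|//]] /= _; rewrite in_itv/= ?lexx ?(ltW hT)//; apply/andP; split; lra.
have D2 (i : 'I_2) : `[0, T]%classic (nth 0 [:: 0; t - s] i + s).
  by case: i => -[|[|//]] /= _; rewrite in_itv/=; apply/andP; split; lra.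
have mB' (i : 'I_2) : measurable (nth setT [:: A; B] i) by case: i => -[|[|//]].
have := @Zs 2 (fun i => nth 0 [:: 0; t - s] i) s (fun i => nth setT [:: A; B] i) D1 D2 mB'.
rewrite (_ : [set w | forall i : 'I_2, nth setT [:: A; B] i (Z (nth 0 [:: 0; t - s] i + s) w)] = Z s @^-1` A `&` Z t @^-1` B); last first.
  apply/seteqP; split => w /=.
    by move=> h; split; [have := h ord0|have := h (lift ord0 ord0)]; rewrite /= ?add0r ?subrK.
  by move=> [h1 h2] [[|[|//]]] /= _; rewrite ?add0r ?subrK.
rewrite (_ : [set w | forall i : 'I_2, nth setT [:: A; B] i (Z (nth 0 [:: 0; t - s] i) w)] = Z 0 @^-1` A `&` Z (t - s) @^-1` B)//.
apply/seteqP; split => w /=.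
  by move=> h; split; [have := h ord0|have := h (lift ord0 ord0)].
by move=> [h1 h2] [[|[|//]]] /= _.
Qed.

Lemma gp_charN t : `[0, T]%classic t -> exists v, charN P (Z t) v.
Proof.
move=> Dt.
have := Zg (fun i : 'I_1 => 1) (fun i : 'I_1 => Dt).
under eq_fun do rewrite big_ord1 mul1r.
by move=> g; exact: (gaussian_centered_charN _ g (Zc Dt)).
Qed.

(** Three times are what the slope of [Gamma] at tau takes: 0, tau and tau + e. *)
Lemma gp_comb3 r s t a b c : `[0, T]%classic r -> `[0, T]%classic s -> `[0, T]%classic t ->
  exists v, charN P (fun w => a * Z r w + b * Z s w + c * Z t w) v.
Proof.
move=> Dr Ds Dt.
have E w : \sum_(i < 3) nth 0 [:: a; b; c] i * Z (nth 0 [:: r; s; t] i) w =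
    a * Z r w + b * Z s w + c * Z t w.
  by rewrite !big_ord_recl big_ord0 /= addr0 addrA.
have D (i : 'I_3) : `[0, T]%classic (nth 0 [:: r; s; t] i) by case: i => -[|[|[|//]]].
have g := Zg (fun i => nth 0 [:: a; b; c] i) D.
move: g; under eq_fun do rewrite E; move=> g.
have iZ x : `[0, T]%classic x -> P.-integrable setT (EFin \o Z x).
  by move=> /gp_charN[v Hv]; exact: (charN_integrable Hv).
have EZ x : `[0, T]%classic x -> \int[P]_w Z x w = 0.
  by move=> /gp_charN[v Hv]; exact: (charN_mean Hv).
have ikZ k x : `[0, T]%classic x -> P.-integrable setT (fun w => (k * Z x w)%:E).
  by move=> Dx; under eq_fun do rewrite EFinM; apply: integrableZl => //; exact: iZ.
have i2 : P.-integrable setT (fun w => (a * Z r w + b * Z s w)%:E).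
  by under eq_fun do rewrite EFinD; apply: integrableD => //; exact: ikZ.
have i3 : P.-integrable setT (fun w => (a * Z r w + b * Z s w + c * Z t w)%:E).
  by under eq_fun do rewrite EFinD; apply: integrableD => //; exact: ikZ.
apply: (gaussian_centered_charN _ g).
- by apply: measurable_funD; [apply: measurable_funD|]; apply: measurable_funM.
- rewrite unlock -[LHS]fineK ?integrable_fin_num//; congr (_%:E).
  rewrite -[LHS]/(\int[P]_w (a * Z r w + b * Z s w + c * Z t w)).
  rewrite RintegralD//; last exact: ikZ.
  rewrite RintegralD//; [|exact: ikZ..].
  by rewrite !RintegralZl ?EZ ?mulr0 ?addr0//; exact: iZ.
Qed.

Definition mean_prod s t := \int[P]_w (Z s w * Z t w).

Lemma mean_prod_sym s t : mean_prod s t = mean_prod t s.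
Proof. by apply: RE_ext => w; rewrite mulrC. Qed.

Lemma mean_prod_integrable s t : `[0, T]%classic s -> `[0, T]%classic t ->
  P.-integrable setT (fun w => (Z s w * Z t w)%:E).
Proof.
have isq x : `[0, T]%classic x -> P.-integrable setT (fun w => (Z x w ^+ 2)%:E).
  move=> /gp_charN[v Hv]; apply/integrableP; split; first by apply/measurable_EFinP; exact: measurable_funX.
  under eq_integral do rewrite gee0_abs ?lee_fin ?sqr_ge0//.
  by rewrite (charN_sqr Hv) ltry.
move=> Ds Dt; have i := integrableD measurableT (isq _ Ds) (isq _ Dt).
apply: le_integrable i => //.
  by apply/measurable_EFinP; exact: measurable_funM.
move=> w _ /=; rewrite lee_fin [leRHS]ger0_norm ?addr_ge0 ?sqr_ge0// ler_norml.
have h1 := sqr_ge0 (Z s w + Z t w); have h2 := sqr_ge0 (Z s w - Z t w).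
have h3 := sqr_ge0 (Z s w); have h4 := sqr_ge0 (Z t w).
by rewrite sqrrD in h1; rewrite sqrrB in h2; apply/andP; split; lra.
Qed.

Lemma gp_comb3_var r s t a b c v : `[0, T]%classic r -> `[0, T]%classic s -> `[0, T]%classic t ->
  charN P (fun w => a * Z r w + b * Z s w + c * Z t w) v ->
  v ^+ 2 = a ^+ 2 * mean_prod r r + b ^+ 2 * mean_prod s s + c ^+ 2 * mean_prod t t +
    (2 * a * b * mean_prod r s + 2 * a * c * mean_prod r t + 2 * b * c * mean_prod s t).
Proof.
move=> Dr Ds Dt H; have /(congr1 fine) /= <- := charN_sqr H.
have iK x y k : `[0, T]%classic x -> `[0, T]%classic y ->
    P.-integrable setT (fun w => (k * (Z x w * Z y w))%:E).
  by move=> Dx Dy; under eq_fun do rewrite EFinM; apply: integrableZl => //; exact: mean_prod_integrable.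
have iD (f g : Om -> R) : P.-integrable setT (fun w => (f w)%:E) -> P.-integrable setT (fun w => (g w)%:E) ->
    P.-integrable setT (fun w => (f w + g w)%:E).
  by move=> i1 i2; under eq_fun do rewrite EFinD; exact: integrableD.
transitivity (\int[P]_w (a ^+ 2 * (Z r w * Z r w) + b ^+ 2 * (Z s w * Z s w) + c ^+ 2 * (Z t w * Z t w) +
    (2 * a * b * (Z r w * Z s w) + 2 * a * c * (Z r w * Z t w) + 2 * b * c * (Z s w * Z t w)))).
  by apply: RE_ext => w; ring.
rewrite RintegralD//; [|by do 2 (apply: (iD); last exact: iK); exact: iK|by do 2 (apply: (iD); last exact: iK); exact: iK].
rewrite RintegralD//; [|by (apply: (iD); last exact: iK); exact: iK|exact: iK].
rewrite RintegralD//; [|exact: iK..].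
rewrite RintegralD//; [|by (apply: (iD); last exact: iK); exact: iK|exact: iK].
rewrite RintegralD//; [|exact: iK..].
by rewrite !RintegralZl//; exact: mean_prod_integrable.
Qed.

Lemma itv0T : `[0, T]%classic 0.
Proof. by rewrite /= in_itv/= lexx ltW. Qed.

Lemma mean_prod_diag t : `[0, T]%classic t -> mean_prod t t = 1.
Proof.
move=> Dt; have Dt' := Dt; move: Dt'; rewrite /= in_itv/= => /andP[t0 tT].
have [v Hv] := gp_charN Dt; have [v' Hv'] := gp_charN itv0T.
have /(congr1 fine) /= E := charN_sqr Hv; have /(congr1 fine) /= E' := charN_sqr Hv'.
have Hvv' : charN P (Z 0) v.
  have [_ v0 H] := Hv; split => // x c; rewrite -H.
  have mc : measurable_fun setT (fun z : R * R => x * z.1 + c).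
    by apply: measurable_funD => //; apply: measurable_funM => //; exact: measurable_fst.
  apply/esym; apply: (@RE_law _ _ _ _ _ _ _ P P (fun w => (Z t w, Z t w)) (fun w => (Z 0 w, Z (t - t) w)) (fun z : R * R => cos (x * z.1 + c))).
  - exact: measurable_fun_pair.
  - exact: measurable_fun_pair.
  - exact: stationary_pair.
  - exact: bmf_cos.
have := Zv; rewrite /covariance_function normr0 unlock => K0.
have K00 : mean_prod 0 0 = 1 by exact: K0.
rewrite /mean_prod; under eq_Rintegral do rewrite -expr2.
rewrite -K00 /mean_prod; under [RHS]eq_Rintegral do rewrite -expr2.
by rewrite /Rintegral E E' (charN_inj Hvv' Hv').
Qed.

(** The product Z_s Z_t is unbounded, so equality of the pair laws is used on Z_s + Z_t instead: its
    scale is invariant by stationarity, and the variance formula returns the covariance. *)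
Lemma mean_prod_Gamma s t : 0 <= s -> s <= t -> t <= T -> mean_prod s t = Gamma (t - s).
Proof.
move=> s0 st tT.
have Ds : `[0, T]%classic s by rewrite /= in_itv/= s0; lra.
have Dt : `[0, T]%classic t by rewrite /= in_itv/= tT andbT; lra.
have Dts : `[0, T]%classic (t - s) by rewrite /= in_itv/=; apply/andP; split; lra.
have -> : Gamma (t - s) = mean_prod 0 (t - s).
  by rewrite /covariance_function ger0_norm ?subr_ge0// unlock.
have [v Hv] := gp_comb3 1 1 0 Ds Dt Ds.
have [v' Hv'] := gp_comb3 1 1 0 itv0T Dts itv0T.
have Hvv' : charN P (fun w => 1 * Z 0 w + 1 * Z (t - s) w + 0 * Z 0 w) v.
  have [_ v0 H] := Hv; split => //; first by case: Hv'.
  move=> x c; rewrite -H.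
  have mc : measurable_fun setT (fun z : R * R => x * (1 * z.1 + 1 * z.2) + c).
    apply: measurable_funD => //; apply: measurable_funM => //.
    by apply: measurable_funD; apply: measurable_funM.
  under eq_Rintegral do rewrite mul0r addr0.
  under [RHS]eq_Rintegral do rewrite mul0r addr0.
  apply/esym; apply: (@RE_law _ _ _ _ _ _ _ P P (fun w => (Z s w, Z t w)) (fun w => (Z 0 w, Z (t - s) w)) (fun z : R * R => cos (x * (1 * z.1 + 1 * z.2) + c))).
  - exact: measurable_fun_pair.
  - exact: measurable_fun_pair.
  - exact: stationary_pair.
  - exact: bmf_cos.
have := gp_comb3_var Ds Dt Ds Hv; have := gp_comb3_var itv0T Dts itv0T Hv'.
have d0 := itv0T; rewrite (charN_inj Hvv' Hv') => -> ; rewrite !mean_prod_diag//.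
by rewrite !expr1n expr0n/= !mul0r !mul1r !mulr0 !mulr1 !mul0r; lra.
Qed.

Lemma mem_itv t : 0 <= t -> t <= T -> `[0, T]%classic t.
Proof. by move=> t0 tT; rewrite /= in_itv/= t0 tT. Qed.

Lemma itv_bounds t : `[0, T]%classic t -> 0 <= t /\ t <= T.
Proof. by rewrite /= in_itv/= => /andP. Qed.

Definition path_deriv (w : Om) : R -> R := sval (cid (ZC1 w)).

Lemma path_deriv_continuous w : {within `[0, T], continuous (path_deriv w)}.
Proof. by rewrite /path_deriv; case: cid => f []. Qed.

Lemma path_deriv_quotient w s (x : nat -> R) : `[0, T]%classic s -> (forall n, `[0, T]%classic (x n)) ->
  (forall n, x n != s) -> x n @[n --> \oo] --> s ->
  (Z (x n) w - Z s w) / (x n - s) @[n --> \oo] --> path_deriv w s.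
Proof.
move=> Ds Dx xs cx; rewrite /path_deriv; case: cid => f /= [_ H].
apply: (cvg_comp x (fun x => (Z x w - Z s w) / (x - s)) _ (H s Ds)).
move=> A [e /= e0 eA].
have /cvgrPdist_lt/(_ _ e0) := cx.
by apply: filterS => n h; apply: eA; [exact: h|exact: xs|exact: Dx].
Qed.

Lemma path_deriv_cvg w s (x : nat -> R) : `[0, T]%classic s -> (forall n, `[0, T]%classic (x n)) ->
  x n @[n --> \oo] --> s -> path_deriv w (x n) @[n --> \oo] --> path_deriv w s.
Proof.
move=> Ds Dx cx; move=> B nB.
have : nbhs (s : subspace `[0, T]) (path_deriv w @^-1` B) by exact: (@path_deriv_continuous w s B nB).
rewrite /nbhs/= -nbhs_subspace_in// => -[e /= e0 eA].
have /cvgrPdist_lt/(_ _ e0) := cx.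
by apply: filterS => n h; apply: eA; [exact: h|exact: Dx].
Qed.

Lemma incr_var s t h : 0 <= s -> s <= t -> t <= T -> h != 0 ->
  charN P (fun w => (Z t w - Z s w) / h) (Num.sqrt (2 * (1 - Gamma (t - s)) / h ^+ 2)).
Proof.
move=> s0 st tT h0.
have Ds : `[0, T]%classic s by apply: mem_itv => //; lra.
have Dt : `[0, T]%classic t by apply: mem_itv => //; lra.
have [v Hv] := gp_comb3 (- h^-1) (h^-1) 0 Ds Dt Ds.
have := gp_comb3_var Ds Dt Ds Hv; rewrite !mean_prod_diag// mean_prod_Gamma// => E.
have v0 : 0 <= v by case: Hv.
rewrite (_ : (fun w => _) = (fun w => - h^-1 * Z s w + h^-1 * Z t w + 0 * Z s w)); last first.
  by apply/funext => w; rewrite mul0r addr0 mulrBl mulNr addrC !(mulrC h^-1).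
rewrite (_ : 2 * _ / _ = v ^+ 2); first by rewrite sqrtr_sqr ger0_norm.
rewrite E; field; exact: h0.
Qed.

Lemma charN_ext (X Y : Om -> R) a : (forall w, X w = Y w) -> charN P X a -> charN P Y a.
Proof. by move=> /funext ->. Qed.

(** The quotients (Z_h - Z_0) / h converge along every path to the derivative at 0, so their
    variances converge. The limit is the variance of the single variable Z'(0), hence the same for
    all sequences. *)
Lemma incr_limit : exists2 a : R, charN P (fun w => path_deriv w 0) a &
  forall h : nat -> R, (forall n, 0 < h n <= T) -> h n @[n --> \oo] --> 0 ->
    2 * (1 - Gamma (h n)) / h n ^+ 2 @[n --> \oo] --> a ^+ 2.
Proof.
have main (h : nat -> R) : (forall n, 0 < h n <= T) -> h n @[n --> \oo] --> 0 ->
    exists2 a : R, charN P (fun w => path_deriv w 0) a &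
    2 * (1 - Gamma (h n)) / h n ^+ 2 @[n --> \oo] --> a ^+ 2.
  move=> h0 ch.
  have Dh n : `[0, T]%classic (h n) by apply: mem_itv; have /andP[] := h0 n => // /ltW.
  have hn0 n : h n != 0 by have /andP[/gt_eqF ->] := h0 n.
  have H n : charN P (fun w => (Z (h n) w - Z 0 w) / h n) (Num.sqrt (2 * (1 - Gamma (h n)) / h n ^+ 2)).
    have [u1 u2] := itv_bounds (Dh n).
    by have := incr_var (lexx 0) u1 u2 (hn0 n); rewrite subr0.
  have [] := charN_limit H (X := fun w => path_deriv w 0).
    move=> w; have := path_deriv_quotient itv0T Dh hn0 ch (w := w).
    by under eq_cvg do rewrite subr0.
  move=> a Ha ca; exists a => //.
  have : Num.sqrt (2 * (1 - Gamma (h n)) / h n ^+ 2) ^+ 2 @[n --> \oo] --> a ^+ 2.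
    exact: cvgrX.
  apply: cvg_trans; apply: near_eq_cvg; apply: nearW => n.
  rewrite sqr_sqrtr//.
  have [u1 u2] := itv_bounds (Dh n).
  have [v Hv] := gp_comb3 1 (-1) 0 (Dh n) itv0T itv0T.
  have := gp_comb3_var (Dh n) itv0T itv0T Hv; rewrite !mean_prod_diag//; last exact: itv0T.
  rewrite (mean_prod_sym (h n)) mean_prod_Gamma// subr0 => E; rewrite divr_ge0 ?sqr_ge0//.
  rewrite (_ : 2 * _ = v ^+ 2) ?sqr_ge0// E; ring.
(* One particular sequence produces a; uniqueness of the scale transfers it to all others. *)
have [a Ha _] := main (mesh T) (fun n => ltac:(by rewrite mesh_gt0 ?mesh_le)) (cvg_mesh T).
exists a => // h h0 ch; have [a' Ha' ca'] := main h h0 ch.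
by rewrite (charN_inj Ha Ha').
Qed.

Lemma Gamma_even x : Gamma (- x) = Gamma x.
Proof. by rewrite /covariance_function normrN. Qed.

(* The variances of Y_tau +- Z'_tau, with Y_tau = (Z_tau - Z_0) / tau, determine the slope of Gamma
   at tau. *)
Lemma Gamma_derive tau : 0 < tau < T -> exists ap am : R,
  [/\ charN P (fun w => (Z tau w - Z 0 w) / tau + path_deriv w tau) ap,
      charN P (fun w => (Z tau w - Z 0 w) / tau - path_deriv w tau) am &
      is_derive tau 1 Gamma (- (tau / 4) * (ap ^+ 2 - am ^+ 2))].
Proof.
move=> /andP[tau0 tauT].
have tau0' : tau != 0 by rewrite gt_eqF.
have Dtau : `[0, T]%classic tau by apply: mem_itv; exact: ltW.
have [a0 _ Hvar] := incr_limit.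
have comb e : e != 0 -> `[0, T]%classic (tau + e) -> forall sg : R,
   exists2 v, charN P (fun w => (Z tau w - Z 0 w) / tau + sg * ((Z (tau + e) w - Z tau w) / (tau + e - tau))) v &
     v ^+ 2 = 2 * (1 - Gamma tau) / tau ^+ 2 + sg ^+ 2 * (2 * (1 - Gamma `|e|) / e ^+ 2) +
       2 * sg * (Gamma e - 1 - Gamma (tau + e) + Gamma tau) / (tau * e).
  move=> e0 De sg.
  have [v Hv] := gp_comb3 (- tau^-1) (tau^-1 - sg / e) (sg / e) itv0T Dtau De.
  exists v.
    apply: charN_ext Hv => w; rewrite [tau + e - tau]addrAC subrr add0r.
    by field; rewrite e0 tau0'.
  have := gp_comb3_var itv0T Dtau De Hv; rewrite !mean_prod_diag//; last exact: itv0T.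
  have [u1 u2] := itv_bounds De.
  rewrite (mean_prod_Gamma (lexx 0) (ltW tau0) (ltW tauT)) (mean_prod_Gamma (lexx 0) u1 u2) !subr0.
  have -> : mean_prod tau (tau + e) = Gamma e.
    have [e1|e1] := leP 0 e.
      rewrite mean_prod_Gamma//; [by rewrite addrC addKr|exact: ltW|by rewrite lerDl].
    rewrite mean_prod_sym mean_prod_Gamma//; [by rewrite opprD addrA subrr add0r Gamma_even|by rewrite gerDl ltW|exact: ltW].
  have -> : Gamma `|e| = Gamma e by rewrite /covariance_function normr_id.
  move=> ->; field; by rewrite e0 tau0'.
have main (e : nat -> R) : (forall n, e n != 0) -> (forall n, `[0, T]%classic (tau + e n)) ->
    e n @[n --> \oo] --> 0 -> exists ap am : R,
    [/\ charN P (fun w => (Z tau w - Z 0 w) / tau + path_deriv w tau) ap,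
      charN P (fun w => (Z tau w - Z 0 w) / tau - path_deriv w tau) am &
      (Gamma (tau + e n) - Gamma tau) / e n @[n --> \oo] --> - (tau / 4) * (ap ^+ 2 - am ^+ 2)].
  move=> e0 De ce.
  have lim sg : exists2 v_ : nat -> R,
      (forall n, v_ n ^+ 2 = 2 * (1 - Gamma tau) / tau ^+ 2 + sg ^+ 2 * (2 * (1 - Gamma `|e n|) / e n ^+ 2) +
       2 * sg * (Gamma (e n) - 1 - Gamma (tau + e n) + Gamma tau) / (tau * e n)) &
      exists2 a, charN P (fun w => (Z tau w - Z 0 w) / tau + sg * path_deriv w tau) a & v_ n @[n --> \oo] --> a.
    have cb n := comb (e n) (e0 n) (De n) sg.
    have HE n : exists v, charN P (fun w => (Z tau w - Z 0 w) / tau + sg * ((Z (tau + e n) w - Z tau w) / (tau + e n - tau))) v /\ v ^+ 2 = 2 * (1 - Gamma tau) / tau ^+ 2 + sg ^+ 2 * (2 * (1 - Gamma `|e n|) / e n ^+ 2) +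
       2 * sg * (Gamma (e n) - 1 - Gamma (tau + e n) + Gamma tau) / (tau * e n).
      by have [v h1 h2] := cb n; exists v.
    have [v_ Hv] := choice HE.
    exists v_; first by move=> n; have [] := Hv n.
    apply: (charN_limit (fun n => proj1 (Hv n))) => w.
    apply: cvgD; first exact: cvg_cst.
    apply: cvgMr; apply: path_deriv_quotient => //.
      by move=> n; rewrite -subr_eq0 addrAC subrr add0r.
    by rewrite -[X in _ --> X]addr0; apply: cvgD; [exact: cvg_cst|].
  have [vp Ep [ap Hap cap]] := lim 1.
  have [vm Em [am Ham cam]] := lim (-1).
  exists ap, am; split.
  - by apply: charN_ext Hap => w; rewrite mul1r.
  - by apply: charN_ext Ham => w; rewrite mulN1r.
  have ch : 2 * (1 - Gamma `|e n|) / `|e n| ^+ 2 @[n --> \oo] --> a0 ^+ 2.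
    apply: Hvar; last by rewrite -(normr0 R); exact: cvg_norm.
    move=> n; rewrite normr_gt0 e0/=; have [u1 u2] := itv_bounds (De n).
    by rewrite ler_norml; apply/andP; split; lra.
  (* Polarization: the difference of the two variances isolates the cross term, which contains the
     increment of [Gamma] at tau and also Gamma(e) - 1. The latter, divided by e, is the first
     summand here and tends to 0. *)
  rewrite (_ : (fun n => _) = (fun n => - (e n / 2) * (2 * (1 - Gamma `|e n|) / `|e n| ^+ 2) + - (tau / 4) * (vp n ^+ 2 - vm n ^+ 2))); last first.
    apply/funext => n; rewrite Ep Em real_normK ?num_real//.
    have -> : Gamma `|e n| = Gamma (e n) by rewrite /covariance_function normr_id.
    by field; rewrite e0 tau0'.
  rewrite -[X in _ --> X]add0r; apply: cvgD; last first.
    by apply: cvgMr; apply: cvgB; exact: cvgrX.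
  rewrite -(mul0r (a0 ^+ 2)); apply: cvgM => //.
  rewrite -oppr0 -(mul0r 2^-1); apply: cvgN; exact: cvgMl.
pose r := Num.min tau (T - tau) / 2.
have r0 : 0 < r by rewrite divr_gt0// lt_min tau0 subr_gt0.
have rin x : `|x| <= r -> `[0, T]%classic (tau + x).
  have r1 : r * 2 <= tau by rewrite /r divfK// ge_min lexx.
  have r2 : r * 2 <= T - tau by rewrite /r divfK// ge_min lexx orbT.
  by rewrite ler_norml => /andP[x1 x2]; apply: mem_itv; lra.
have [|||ap [am [Hap Ham _]]] := main (fun n => r / n.+1%:R).
- by move=> n; rewrite gt_eqF// divr_gt0.
- move=> n; apply: rin; rewrite ger0_norm; last by rewrite divr_ge0// ltW.
  by rewrite ler_pdivrMr// ler_peMr ?ler1n// ltW.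
- exact: cvg_invS_0.
exists ap, am; split => //.
set l := - (tau / 4) * _.
have cl : h^-1 *: (Gamma (h *: (1 : R) + tau) - Gamma tau) @[h --> 0^'] --> l.
  apply/cvgr_dnbhsP => u [u0 cu].
  pose e n := if `|u n| <= r then u n else r.
  have eu : \forall n \near \oo, e n = u n.
    exact: clip_near.
  have [|||ap' [am' [Hap' Ham' c']]] := main e.
  - by move=> n; rewrite /e; case: ifP => _; [exact: u0|rewrite gt_eqF].
  - by move=> n; rewrite /e; case: ifP => [|_]; [exact: rin|apply: rin; rewrite gtr0_norm].
  - by apply: cvg_trans cu; apply: near_eq_cvg; apply: filterS eu => n ->.
  rewrite /l (charN_inj Hap Hap') (charN_inj Ham Ham').
  apply: cvg_trans c'; apply: near_eq_cvg; apply: filterS eu => n ->.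
  by rewrite /GRing.scale/= mulr1 mulrC (addrC tau).
split; first by apply/cvg_ex; exists l.
by rewrite /derive; apply: cvg_lim.
Qed.

Lemma Gamma_derivN tau : 0 < tau < T -> derive1 Gamma (- tau) = - derive1 Gamma tau.
Proof.
move=> h; have [ap [am [_ _ d1]]] := Gamma_derive h.
have dN : is_derive (- tau) 1 (Gamma \o -%R) ((- (tau / 4) * (ap ^+ 2 - am ^+ 2)) * -1).
  have d1' : is_derive (- - tau) 1 Gamma (- (tau / 4) * (ap ^+ 2 - am ^+ 2)) by rewrite opprK.
  by apply: is_derive1_comp.
have E : Gamma \o -%R = Gamma by apply/funext => x /=; rewrite Gamma_even.
by rewrite E in dN; rewrite !derive1E !derive_val mulrN1.
Qed.

(** The quotient (Gamma(e) - 1) / e is - e / 2 times a quantity with a finite limit. *)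
Lemma Gamma_deriv0 : derive1 Gamma 0 = 0.
Proof.
have [a _ H] := incr_limit.
apply: cvg_lim => //; apply/cvgr_dnbhsP => u [u0 cu].
pose e n := if `|u n| <= T then u n else T.
have eu : \forall n \near \oo, e n = u n.
  exact: clip_near.
have ce : e n @[n --> \oo] --> 0 by apply: cvg_trans cu; apply: near_eq_cvg; apply: filterS eu => n ->.
have e0 n : e n != 0 by rewrite /e; case: ifP => _; [exact: u0|rewrite gt_eqF].
have ch : 2 * (1 - Gamma `|e n|) / `|e n| ^+ 2 @[n --> \oo] --> a ^+ 2.
  apply: H; last by rewrite -(normr0 R); exact: cvg_norm.
  move=> n; rewrite normr_gt0 e0/= /e; case: ifP => // _.
  by rewrite ger0_norm// ltW.
have : - (e n / 2) * (2 * (1 - Gamma `|e n|) / `|e n| ^+ 2) @[n --> \oo] --> 0.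
  rewrite -(mul0r (a ^+ 2)); apply: cvgM => //.
  rewrite -oppr0 -(mul0r 2^-1); apply: cvgN; exact: cvgMl.
apply: cvg_trans; apply: near_eq_cvg; apply: filterS eu => n eun.
rewrite -eun addr0 /GRing.scale/= Zv real_normK ?num_real//.
have -> : Gamma `|e n| = Gamma (e n) by rewrite /covariance_function normr_id.
by field; rewrite e0.
Qed.

(** By [Gamma_derive], Gamma'(e) / e = - (ap^2 - am^2) / 4 for e > 0, where ap and am are the scales
    of Y_e + Z'_e and Y_e - Z'_e with Y_e = (Z_e - Z_0) / e. These variables tend to 2 Z'(0) and 0,
    so the limit is - a^2 with a the scale of Z'(0). Negative e follow from evenness. *)
Lemma Gamma_second_derivative : exists2 a : R, derive1n 2 Gamma 0 = - a ^+ 2 & 0 <= a /\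
  forall h : nat -> R, (forall n, 0 < h n <= T) -> h n @[n --> \oo] --> 0 ->
    2 * (1 - Gamma (h n)) / h n ^+ 2 @[n --> \oo] --> a ^+ 2.
Proof.
have [a Ha H] := incr_limit; exists a; last by split => //; case: Ha.
rewrite /= /derive1n /=.
apply: cvg_lim => //; apply/cvgr_dnbhsP => u [u0 cu].
rewrite -/(derive1 Gamma).
pose r := T / 2.
have r0 : 0 < r by rewrite divr_gt0.
have rT : r < T by rewrite /r; move: hT; lra.
pose e n := if `|u n| <= r then u n else r.
have eu : \forall n \near \oo, e n = u n by exact: clip_near.
have ce : e n @[n --> \oo] --> 0 by apply: cvg_trans cu; apply: near_eq_cvg; apply: filterS eu => n ->.
have e0 n : e n != 0 by rewrite /e; case: ifP => _; [exact: u0|rewrite gt_eqF].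
have er n : `|e n| <= r by rewrite /e; case: ifP => // _; rewrite gtr0_norm.
have ce' : `|e n| @[n --> \oo] --> 0 by rewrite -(normr0 R); exact: cvg_norm.
have eT n : 0 < `|e n| < T by rewrite normr_gt0 e0 /= (le_lt_trans (er n)).
have De n : `[0, T]%classic `|e n| by apply: mem_itv => //; rewrite (le_trans (er n))// ltW.
have en0 n : `|e n| != 0 by rewrite normr_eq0.
have /choice[ap Hap] n := Gamma_derive (eT n).
have /choice[am Ham] := Hap.
have cY w : (Z `|e n| w - Z 0 w) / `|e n| @[n --> \oo] --> path_deriv w 0.
  by have := path_deriv_quotient itv0T De en0 ce' (w := w); under eq_cvg do rewrite subr0.
have cdZ w : path_deriv w `|e n| @[n --> \oo] --> path_deriv w 0 by exact: path_deriv_cvg itv0T De ce'.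
have [a2 Ha2 ca2] : exists2 b, charN P (fun w => 2 * path_deriv w 0) b & ap n @[n --> \oo] --> b.
  apply: (@charN_limit _ _ _ P (fun n w => (Z `|e n| w - Z 0 w) / `|e n| + path_deriv w `|e n|) ap) => [n|w]; first by case: (Ham n).
  by rewrite mulr_natl mulr2n; exact: cvgD.
have [b Hb cb] : exists2 b, charN P (fun w => 0 * path_deriv w 0) b & am n @[n --> \oo] --> b.
  apply: (@charN_limit _ _ _ P (fun n w => (Z `|e n| w - Z 0 w) / `|e n| - path_deriv w `|e n|) am) => [n|w]; first by case: (Ham n).
  rewrite (_ : 0 * path_deriv w 0 = path_deriv w 0 - path_deriv w 0); last by rewrite mul0r subrr.
  apply: cvgB; [exact: cY|exact: cdZ].
have b0 : b = 0 by rewrite (charN_inj Hb (charN_scale 0 Ha)) normr0 mul0r.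
have a2E : a2 = 2 * a by rewrite (charN_inj Ha2 (charN_scale 2 Ha)) ger0_norm.
have : - 4^-1 * (ap n ^+ 2 - am n ^+ 2) @[n --> \oo] --> - a ^+ 2.
  rewrite (_ : - a ^+ 2 = - 4^-1 * (a2 ^+ 2 - b ^+ 2)); last by rewrite b0 a2E; field.
  by apply: cvgMr; apply: cvgB; exact: cvgrX.
apply: cvg_trans; apply: near_eq_cvg; apply: filterS eu => n eun.
rewrite -eun addr0 Gamma_deriv0 subr0 /GRing.scale/=.
have [_ _ dn] := Ham n.
have E : derive1 Gamma `|e n| = - (`|e n| / 4) * (ap n ^+ 2 - am n ^+ 2) by rewrite derive1E derive_val.
have [e1|e1] := leP 0 (e n).
  by move: E; rewrite ger0_norm// => ->; field; rewrite e0.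
have -> : derive1 Gamma (e n) = - derive1 Gamma `|e n| by rewrite -Gamma_derivN// ltr0_norm// opprK.
by rewrite E ltr0_norm//; field; rewrite e0.
Qed.

(** The half-sum and the half-difference are uncorrelated because Z_0 and Z_h have the same
    variance, and all their combinations are Gaussian. The bound on [Gamma h] says that Z_0 + Z_h
    and Z_0 - Z_h have nonnegative variances. *)
Lemma gp_sum_diff_indep h : 0 < h <= T ->
  [/\ charN P (fun w => (Z 0 w + Z h w) / 2) (Num.sqrt ((1 + Gamma h) / 2)),
      charN P (fun w => (Z h w - Z 0 w) / 2) (Num.sqrt ((1 - Gamma h) / 2)),
      `|Gamma h| <= 1 &
      indep_rv P (fun w => (Z 0 w + Z h w) / 2) (fun w => (Z h w - Z 0 w) / 2)].
Proof.
move=> /andP[h0 hTT].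
have Dh : `[0, T]%classic h by apply: mem_itv => //; exact: ltW.
have cov a b : exists2 v, charN P (fun w => a * Z 0 w + b * Z h w + 0 * Z 0 w) v &
    v ^+ 2 = a ^+ 2 + b ^+ 2 + 2 * a * b * Gamma h.
  have [v Hv] := gp_comb3 a b 0 itv0T Dh itv0T; exists v => //.
  rewrite (gp_comb3_var itv0T Dh itv0T Hv) mean_prod_diag//; last exact: itv0T.
  by rewrite mean_prod_diag// mean_prod_Gamma// ?ltW// subr0; ring.
have comb t r : charN P (fun w => t * ((Z 0 w + Z h w) / 2) + r * ((Z h w - Z 0 w) / 2))
    (Num.sqrt ((t * Num.sqrt ((1 + Gamma h) / 2)) ^+ 2 + (r * Num.sqrt ((1 - Gamma h) / 2)) ^+ 2)) /\ `|Gamma h| <= 1.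
  have [v1 _ E1] := cov 1 1; have [v2 _ E2] := cov 1 (-1).
  have G1 : 0 <= (1 + Gamma h) / 2 by have := sqr_ge0 v1; rewrite E1; lra.
  have G2 : 0 <= (1 - Gamma h) / 2 by have := sqr_ge0 v2; rewrite E2; lra.
  split; last by rewrite ler_norml; apply/andP; split; lra.
  have [v Hv Ev] := cov ((t - r) / 2) ((t + r) / 2).
  rewrite [X in charN _ _ (Num.sqrt X)](_ : _ = v ^+ 2); last first.
    by rewrite Ev !exprMn !sqr_sqrtr//; field.
  rewrite sqrtr_sqr ger0_norm; last by case: Hv.
  by apply: charN_ext Hv => w; field.
have [_ G] := comb 0 0.
split => //.
- have [c _] := comb 1 0; move: c; rewrite mul0r expr0n/= addr0 mul1r sqrtr_sqr ger0_norm//.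
  by apply: charN_ext => w; rewrite mul1r mul0r addr0.
- have [c _] := comb 0 1; move: c; rewrite mul0r expr0n/= add0r mul1r sqrtr_sqr ger0_norm//.
  by apply: charN_ext => w; rewrite mul1r mul0r add0r.
- apply: charN_indep (fun t r => proj1 (comb t r)); apply: measurable_funM => //.
    exact: measurable_funD.
  exact: measurable_funB.
Qed.

End gaussian_process_facts.

(** * Estimates for Gaussian crossings *)

Section charN_sums.
Context d1 d2 (T1 : measurableType d1) (T2 : measurableType d2) (R : realType).
Context (P1 : probability T1 R) (P2 : probability T2 R).

Lemma charN_prod (X : T1 -> R) (Y : T2 -> R) a b : charN P1 X a -> charN P2 Y b ->
  charN (P1 \x P2)%E (fun z => X z.1 + Y z.2) (Num.sqrt (a ^+ 2 + b ^+ 2)).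
Proof.
move=> HX HY; have [mX a0 EX] := HX; have [mY b0 EY] := HY.
have mXY : measurable_fun setT (fun z : T1 * T2 => X z.1 + Y z.2).
  by apply: measurable_funD; apply: measurableT_comp.
split => // t c.
have bc : bmf (fun z : T1 * T2 => cos (t * (X z.1 + Y z.2) + c)).
  by apply: bmf_cos; apply: measurable_funD => //; exact: measurable_funM.
rewrite RE_fubini1//=.
transitivity (\int[P1]_x (expR (- ((t * b) ^+ 2 / 2)) * cos (t * X x + c))).
  apply: RE_ext => x; rewrite mulrC -EY; apply: RE_ext => y; congr cos; ring.
rewrite REZ; last exact: (bmf_charN t c HX).
rewrite EX mulrCA -expRD; congr (_ * expR _).
by rewrite !exprMn sqr_sqrtr ?addr_ge0 ?sqr_ge0//; field.
Qed.

Lemma RE_charN_normal (X : T1 -> R) a (f : R -> R) : 0 < a -> charN P1 X a -> bmf f ->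
  \int[P1]_w f (X w) = \int[normal_prob (0:R) a]_x f x.
Proof.
move=> a0 HX bf; have [mX _ _] := HX.
exact: (@RE_law _ _ _ _ _ _ _ P1 (normal_prob (0:R) a) X id f mX (@measurable_id _ _ _) (charN_law HX (charN_normal a0)) bf).
Qed.

End charN_sums.

Lemma charN_indep_sum d (T : measurableType d) (R : realType) (P : probability T R)
  (X Y : T -> R) a b : charN P X a -> charN P Y b -> indep_rv P X Y ->
  charN P (fun w => X w + Y w) (Num.sqrt (a ^+ 2 + b ^+ 2)).
Proof.
move=> HX HY iXY; have [mX a0 EX] := HX; have [mY b0 EY] := HY.
have [mXY _ E] := charN_prod HX HY; split => //; first exact: measurable_funD.
move=> t c; rewrite -E.
have bc : bmf (fun z : R * R => cos (t * (z.1 + z.2) + c)).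
  apply: bmf_cos; apply: measurable_funD => //; apply: measurable_funM => //.
  by apply: measurable_funD; [exact: measurable_fst|exact: measurable_snd].
rewrite (RE_indep mX mY iXY bc) RE_fubini1//.
apply: (bmf_comp (f := fun z : R * R => cos (t * (z.1 + z.2) + c)) (g := fun z : T * T => (X z.1, Y z.2)) bc).
by apply: measurable_fun_pair; apply: measurableT_comp.
Qed.

Section normal_intervals.
Context (R : realType).
Local Notation mu := (@lebesgue_measure R).
Implicit Types (a b u x y : R).

Lemma normal_peak1_le1 : normal_peak 1 <= 1 :> R.
Proof.
have p2 : 0 < pi *+ 2 :> R by rewrite mulrn_wgt0// pi_gt0.
rewrite /normal_peak expr1n mul1r invf_le1 ?sqrtr_gt0//.
rewrite -[leLHS]sqrtr1 ler_wsqrtr// mulr2n (le_trans _ (lerD (pi_ge2 R) (pi_ge2 R)))//.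
by lra.
Qed.

(** Standard deviations at least 1 give densities at most 1; this is what makes the later bounds
    uniform in the number of jumps. *)
Lemma normal_peak_le1 a : 1 <= a -> normal_peak a <= 1.
Proof.
move=> a1; apply: le_trans normal_peak1_le1.
have a0 : 0 < a by exact: lt_le_trans a1.
have p0 x : 0 < x -> 0 < x ^+ 2 * pi *+ 2 :> R.
  by move=> x0; rewrite mulrn_wgt0// mulr_gt0 ?pi_gt0// exprn_gt0.
rewrite /normal_peak lef_pV2 ?posrE ?sqrtr_gt0 ?p0//.
by rewrite ler_wsqrtr// lerMn2r/= ler_wpM2r ?pi_ge0// expr1n exprn_ege1.
Qed.

Lemma normal_prob_itv_le a x e : 1 <= a -> 0 <= e ->
  (normal_prob 0 a `[(x - e)%R, (x + e)%R] <= (2 * e)%:E)%E.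
Proof.
move=> a1 e0.
have a0 : a != 0 by rewrite gt_eqF// (lt_le_trans _ a1).
rewrite /normal_prob.
apply: (@le_trans _ _ (\int[mu]_(y in `[(x - e)%R, (x + e)%R]) (cst 1%E) y)%E).
  apply: ge0_le_integral => //.
  - by move=> y _; rewrite lee_fin normal_pdf_ge0.
  - by apply: measurable_funTS; exact: normal_pdf_measurable_EFin.
  - by move=> y _; rewrite lee_fin (le_trans (normal_pdf_ub _ _ a0))// normal_peak_le1.
rewrite integral_cst//= lebesgue_measure_itv/= mul1e lte_fin.
case: ifPn => _; last by rewrite lee_fin mulr_ge0.
by rewrite -EFinB lee_fin; lra.
Qed.

(** Mean value theorem: the slope is at most 1 in absolute value since |z| <= 1 + z^2 / 2 <= exp(z^2
    / 2). *)
Lemma gauss_lip x y : `|expR (- (x ^+ 2 / 2)) - expR (- (y ^+ 2 / 2))| <= `|x - y|.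
Proof.
wlog xy : x y / x <= y.
  move=> h; have [xy|/ltW xy] := leP x y; first exact: h.
  by rewrite distrC (distrC x) h.
have [->|xney] := eqVneq x y; first by rewrite !subrr normr0.
have xy' : x < y by rewrite lt_neqAle xney.
have dg (z : R) : is_derive z 1 (fun z => expR (- (z ^+ 2 / 2))) (- z * expR (- (z ^+ 2 / 2))).
  by apply: is_derive_eq; rewrite /GRing.scale/=; field.
have wc : {within `[x, y], continuous (fun z : R => expR (- (z ^+ 2 / 2)))}.
  by apply: derivable_within_continuous => z _; have := dg z => ?; exact: ex_derive.
have [z _ E] := MVT xy' (fun z _ => dg z) wc.
rewrite distrC E normrM (distrC x) ler_piMl// normrM normrN.
rewrite (ger0_norm (expR_ge0 _)).
have h : `|z| <= expR (z ^+ 2 / 2).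
  rewrite (le_trans _ (expR_ge1Dx _))// -(real_normK (num_real z)).
  have := sqr_ge0 (`|z| - 1); rewrite sqrrB expr1n mulr1; lra.
by rewrite expRN ler_pdivrMr ?mul1r// expR_gt0.
Qed.

Lemma normal_pdf_inv a x : 0 < a ->
  normal_pdf 0 a x = normal_peak 1 * (a^-1 * expR (- ((a^-1 * x) ^+ 2 / 2))).
Proof.
move=> a0; rewrite normal_pdfE ?gt_eqF// /normal_fun subr0 mulrA.
congr (_ * expR _); last by field; rewrite gt_eqF.
rewrite /normal_peak expr1n mul1r -mulrnAr sqrtrM ?sqr_ge0// sqrtr_sqr gtr0_norm//.
by rewrite invfM mulrC.
Qed.

(** In terms of p = 1 / a the density is phi(0) times p exp(- (p x)^2 / 2); the point x and the
    inverse scale p are changed one after the other. *)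
Lemma normal_pdf_diff a b x u : 0 < a -> 0 < b ->
  `|normal_pdf 0 a x - normal_pdf 0 b u| <=
  a^-1 ^+ 2 * `|x - u| + `|a^-1 - b^-1| * (1 + a^-1 * `|u|).
Proof.
move=> a0 b0; rewrite !normal_pdf_inv//.
set p := a^-1; set q := b^-1.
have p0 : 0 <= p by rewrite invr_ge0 ltW.
rewrite -mulrBr normrM ger0_norm ?normal_peak_ge0//.
rewrite (@le_trans _ _ (1 * `|p * expR (- ((p * x) ^+ 2 / 2)) - q * expR (- ((q * u) ^+ 2 / 2))|))//.
  by rewrite ler_wpM2r// normal_peak1_le1.
rewrite mul1r.
have -> : p * expR (- ((p * x) ^+ 2 / 2)) - q * expR (- ((q * u) ^+ 2 / 2)) =
   p * (expR (- ((p * x) ^+ 2 / 2)) - expR (- ((p * u) ^+ 2 / 2))) +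
   (p * (expR (- ((p * u) ^+ 2 / 2)) - expR (- ((q * u) ^+ 2 / 2))) +
    (p - q) * expR (- ((q * u) ^+ 2 / 2))) by ring.
rewrite (le_trans (ler_normD _ _))// lerD//.
  rewrite normrM ger0_norm// [p ^+ 2]expr2 -mulrA ler_wpM2l// (le_trans (gauss_lip _ _))//.
  by rewrite -mulrBr normrM ger0_norm.
rewrite (le_trans (ler_normD _ _))// [leRHS]mulrDr mulr1 addrC lerD//.
  rewrite normrM ler_piMr// ger0_norm ?expR_ge0// -[leRHS]expR0 ler_expR oppr_le0.
  by rewrite divr_ge0// sqr_ge0.
rewrite normrM ger0_norm// [leRHS]mulrCA ler_wpM2l// (le_trans (gauss_lip _ _))//.
by rewrite -mulrBl normrM.
Qed.

(** With g = Gamma(h), k + (1 + g) / 2 is the variance of S plus k jumps, and it tends to k + 1. The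
    half-width e stands for a value of D; the window is empty for e <= 0, whence [Num.max e 0]. The
    error does not involve k. *)
Lemma normal_prob_itv_approx (k : nat) g u e : 0 <= g -> g <= 1 ->
  `|fine (normal_prob 0 (Num.sqrt (k%:R + (1 + g) / 2)) `]u - e, u + e[) -
    2 * Num.max e 0 * normal_pdf 0 (Num.sqrt k.+1%:R) u| <=
  2 * Num.max e 0 * (2 * Num.max e 0 + (1 - g) * (1 + 2 * `|u|)).
Proof.
move=> g0 g1.
have [e0|e0] := leP e 0.
  rewrite mulr0 !mul0r subr0 set_itv_ge; last by rewrite bnd_simp -leNgt; lra.
  by rewrite measure0 normr0.
set v := k%:R + (1 + g) / 2; set c := normal_pdf 0 _ u.
have k0 : 0 <= k%:R :> R by [].
have v2 : 2^-1 <= v by rewrite /v; move: k0 g0; lra.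
have vk : v <= k.+1%:R by rewrite /v -[k.+1%:R]natr1; move: g1; lra.
have k1 : 1 <= k.+1%:R :> R by rewrite ler1n.
have sv0 : 0 < Num.sqrt v by rewrite sqrtr_gt0; lra.
have sk0 : 0 < Num.sqrt k.+1%:R :> R by rewrite sqrtr_gt0.
have sva : (Num.sqrt v)^-1 ^+ 2 = v^-1 by rewrite exprVn sqr_sqrtr//; lra.
have skb : (Num.sqrt k.+1%:R)^-1 ^+ 2 = k.+1%:R^-1 :> R by rewrite exprVn sqr_sqrtr.
set a := Num.sqrt v in sv0 sva *; set b := Num.sqrt k.+1%:R in sk0 skb *.
have vV : v^-1 <= 2 by rewrite -[leRHS]invrK lef_pV2 ?posrE//; lra.
have v0 : 0 < v by lra.
have aV0 : 0 < a^-1 by rewrite invr_gt0.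
have bV0 : 0 < b^-1 by rewrite invr_gt0.
have aV2 : a^-1 <= 2.
  rewrite -(@ler_pXn2r _ 2)// ?nnegrE ?(ltW aV0)// sva (le_trans vV)//.
  by rewrite -natrX ler_nat.
(* Difference of squares: 1 / v - 1 / (k + 1) is (1 - g) / 2 divided by v (k + 1). *)
have ab : `|a^-1 - b^-1| <= 1 - g.
  have bV1 : b^-1 ^+ 2 <= 1 by rewrite skb invf_le1.
  have E : (a^-1 - b^-1) * (a^-1 + b^-1) = (1 - g) / 2 * (a^-1 ^+ 2 * b^-1 ^+ 2).
    transitivity (a^-1 ^+ 2 - b^-1 ^+ 2); first by ring.
    rewrite sva skb -[k.+1%:R]natr1 /v; field; rewrite natr1.
    by apply/andP; split; rewrite gt_eqF//; move: k0 g0; lra.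
  have ab0 : 0 <= a^-1 - b^-1.
    rewrite -(pmulr_lge0 _ (addr_gt0 aV0 bV0)) E mulr_ge0//; first by rewrite divr_ge0//; lra.
    by rewrite mulr_ge0// exprn_ge0// ltW.
  rewrite ger0_norm// -(ler_pM2r aV0).
  apply: (@le_trans _ _ ((a^-1 - b^-1) * (a^-1 + b^-1))).
    by rewrite ler_wpM2l// lerDl ltW.
  rewrite E (_ : _ * _ = (1 - g) * a^-1 * (a^-1 * b^-1 ^+ 2 / 2)); last by ring.
  rewrite ler_piMr//; first by rewrite mulr_ge0 ?(ltW aV0)//; lra.
  by rewrite ler_pdivrMr// mul1r -[leRHS]mulr1 ler_pM// ?(ltW aV0) ?sqr_ge0.
have pdfle x : x \in `]u - e, u + e[ -> `|normal_pdf 0 a x - c| <= 2 * e + (1 - g) * (1 + 2 * `|u|).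
  rewrite in_itv/= => /andP[x1 x2].
  rewrite (le_trans (normal_pdf_diff _ _ sv0 sk0))// lerD//.
    rewrite sva ler_pM//; first by rewrite invr_ge0 ltW.
    by rewrite ler_norml; apply/andP; split; lra.
  rewrite ler_pM// ?lerD2l ?ler_wpM2r//; last by rewrite addr_ge0// mulr_ge0// ltW.
have mI : mu `]u - e, u + e[ = (2 * e)%:E.
  rewrite lebesgue_measure_itv/= lte_fin ifT; last by lra.
  by rewrite -EFinB; congr (_%:E); ring.
have ipdf : mu.-integrable `]u - e, u + e[ (EFin \o normal_pdf 0 a).
  by apply: (integrableS measurableT) => //; exact: integrable_normal_pdf.
have icst (r : R) : mu.-integrable `]u - e, u + e[ (EFin \o cst r).
  apply: measurable_bounded_integrable => //; first by rewrite [X in (X < _)%E]mI ltry.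
  by exists `|r|; split; [exact: num_real|move=> x rx y _ /=; exact: ltW].
rewrite -[X in fine X]/(\int[mu]_(x in `](u - e)%R, (u + e)%R[) (normal_pdf 0 a x)%:E)%E.
rewrite -[fine _]/(\int[mu]_(x in `](u - e)%R, (u + e)%R[) (normal_pdf 0 a x)).
have -> : 2 * e * c = \int[mu]_(x in `](u - e)%R, (u + e)%R[) (cst c x).
  by rewrite Rintegral_cst// mulrC; congr (_ * _); move/(congr1 fine): mI => /= <-.
rewrite -RintegralB//.
have idiff : mu.-integrable `]u - e, u + e[ (EFin \o (fun x => normal_pdf 0 a x - cst c x)).
  rewrite (_ : _ \o _ = (EFin \o normal_pdf 0 a) \- (EFin \o cst c))%E//.
  exact: integrableB.
rewrite (le_trans (le_normr_Rintegral _ _))//.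
have -> : 2 * e * (2 * e + (1 - g) * (1 + 2 * `|u|)) = \int[mu]_(x in `](u - e)%R, (u + e)%R[) (cst (2 * e + (1 - g) * (1 + 2 * `|u|)) x).
  by rewrite Rintegral_cst// mulrC; congr (_ * _); move/(congr1 fine): mI => /= <-.
apply: le_Rintegral => //.
  exact: integrable_norm.
Qed.

End normal_intervals.

Lemma ge0_integrable d (T : measurableType d) (R : realType) (P : probability T R)
  (f : T -> R) (c : R) : measurable_fun setT f -> (forall x, 0 <= f x) ->
  (\int[P]_x (f x)%:E = c%:E)%E -> P.-integrable setT (EFin \o f).
Proof.
move=> mf f0 E; apply/integrableP; split; first exact/measurable_EFinP.
under eq_integral do rewrite /= ger0_norm//.
by rewrite E ltry.
Qed.

Lemma measurable_lt_set d (S : measurableType d) (R : realType) (f g : S -> R) :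
  measurable_fun setT f -> measurable_fun setT g -> measurable [set x | f x < g x].
Proof.
move=> mf mg; rewrite (_ : [set x | f x < g x] = ~` (setT `&` [set x | g x <= f x])).
  by apply: measurableC; exact: measurable_fun_le.
by rewrite setTI; apply/seteqP; split => x /=; rewrite ltNge => /negP.
Qed.

Section slab.
Context d (Om : measurableType d) (R : realType) (P : probability Om R).
Context d' (Om' : measurableType d') (P' : probability Om' R).

(** The coordinates are ((S, J), D). With Z_0 = S - D and Z_h = S + D the condition reads Z_0 + J <
    u < Z_h + J. *)
Definition slab (u : R) : set ((R * R) * R) := [set z | `|z.1.1 + z.1.2 - u| < z.2].

Lemma measurable_slab u : measurable (slab u).
Proof.
apply: measurable_lt_set; last exact: measurable_snd.
apply: measurableT_comp; first exact: normr_measurable.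
apply: measurable_funB => //; apply: measurable_funD.
  by apply: measurableT_comp => //; exact: measurable_fst.
by apply: measurableT_comp => //; exact: measurable_fst.
Qed.

Lemma slab_itv u s y x : (\1_(slab u) ((s, y), x) : R) = \1_(`](u - x)%R, (u + x)%R[%classic) (s + y).
Proof.
rewrite !indicE; congr (_%:R); congr nat_of_bool.
rewrite /slab; apply/idP/idP; rewrite !inE/= in_itv/= ltr_norml.
  by move=> /andP[h1 h2]; apply/andP; split; lra.
by move=> /andP[h1 h2]; apply/andP; split; lra.
Qed.

Lemma RE_slab (S : Om -> R) (Y : Om' -> R) a b sd u x : charN P S a -> charN P' Y b ->
  Num.sqrt (a ^+ 2 + b ^+ 2) = sd -> 0 < sd ->
  \int[P']_w' \int[P]_w (\1_(slab u) ((S w, Y w'), x) : R) =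
  fine (normal_prob 0 sd `](u - x)%R, (u + x)%R[).
Proof.
move=> HS HY sdE sd0.
have mIt : measurable `](u - x)%R, (u + x)%R[%classic by exact: measurable_itv.
have [mS _ _] := HS; have [mY _ _] := HY.
have mSY : measurable_fun setT (fun z : Om * Om' => S z.1 + Y z.2).
  by apply: measurable_funD; apply: measurableT_comp.
have bf : bmf (fun z : Om * Om' => \1_(`](u - x)%R, (u + x)%R[%classic) (S z.1 + Y z.2) : R).
  exact: (bmf_comp (bmf_indic R mIt) mSY).
have H := charN_prod HS HY; rewrite sdE in H.
rewrite -(RE_indic (normal_prob (0:R) sd) mIt) -(RE_charN_normal sd0 H (bmf_indic R mIt)).
rewrite (RE_fubini1 P P' bf) (RE_fubini P P' bf).
by apply: RE_ext => w'; apply: RE_ext => w; exact: slab_itv.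
Qed.

Lemma slab_approx (S D : Om -> R) (Y : Om' -> R) (k : nat) g e u :
  0 <= g -> g <= 1 -> 0 <= e -> e ^+ 2 = (1 - g) / 2 ->
  charN P S (Num.sqrt ((1 + g) / 2)) -> charN P D e -> indep_rv P S D ->
  charN P' Y (Num.sqrt k%:R) ->
  `|\int[P']_w' \int[P]_w (\1_(slab u) ((S w, Y w'), D w) : R) -
    2 * (e * normal_peak 1) * normal_pdf 0 (Num.sqrt k.+1%:R) u| <= 4 * e ^+ 2 + 4 * (1 + 2 * `|u|) * e ^+ 3.
Proof.
move=> G0 G1 e0 e2 HS HD iSD HY.
have k0 : 0 <= k%:R :> R by [].
have g2 : 0 <= (1 + g) / 2 by lra.
pose sd := Num.sqrt (k%:R + (1 + g) / 2).
have sd0 : 0 < sd by rewrite sqrtr_gt0; lra.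
have sdE : Num.sqrt (Num.sqrt ((1 + g) / 2) ^+ 2 + Num.sqrt k%:R ^+ 2) = sd.
  by rewrite (sqr_sqrtr g2) (sqr_sqrtr k0) addrC.
have ge : 1 - g = 2 * e ^+ 2 by rewrite e2; lra.
have p1 := normal_peak1_le1 R.
have [mS _ _] := HS; have [mD _ _] := HD; have [mY _ _] := HY.
have mA := measurable_slab u; have bA := bmf_indic R mA.
(* Independence of S and D lets D be read on a second copy of the sample space. *)
have step1 w' : \int[P]_w (\1_(slab u) ((S w, Y w'), D w) : R) =
    \int[P]_w2 \int[P]_w (\1_(slab u) ((S w, Y w'), D w2) : R).
  have m2 : measurable_fun setT (fun z : R * R => ((z.1, Y w'), z.2)).
    by apply: measurable_fun_pair => //; exact: measurable_fun_pair.
  rewrite (RE_indep mS mD iSD (bmf_comp bA m2)).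
  have m3 : measurable_fun setT (fun z : Om * Om => ((S z.1, Y w'), D z.2)).
    apply: measurable_fun_pair; last by apply: measurableT_comp.
    by apply: measurable_fun_pair => //; apply: measurableT_comp.
  exact: (RE_fubini P P (bmf_comp bA m3)).
rewrite (RE_ext _ step1).
have mSYD : measurable_fun setT (fun z : (Om' * Om) * Om => ((S z.2, Y z.1.1), D z.1.2)).
  have m1 : measurable_fun setT (fun z : (Om' * Om) * Om => z.1.1).
    by apply: measurableT_comp => //; exact: measurable_fst.
  have m2 : measurable_fun setT (fun z : (Om' * Om) * Om => z.1.2).
    by apply: measurableT_comp => //; exact: measurable_fst.
  apply: measurable_fun_pair; last by apply: measurableT_comp.
  by apply: measurable_fun_pair; apply: measurableT_comp.
have bI := bmf_fubini1 (P' \x P)%E P (bmf_comp bA mSYD).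
pose psi (x : R) := fine (normal_prob 0 sd `](u - x)%R, (u + x)%R[).
have step2 x : \int[P']_w' \int[P]_w (\1_(slab u) ((S w, Y w'), x) : R) = psi x.
  exact: (RE_slab u x HS HY sdE sd0).
rewrite (RE_fubini P' P bI).
have step3 y : \int[P']_x \int[P]_w (\1_(slab u) ((S w, Y (x, y).1), D (x, y).2) : R) = psi (D y).
  exact: (step2 (D y)).
rewrite (RE_ext _ step3).
have bpsi : bmf (fun y => psi (D y)).
  by rewrite -(funext step3); exact: (bmf_fubini1 P P' (bmf_swap bI)).
have mDp : measurable_fun setT (fun w => Num.max (D w) 0) by exact: measurable_funrpos.
have Dp0 w : 0 <= Num.max (D w) 0 by rewrite le_max lexx orbT.
have iDp := ge0_integrable mDp Dp0 (charN_pos HD).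
have EDp : \int[P]_w Num.max (D w) 0 = e * normal_peak 1 by have /(congr1 fine) := charN_pos HD.
have iD2 : P.-integrable setT (EFin \o (fun w => D w ^+ 2)).
  apply: (ge0_integrable _ _ (charN_sqr HD)); first exact: measurable_funX.
  by move=> w; exact: sqr_ge0.
have ED2 : \int[P]_w (D w ^+ 2) = e ^+ 2 by have /(congr1 fine) := charN_sqr HD.
set c := normal_pdf 0 _ u.
have ikDp r : P.-integrable setT (EFin \o (fun w => r * Num.max (D w) 0)).
  by rewrite /comp; under eq_fun do rewrite EFinM; exact: integrableZl.
have -> : 2 * (e * normal_peak 1) * c = \int[P]_w (2 * c * Num.max (D w) 0).
  by rewrite RintegralZl// EDp; ring.
have ipsi := bmf_integrable P bpsi.
rewrite -RintegralB//.
have idiff : P.-integrable setT (EFin \o (fun w => psi (D w) - 2 * c * Num.max (D w) 0)).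
  exact: (integrableB measurableT ipsi (ikDp (2 * c))).
rewrite (le_trans (le_normr_Rintegral _ _))//.
set B := 2 * (1 - g) * (1 + 2 * `|u|).
have i4 : P.-integrable setT (EFin \o (fun w => 4 * D w ^+ 2)).
  by rewrite /comp; under eq_fun do rewrite EFinM; exact: integrableZl.
apply: (@le_trans _ _ (\int[P]_w (4 * D w ^+ 2 + B * Num.max (D w) 0))).
  apply: le_Rintegral => //; first exact: integrable_norm.
    exact: (integrableD measurableT i4 (ikDp B)).
  move=> w _; rewrite (_ : 2 * c * _ = 2 * Num.max (D w) 0 * c); last by ring.
  rewrite (le_trans (normal_prob_itv_approx _ _ _ G0 G1))//.
  rewrite (_ : _ * _ = 4 * Num.max (D w) 0 ^+ 2 + B * Num.max (D w) 0); last by rewrite /B; ring.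
  rewrite lerD2r ler_wpM2l//; have [D0|D0] := leP (D w) 0; first by rewrite expr0n sqr_ge0.
  by [].
rewrite RintegralD// !RintegralZl// ED2 EDp lerD2l.
rewrite /B ge [leLHS](_ : _ = 4 * (1 + 2 * `|u|) * e ^+ 3 * normal_peak 1); last by ring.
rewrite ler_piMr// mulr_ge0 ?exprn_ge0// mulr_ge0// addr_ge0// mulr_ge0//.
Qed.

End slab.

Lemma charN_norm d (T : measurableType d) (R : realType) (P : probability T R) (X : T -> R) a :
  charN P X a -> (\int[P]_w (`|X w|)%:E = (2 * a * normal_peak 1)%:E)%E.
Proof.
move=> HX; have HN := charNN HX; have [mX _ _] := HX; have [mN _ _] := HN.
transitivity (\int[P]_w ((Num.max (X w) 0)%:E + (Num.max (- X w) 0)%:E))%E.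
  apply: eq_integral => w _; rewrite -EFinD; congr (_%:E).
  have [x0|x0] := leP (X w) 0.
    by rewrite ler0_norm// add0r max_l// oppr_ge0.
  by rewrite gtr0_norm// max_r ?addr0// oppr_le0 ltW.
rewrite ge0_integralD//.
- by rewrite (charN_pos HX) (charN_pos HN) -EFinD; congr (_%:E); ring.
- by move=> w _; rewrite lee_fin le_max lexx orbT.
- by apply/measurable_EFinP; exact: measurable_funrpos.
- by move=> w _; rewrite lee_fin le_max lexx orbT.
- by apply/measurable_EFinP; exact: measurable_funrpos.
Qed.

Section jump_crossing.
Context d (Om : measurableType d) (R : realType) (P : probability Om R).
Context d' (Om' : measurableType d') (P' : probability Om' R).

Definition crossing (u : R) : set ((R * R) * (R * R)) :=
  [set z | z.1.1 + z.2.1 < u /\ u < z.1.2 + z.2.2].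

Lemma measurable_crossing u : measurable (crossing u).
Proof.
apply: measurableI.
  apply: (@measurable_lt_set _ _ _ (fun z : (R * R) * (R * R) => z.1.1 + z.2.1) (fun=> u)) => //.
  by apply: measurable_funD; apply: measurableT_comp.
apply: (@measurable_lt_set _ _ _ (fun=> u) (fun z : (R * R) * (R * R) => z.1.2 + z.2.2)) => //.
by apply: measurable_funD; apply: measurableT_comp.
Qed.

(** Freezes Z during a cell. The two indicators differ only if |A + V - u| <= |B - A|. Given A and B
    this has probability at most 2 |B - A|, as V has a density bounded by 1, and E |B - A| <= 2
    a. *)
Lemma crossing_perturb (A B : Om -> R) (Y V : Om' -> R) a b u :
  measurable_fun setT A -> measurable_fun setT B -> measurable_fun setT Y ->
  charN P (fun w => B w - A w) a -> charN P' V b -> 1 <= b ->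
  `|\int[P']_w' \int[P]_w (\1_(crossing u) ((A w, B w), (Y w', V w')) : R) -
    \int[P']_w' \int[P]_w (\1_(crossing u) ((A w, A w), (Y w', V w')) : R)| <= 4 * a.
Proof.
move=> mA mB mY HBA HV b1; have [mV _ _] := HV; have [mBA a0 _] := HBA.
have b0 : 0 < b by lra.
have mC := measurable_crossing u; have bC := bmf_indic R mC.
pose C1 (z : Om' * Om) : R := \1_(crossing u) ((A z.2, B z.2), (Y z.1, V z.1)).
pose C2 (z : Om' * Om) : R := \1_(crossing u) ((A z.2, A z.2), (Y z.1, V z.1)).
have b1' : bmf C1.
  by apply: (bmf_comp bC); apply: measurable_fun_pair; apply: measurable_fun_pair; apply: measurableT_comp.
have b2' : bmf C2.
  by apply: (bmf_comp bC); apply: measurable_fun_pair; apply: measurable_fun_pair; apply: measurableT_comp.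
rewrite -(RE_fubini1 P' P b1') -(RE_fubini1 P' P b2') -REB//.
pose del (w : Om) := `|B w - A w|.
have mdel : measurable_fun setT del by apply: measurableT_comp => //; exact: normr_measurable.
pose E := [set z : Om' * Om | `|A z.2 + V z.1 - u| <= del z.2].
have mE : measurable E.
  rewrite -[E]setTI; apply: measurable_fun_le => //; last by apply: measurableT_comp.
  apply: measurableT_comp; first exact: normr_measurable.
  by apply: measurable_funB => //; apply: measurable_funD; apply: measurableT_comp.
have bE := bmf_indic R mE.
apply: (@le_trans _ _ (\int[(P' \x P)%E]_z (\1_E z : R))).
  apply: RE_norm_le => //; first exact: bmfB.
  move=> z; rewrite /C1 /C2 !indicE.
  have [zE|zE] := boolP (z \in E).
    by do 2 case: (_ \in _); rewrite ?subrr ?normr0 ?subr0 ?sub0r ?normrN ?normr1.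
  rewrite (_ : (_ \in crossing u) = ((A z.2, A z.2, (Y z.1, V z.1)) \in crossing u)); first by rewrite subrr normr0.
  move: zE; rewrite notin_setE /E /= /del /crossing => /negP; rewrite -ltNge => zE.
  apply/idP/idP; rewrite !inE/= => -[h1 h2]; split => //; move: zE h2.
    by case: (ger0P (B z.2 - A z.2)); case: (ger0P (A z.2 + V z.1 - u)); lra.
  by case: (ger0P (B z.2 - A z.2)); case: (ger0P (A z.2 + V z.1 - u)); lra.
rewrite (RE_fubini1 P' P bE) (RE_fubini P' P bE).
have bF := bmf_fubini1 P P' (bmf_swap bE).
have idel : P.-integrable setT (EFin \o (fun w => 2 * del w)).
  rewrite /comp; under eq_fun do rewrite EFinM; apply: integrableZl => //.
  by apply: (ge0_integrable mdel _ (charN_norm HBA)) => w; exact: normr_ge0.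
apply: (@le_trans _ _ (\int[P]_w (2 * del w))).
  apply: le_Rintegral => //; first exact: bmf_integrable.
  move=> w _.
  have mIt : measurable `[(u - A w) - del w, (u - A w) + del w]%classic by exact: measurable_itv.
  have -> : \int[P']_x (\1_E (x, w) : R) = \int[P']_x (\1_(`[(u - A w) - del w, (u - A w) + del w]%classic) (V x) : R).
    apply: RE_ext => x; rewrite !indicE; congr (_%:R); congr nat_of_bool.
    rewrite /E; apply/idP/idP; rewrite !inE/= in_itv/= ler_norml => /andP[h1 h2]; apply/andP; split; lra.
  rewrite (RE_charN_normal b0 HV (bmf_indic R mIt)) (RE_indic (normal_prob (0:R) b) mIt).
  have h := normal_prob_itv_le (u - A w) b1 (normr_ge0 (B w - A w)).
  by rewrite -lee_fin fineK// ge0_fin_numE// (le_lt_trans h)// ltry.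
have idel1 : P.-integrable setT (EFin \o del).
  by apply: (ge0_integrable mdel _ (charN_norm HBA)) => w; exact: normr_ge0.
rewrite RintegralZl//.
have -> : \int[P]_w del w = 2 * a * normal_peak 1 by have /(congr1 fine) := charN_norm HBA.
rewrite (_ : _ * _ = 4 * a * normal_peak 1); last by ring.
by rewrite ler_piMr ?normal_peak1_le1// mulr_ge0.
Qed.

Lemma std_normal_ccdfE (x : R) :
  std_normal_ccdf x = fine (normal_prob 0 1 `]x, +oo[).
Proof.
rewrite /std_normal_ccdf /std_normal_cdf.
have -> : `]x, +oo[%classic = ~` `]-oo, x]%classic by rewrite setCitvl.
have mI : measurable `]-oo, x]%classic by exact: measurable_itv.
rewrite (_ : normal_prob 0 1 (~` `]-oo, x]%classic) = (1 - normal_prob 0 1 `]-oo, x]%classic)%E).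
  have fI := fin_num_measure (normal_prob (0:R) 1) _ mI.
  by rewrite -[in RHS](fineK fI).
exact: (probability_setC (normal_prob (0:R) 1) mI).
Qed.

(** The probability that a jump arriving after k earlier ones carries X across u: Z plus k jumps has
    variance k + 1, and the new jump has to exceed the missing height u - x. *)
Definition jump_prob (u : R) (k : nat) : R :=
  fine (\int[lebesgue_measure]_(x in `]-oo, u]) (std_normal_ccdf (u - x) * normal_pdf 0 (Num.sqrt k.+1%:R) x)%:E)%E.

Lemma measurable_std_normal_ccdf : measurable_fun setT (@std_normal_ccdf R).
Proof.
apply: measurable_funB => //.
apply: nondecreasing_measurable => // x y xy.
rewrite /std_normal_cdf fine_le ?fin_num_measure//; [exact: measurable_itv..|].
apply: le_measure; rewrite ?inE; [exact: measurable_itv..|].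
by move=> z /=; rewrite !in_itv/= => /le_trans; apply.
Qed.

Lemma std_normal_ccdf_itv (x : R) : 0 <= std_normal_ccdf x <= 1.
Proof.
rewrite std_normal_ccdfE; have mI : measurable `]x, +oo[%classic by exact: measurable_itv.
rewrite fine_ge0 ?measure_ge0//=.
rewrite -lee_fin fineK ?fin_num_measure//; exact: (probability_le1 (normal_prob (0:R) 1) mI).
Qed.

Lemma jump_crossing_prob (A : Om -> R) (Y xi : Om' -> R) (k : nat) u :
  charN P A 1 -> charN P' Y (Num.sqrt k%:R) -> charN P' xi 1 -> indep_rv P' Y xi ->
  \int[P']_w' \int[P]_w (\1_(crossing u) ((A w, A w), (Y w', Y w' + xi w')) : R) = jump_prob u k.
Proof.
move=> HA HY Hxi iYx; have [mA _ _] := HA; have [mY _ _] := HY; have [mxi _ _] := Hxi.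
have k0 : 0 <= k%:R :> R by [].
have sd0 : 0 < Num.sqrt k.+1%:R :> R by rewrite sqrtr_gt0.
have sdE : Num.sqrt (1 ^+ 2 + Num.sqrt k%:R ^+ 2) = Num.sqrt k.+1%:R :> R.
  by rewrite expr1n (sqr_sqrtr k0) addrC natr1.
have mC := measurable_crossing u; have bC := bmf_indic R mC.
pose F (m : R) := \1_(`]-oo, u[%classic) m * std_normal_ccdf (u - m).
have mu_ : measurable_fun setT (fun m : R => u - m) by exact: measurable_funB.
have bF : bmf F.
  apply: bmfM; first by apply: (bmf_indic R); exact: measurable_itv.
  split; first exact: (measurableT_comp measurable_std_normal_ccdf mu_).
  by exists 1 => m; have /andP[h1 h2] := std_normal_ccdf_itv (u - m); rewrite ger0_norm.
have inner m : \int[P']_w' (\1_(crossing u) ((m, m), (0, xi w')) : R) = F m.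
  rewrite /F; have mI : measurable `](u - m)%R, +oo[%classic by exact: measurable_itv.
  rewrite std_normal_ccdfE -(RE_indic (normal_prob (0:R) 1) mI) -(RE_charN_normal ltr01 Hxi (bmf_indic R mI)).
  rewrite -REZ; last exact: (bmf_comp (bmf_indic R mI) mxi).
  apply: RE_ext => w'; rewrite !indicE -natrM mulnb; congr (_%:R); congr nat_of_bool.
  rewrite /crossing; apply/idP/andP; rewrite !inE/= !in_itv/= andbT addr0.
    by move=> [h1 h2]; split => //; lra.
  by move=> [h1 h2]; split => //; lra.
pose C1 (z : Om' * Om) : R := \1_(crossing u) ((A z.2, A z.2), (Y z.1, Y z.1 + xi z.1)).
have b1 : bmf C1.
  apply: (bmf_comp bC); apply: measurable_fun_pair; apply: measurable_fun_pair; try by apply: measurableT_comp.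
  by apply: measurable_funD; apply: measurableT_comp.
rewrite (RE_fubini P' P b1).
have step w : \int[P']_x C1 (x, w) = \int[P']_x F (A w + Y x).
  have m3 : measurable_fun setT (fun z : R * R => ((A w, A w), (z.1, z.1 + z.2))).
    apply: measurable_fun_pair => //; apply: measurable_fun_pair => //.
    by apply: measurable_funD; [exact: measurable_fst|exact: measurable_snd].
  rewrite /C1 /= (RE_indep mY mxi iYx (bmf_comp bC m3)).
  apply: RE_ext => x; rewrite -inner; apply: RE_ext => y /=.
  rewrite !indicE; congr (_%:R); congr nat_of_bool.
  rewrite /crossing; apply/idP/idP; rewrite !inE/= addr0 => -[h1 h2]; split => //; lra.
rewrite (RE_ext _ step).
have mAY : measurable_fun setT (fun z : Om * Om' => A z.1 + Y z.2).
  by apply: measurable_funD; apply: measurableT_comp.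
have H := charN_prod HA HY; rewrite sdE in H.
rewrite -(RE_fubini1 P P' (bmf_comp bF mAY)) (RE_charN_normal sd0 H bF).
rewrite /jump_prob /Rintegral; congr fine.
have F0 x : 0 <= F x by rewrite mulr_ge0//; have /andP[] := std_normal_ccdf_itv (u - x).
rewrite ge0_integral_normal; last 2 first.
- by apply/measurable_EFinP; case: bF.
- by move=> x; rewrite lee_fin.
transitivity (\int[lebesgue_measure]_(x in `]-oo, u[) (std_normal_ccdf (u - x) * normal_pdf 0 (Num.sqrt k.+1%:R) x)%:E)%E.
  rewrite [RHS]integral_mkcond; apply: eq_integral => x _; rewrite -EFinM patchE /F indicE.
  by case: ifPn => xu; rewrite ?(negbTE xu) ?xu ?mul1r// !mul0r.
(* The crossing asks for x < u strictly; the end point is a Lebesgue null set. *)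
apply: integral_itv_bndo_bndc; apply: measurable_funTS; apply/measurable_EFinP.
apply: measurable_funM; last exact: measurable_normal_pdf.
exact: (measurableT_comp measurable_std_normal_ccdf mu_).
Qed.

End jump_crossing.

(** * The compound Poisson process *)

Section generated_independence.
Context d (Om : measurableType d) (R : realType) (P : probability Om R).

Lemma pi_system_indep (G : set (set Om)) (B : set Om) : G `<=` measurable -> setI_closed G ->
  G setT -> measurable B -> (forall A, G A -> P (A `&` B) = (P A * P B)%E) ->
  forall A, <<s G >> A -> P (A `&` B) = (P A * P B)%E.
Proof.
move=> Gm GI GT mB H A sA.
have mA : measurable A by exact: (smallest_sub (sigma_algebra_measurable Om) Gm).
have PB0 : 0 <= fine (P B) by apply: fine_ge0.
have PBE : (fine (P B))%:E = P B by rewrite fineK// fin_num_measure.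
pose m1 := mrestr P mB : {measure set Om -> \bar R}.
pose m2 := mscale (NngNum PB0) P : {measure set Om -> \bar R}.
have m2E C : m2 C = (P C * P B)%E by rewrite muleC -PBE.
rewrite -m2E -[LHS]/(m1 A).
apply: (@g_sigma_algebra_measure_unique _ _ _ G Gm (fun=> setT)) => //.
- by apply/seteqP; split => // x _; exists 0%N.
- by move=> C GC; rewrite m2E -H.
- move=> _; rewrite -[X in (X < _)%E]/(P (setT `&` B)) setTI.
  by rewrite (le_lt_trans (probability_le1 _ _))// ltry.
Qed.

(** The generators of [sigma_family] before closure, so that [g_sigma_algebraType] turns Om with the
    generated sigma-algebra into a measurable space of its own. *)
Definition gen_family d' (E : measurableType d') (I : Type) (D : set I) (X : I -> Om -> E) : set (set Om) :=
  [set A | exists i (B : set E), [/\ D i, measurable B & A = X i @^-1` B]].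

Lemma measurable_gen_family d' (E : measurableType d') (I : Type) (D : set I) (X : I -> Om -> E) i :
  D i -> measurable_fun setT (X i : g_sigma_algebraType (gen_family D X) -> E).
Proof.
move=> Di _ B mB; rewrite setTI; apply: sub_sigma_algebra; by exists i, B.
Qed.

Lemma gen_family_measurable d' (E : measurableType d') (I : Type) (D : set I) (X : I -> Om -> E) :
  (forall i, D i -> measurable_fun setT (X i)) -> gen_family D X `<=` measurable.
Proof. by move=> mX A [i [B [Di mB ->]]]; exact: measurable_pre (mX i Di) mB. Qed.

(** The identity maps from Om to Om with either generated sigma-algebra are random variables, and
    independence of the systems is exactly their independence. So [RE_indep] separates the two
    arguments of f. *)
Lemma RE_indep_systems (G1 G2 : set (set Om)) (f : g_sigma_algebraType G1 * g_sigma_algebraType G2 -> R) :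
  G1 `<=` measurable -> G2 `<=` measurable -> independent_systems P <<s G1 >> <<s G2 >> -> bmf f ->
  \int[P]_w f (w, w) = \int[P]_w \int[P]_w' f (w, w').
Proof.
move=> m1 m2 iG bf.
have mid (G : set (set Om)) : G `<=` measurable -> measurable_fun setT (fun w : Om => w : g_sigma_algebraType G).
  move=> mG _ B mB; rewrite setTI preimage_id.
  exact: (smallest_sub (sigma_algebra_measurable Om) mG).
apply: (@RE_indep _ _ _ _ _ _ R P (fun w => w : g_sigma_algebraType G1) (fun w => w : g_sigma_algebraType G2) f (mid _ m1) (mid _ m2) _ bf).
by move=> A B mA mB; exact: iG.
Qed.

End generated_independence.

Section gaussian_jumps.
Context d (Om : measurableType d) (R : realType) (P : probability Om R).
Context (xi : nat -> {RV P >-> R}).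
Hypotheses (xi_gaussian : forall n, standard_gaussian P (xi n)) (xi_indep : independent_family P xi).

Lemma xi_charN n : charN P (xi n) 1.
Proof.
have [_ _ H] := charN_normal (ltr01 : 0 < 1 :> R).
split => // t c; rewrite -H.
apply: (@RE_law _ _ _ _ _ _ _ P (normal_prob (0:R) 1) (xi n) id (fun x => cos (t * x + c))) => //.
- exact: xi_gaussian.
- by apply: bmf_cos; apply: measurable_funD => //; exact: measurable_funM.
Qed.

(** Cylinders over the indices in s: a pi-system on which independence of the family applies
    directly. *)
Definition xi_cyl (s : seq nat) : set (set Om) :=
  [set A | exists B : nat -> set R, (forall i, measurable (B i)) /\ A = \bigcap_(i in [set` s]) (xi i @^-1` B i)].

Lemma measurable_xi_sum (s : seq nat) :
  measurable_fun setT ((fun w => \sum_(j <- s) xi j w) : g_sigma_algebraType (xi_cyl s) -> R).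
Proof.
suff H s' : {subset s' <= s} -> measurable_fun setT ((fun w => \sum_(j <- s') xi j w) : g_sigma_algebraType (xi_cyl s) -> R) by exact: H.
elim: s' => [|x s' IH] ss.
  by under eq_fun do rewrite big_nil; exact: measurable_cst.
under eq_fun do rewrite big_cons.
apply: measurable_funD; last by apply: IH => y ys; apply: ss; rewrite inE ys orbT.
move=> _ B mB; rewrite setTI; apply: sub_sigma_algebra.
exists (fun i => if i == x then B else setT); split; first by move=> i; case: ifP.
apply/seteqP; split => w /=.
  by move=> Bw i _; rewrite /=; case: eqP => [->|].
by move=> /(_ x); rewrite /= eqxx; apply; apply: ss; rewrite inE eqxx.
Qed.

(** For cylinders over s the product formula is [xi_indep] on x :: s. It extends to the generated
    sigma-algebra, for which the sum is measurable. *)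
Lemma xi_sum_indep (s : seq nat) x : uniq (x :: s) ->
  indep_rv P (fun w => \sum_(j <- s) xi j w) (xi x).
Proof.
move=> us A B mA mB.
have mBx : measurable (xi x @^-1` B) by exact: measurable_pre.
apply: (pi_system_indep (G := xi_cyl s)) => //.
- move=> _ [C [mC ->]]; apply: bigcap_measurableType => i _; exact: measurable_pre.
- move=> _ _ [C [mC ->]] [C' [mC' ->]]; exists (fun i => C i `&` C' i); split.
    by move=> i; exact: measurableI.
  by rewrite -bigcapI.
- exists (fun=> setT); split => //; apply/seteqP; split => // w _ i _ //.
- move=> _ [C [mC ->]].
  have mC0 i : measurable ((fun i => if i == x then B else C i) i) by case: ifP.
  have := xi_indep us mC0; rewrite big_cons eqxx.
  have us' : uniq s by case/andP: us.
  have xs : x \notin s by case/andP: us.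
  have -> : [set` x :: s] = x |` [set` s].
    apply/seteqP; split => i /=; rewrite inE; first by move/predU1P.
    by move=> H; apply/predU1P.
  rewrite bigcap_setU1 eqxx => E.
  have E1 : \bigcap_(i in [set` s]) xi i @^-1` (if i == x then B else C i) = \bigcap_(i in [set` s]) xi i @^-1` C i.
    apply: eq_bigcapr => i /= si; case: eqP => // ix; by rewrite -ix si in xs.
  rewrite E1 in E; rewrite setIC E muleC; congr (_ * _)%E.
  rewrite (xi_indep us' mC); rewrite !big_seq; apply: eq_bigr => i si.
  by case: eqP => // ix; rewrite -ix si in xs.
have := @measurable_xi_sum s measurableT A mA; by rewrite setTI.
Qed.

Lemma xi_sum_charN (s : seq nat) : uniq s ->
  charN P (fun w => \sum_(j <- s) xi j w) (Num.sqrt (size s)%:R).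
Proof.
elim: s => [|x s IH] us.
  split; [by under eq_fun do rewrite big_nil; exact: measurable_cst|exact: sqrtr_ge0|].
  move=> t c; rewrite sqrtr0 mulr0 expr0n/= mul0r oppr0 expR0 mulr1 -[RHS](REcst P).
  by apply: RE_ext => w; rewrite big_nil mulr0 add0r.
have us' : uniq s by case/andP: us.
have := charN_indep_sum (IH us') (xi_charN x) (xi_sum_indep us).
rewrite sqr_sqrtr// expr1n natr1.
by apply: charN_ext => w; rewrite big_cons addrC.
Qed.

End gaussian_jumps.

(** A random index: preimages split over the countably many values of N. *)
Lemma measurable_select d1 d2 d3 (X : measurableType d1) (Y : measurableType d2) (E : measurableType d3)
  (N : X -> nat) (F : nat -> Y -> E) : measurable_fun setT N -> (forall k, measurable_fun setT (F k)) ->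
  measurable_fun setT (fun z : X * Y => F (N z.1) z.2).
Proof.
move=> mN mF _ B mB; rewrite setTI.
rewrite (_ : _ @^-1` B = \bigcup_k ((N @^-1` [set k]) `*` (F k @^-1` B))).
  apply: bigcupT_measurable => k; apply: measurableX; first exact: measurable_pre.
  exact: measurable_pre.
apply/seteqP; split => [z Bz|z [k _ [/= <-]]//].
by exists (N z.1).
Qed.

Lemma measurable_eq_set d (S : measurableType d) (R : realType) (f g : S -> R) :
  measurable_fun setT f -> measurable_fun setT g -> measurable [set x | f x = g x].
Proof.
move=> mf mg; rewrite (_ : [set x | f x = g x] = ~` ([set x | f x < g x] `|` [set x | g x < f x])).
  by apply: measurableC; apply: measurableU; exact: measurable_lt_set.
apply/seteqP; split => x /=; first by move=> ->; rewrite ltxx => -[].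
by move=> /not_orP[/negP h1 /negP h2]; apply/eqP; rewrite eq_le !leNgt h1 h2.
Qed.

Section compound_poisson_independence.
Context d (Om : measurableType d) (R : realType) (P : probability Om R).
Context (nu : R -> {RV P >-> nat}) (xi : nat -> {RV P >-> R}).
Hypotheses (nu_xi_indep : independent_systems P
       (sigma_family [set t | 0 <= t] nu) (sigma_family [set: nat] xi)).

Definition partial_sum (k : nat) (w : Om) : R := \sum_(n < k) xi n w.

Lemma partial_sumS k w : partial_sum k.+1 w = partial_sum k w + xi k w.
Proof. by rewrite /partial_sum big_ord_recr. Qed.

Lemma measurable_partial_sum k : measurable_fun setT (partial_sum k).
Proof. exact: measurable_sum. Qed.

Lemma measurable_partial_sum_gen k :
  measurable_fun setT (partial_sum k : g_sigma_algebraType (gen_family [set: nat] xi) -> R).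
Proof.
rewrite /partial_sum.
apply: (@measurable_sum _ (g_sigma_algebraType (gen_family [set: nat] xi)) R setT _ _ (fun (n : 'I_k) w => xi n w)).
by move=> n; exact: (@measurable_gen_family _ Om _ R nat [set: nat] xi n).
Qed.

Lemma measurable_compound t : measurable_fun setT (compound nu xi t).
Proof.
have H := @measurable_select _ _ _ Om Om R (nu t) partial_sum (measurable_funPT (nu t)) measurable_partial_sum.
have H2 : measurable_fun setT (fun w : Om => (w, w)) by exact: measurable_fun_pair.
exact: measurableT_comp H H2.
Qed.

Lemma RE_compound s t (f : R * R -> R) : 0 <= s -> 0 <= t -> bmf f ->
  \int[P]_w f (compound nu xi s w, compound nu xi t w) =
  \int[P]_w \int[P]_w' f (partial_sum (nu s w) w', partial_sum (nu t w) w').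
Proof.
move=> s0 t0 bf.
apply: (@RE_indep_systems _ Om R P (gen_family [set t | 0 <= t] nu) (gen_family [set: nat] xi)
  (fun z => f (partial_sum (nu s z.1) z.2, partial_sum (nu t z.1) z.2))).
- by apply: gen_family_measurable => r _.
- by apply: gen_family_measurable => n _.
- exact: nu_xi_indep.
apply: (bmf_comp bf); apply: measurable_fun_pair; apply: measurable_select => //.
- exact: (@measurable_gen_family _ Om _ nat R [set t | 0 <= t] nu s).
- exact: measurable_partial_sum_gen.
- exact: (@measurable_gen_family _ Om _ nat R [set t | 0 <= t] nu t).
- exact: measurable_partial_sum_gen.
Qed.

Context (T : R) (Z : R -> {RV P >-> R}).
Hypothesis (Z_J_indep : independent_systems P
       (sigma_family `[0, T] Z) (sigma_family `[0, T] (compound nu xi))).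

(** The mean of f given that the counts at s and t are k and m: the outer integral is over the
    jumps, the inner one over Z. *)
Definition pair_prob (f : (R * R) * (R * R) -> R) (s t : R) (k m : nat) : R :=
  \int[P]_w' \int[P]_w f ((Z s w, Z t w), (partial_sum k w', partial_sum m w')).

(** Two separations: Z from J, then the counts from the jumps. What is left is an average over the
    counts alone. *)
Lemma RE_increment s t (f : (R * R) * (R * R) -> R) : 0 <= s <= T -> 0 <= t <= T -> bmf f ->
  \int[P]_w f ((Z s w, Z t w), (compound nu xi s w, compound nu xi t w)) =
  \int[P]_w pair_prob f s t (nu s w) (nu t w).
Proof.
move=> sT tT bf; have /andP[s0 _] := sT; have /andP[t0 _] := tT.
have m1 r : 0 <= r <= T -> `[0, T]%classic r by rewrite /= in_itv.
have mZ r : 0 <= r <= T -> measurable_fun setT (Z r : g_sigma_algebraType (gen_family `[0, T] Z) -> R).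
  by move=> rT; exact: (@measurable_gen_family _ Om _ R R `[0, T]%classic Z r (m1 r rT)).
have mJ r : 0 <= r <= T -> measurable_fun setT (compound nu xi r : g_sigma_algebraType (gen_family `[0, T] (compound nu xi)) -> R).
  by move=> rT; exact: (@measurable_gen_family _ Om _ R R `[0, T]%classic (compound nu xi) r (m1 r rT)).
rewrite (@RE_indep_systems _ Om R P (gen_family `[0, T] Z) (gen_family `[0, T] (compound nu xi))
  (fun z => f ((Z s z.1, Z t z.1), (compound nu xi s z.2, compound nu xi t z.2)))).
- have b2 : bmf (fun z : (R * R) * Om => f ((Z s z.2, Z t z.2), z.1)).
    apply: (bmf_comp bf); apply: measurable_fun_pair => //.
    by apply: measurable_fun_pair; apply: measurableT_comp.
  have b1 : bmf (fun z : Om * Om => f ((Z s z.1, Z t z.1), (compound nu xi s z.2, compound nu xi t z.2))).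
    apply: (bmf_comp b2 (g := fun z : Om * Om => ((compound nu xi s z.2, compound nu xi t z.2), z.1))).
    apply: measurable_fun_pair => //.
    by apply: measurable_fun_pair; apply: measurableT_comp => //; exact: measurable_compound.
  rewrite (RE_fubini P P b1).
  rewrite (@RE_compound s t (fun y => \int[P]_w f ((Z s w, Z t w), y)))//.
  (* A default value: [bmf_fubini1] asks for some probability on the first factor, here a Dirac
     mass. *)
  exact: (bmf_fubini1 (\d_((0:R), (0:R)) : probability _ R) P b2).
- by apply: gen_family_measurable => r _.
- by apply: gen_family_measurable => r _; exact: measurable_compound.
- exact: Z_J_indep.
apply: (bmf_comp bf); apply: measurable_fun_pair; apply: measurable_fun_pair.
- by apply: measurableT_comp (measurable_fst) => //; exact: mZ.
- by apply: measurableT_comp (measurable_fst) => //; exact: mZ.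
- by apply: measurableT_comp (measurable_snd) => //; exact: mJ.
- by apply: measurableT_comp (measurable_snd) => //; exact: mJ.
Qed.

End compound_poisson_independence.

Section partial_sums_law.
Context d (Om : measurableType d) (R : realType) (P : probability Om R).
Context (xi : nat -> {RV P >-> R}).
Hypotheses (xi_gaussian : forall n, standard_gaussian P (xi n)) (xi_indep : independent_family P xi).

Lemma partial_sum_charN k : charN P (partial_sum xi k) (Num.sqrt k%:R).
Proof.
have := xi_sum_charN xi_gaussian xi_indep (iota_uniq 0 k); rewrite size_iota.
by apply: charN_ext => w; rewrite /partial_sum -[in LHS](subn0 k) big_mkord.
Qed.

Lemma partial_sum_indep k : indep_rv P (partial_sum xi k) (xi k).
Proof.
have us : uniq (k :: iota 0 k) by rewrite /= mem_iota add0n ltnn iota_uniq.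
have := xi_sum_indep xi_indep us.
rewrite (_ : (fun w => _) = partial_sum xi k)//; apply/funext => w.
by rewrite /partial_sum -[in LHS](subn0 k) big_mkord.
Qed.

(** The difference of the two sums is Gaussian with variance |m - k| > 0, hence without atoms. So
    almost surely J_s = J_t means nu_s = nu_t, and a change of nu can be read off J. *)
Lemma partial_sum_inj_ae k m : k != m -> P [set w | partial_sum xi k w = partial_sum xi m w] = 0%E.
Proof.
wlog km : k m / (k < m)%N.
  move=> H; rewrite neq_ltn => /orP[] km; first by apply: H => //; rewrite neq_ltn km.
  rewrite (_ : [set w | _] = [set w | partial_sum xi m w = partial_sum xi k w]).
    by apply: H => //; rewrite neq_ltn km.
  by apply/seteqP; split => w /= ->.
move=> _.
have us : uniq (iota k (m - k)) by exact: iota_uniq.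
have := xi_sum_charN xi_gaussian xi_indep us; rewrite size_iota => HC.
have a0 : 0 < Num.sqrt (m - k)%:R :> R by rewrite sqrtr_gt0 ltr0n subn_gt0.
have := charN_normal_prob a0 HC (measurable_set1 0).
have -> : normal_prob (0:R) (Num.sqrt (m - k)%:R) [set 0] = 0%E.
  have /null_content_dominatesP := normal_prob_dominates 0 (Num.sqrt (m - k)%:R : R).
  by apply => //; exact: lebesgue_measure_set1.
move=> <-; congr (P _); apply/seteqP.
have E w : partial_sum xi m w = partial_sum xi k w + \sum_(j <- iota k (m - k)) xi j w.
  rewrite /partial_sum -(big_mkord xpredT (fun n => xi n w)) -(big_mkord xpredT (fun n => xi n w)).
  by rewrite (big_cat_nat (leq0n k) (ltnW km)).
split => w /=; rewrite E; last by move=> ->; rewrite addr0.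
by rewrite -[in X in X -> _](addr0 (partial_sum xi k w)) -addrA add0r => /addrI <-.
Qed.

End partial_sums_law.

Lemma bmf_nat d (S : measurableType d) (R : realType) (N : S -> nat) (b : nat -> R) (M : R) :
  measurable_fun setT N -> (forall k, `|b k| <= M) -> bmf (fun w => b (N w)).
Proof.
move=> mN bM; split; last by exists M => w; exact: bM.
by apply: (measurableT_comp (f := b)).
Qed.

Lemma RE_boolr d (S : measurableType d) (R : realType) (P : probability S R) (p : S -> bool) :
  measurable [set w | p w] -> \int[P]_w (p w)%:R = fine (P [set w | p w]) :> R.
Proof.
move=> mp; rewrite -(RE_indic P mp); apply: RE_ext => w.
by rewrite indicE; congr (_%:R); congr nat_of_bool; apply/idP/idP; rewrite inE.
Qed.

Lemma measurable_nat2 d d' (S : measurableType d) (E : measurableType d') (N M : S -> nat) (f : nat -> nat -> E) :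
  measurable_fun setT N -> measurable_fun setT M -> measurable_fun setT (fun w => f (N w) (M w)).
Proof.
move=> mN mM.
have H := @measurable_select _ _ _ S S E N (fun k w => f k (M w)) mN (fun k => measurableT_comp (f := f k) (fun _ _ _ => Logic.I) mM).
have H2 : measurable_fun setT (fun w : S => (w, w)) by exact: measurable_fun_pair.
exact: measurableT_comp H H2.
Qed.

Lemma bmf_sum d (S : measurableType d) (R : realType) n (f : nat -> S -> R) :
  (forall i, (i < n)%N -> bmf (f i)) -> bmf (fun w => \sum_(i < n) f i w).
Proof.
elim: n => [|n IH] bf.
  by under eq_fun do rewrite big_ord0; exact: bmf_cst.
under eq_fun do rewrite big_ord_recr/=; apply: bmfD; last exact: bf.
by apply: IH => i ni; apply: bf; rewrite ltnS ltnW.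
Qed.

Lemma RE_sum d (S : measurableType d) (R : realType) (P : probability S R) n (f : nat -> S -> R) :
  (forall i, (i < n)%N -> bmf (f i)) ->
  \int[P]_w (\sum_(i < n) f i w) = \sum_(i < n) \int[P]_w f i w.
Proof.
elim: n => [|n IH] bf; first by rewrite big_ord0 -[RHS](REcst P); apply: RE_ext => w; rewrite big_ord0.
have bf' i : (i < n)%N -> bmf (f i) by move=> ni; apply: bf; rewrite ltnS ltnW.
rewrite big_ord_recr/= -IH// -RED//; [|exact: bmf_sum|exact: bf].
by apply: RE_ext => w; rewrite big_ord_recr.
Qed.

(** * Poisson increments and Riemann sums along a Poisson process *)

Section poisson_increments.
Context d (Om : measurableType d) (R : realType) (P : probability Om R).
Context (lambda : R) (nu : R -> {RV P >-> nat}).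
Hypotheses (hlambda : 0 < lambda) (nu_poisson : poisson_process P lambda nu).

Lemma poisson_0 w : nu 0 w = 0%N.
Proof. by case: nu_poisson => /(_ w)[]. Qed.

Lemma poisson_mono s t w : 0 <= s -> s <= t -> (nu s w <= nu t w)%N.
Proof. by case: nu_poisson => /(_ w)[_ H _ _] _ _; exact: H. Qed.

Lemma poisson_incr_indep s t : 0 <= s -> s <= t ->
  indep_rv P (nu s) (fun w => (nu t w - nu s w)%N).
Proof.
move=> s0 st A B _ _; have [_ _ H] := nu_poisson.
(* The times 0, s, t, t, ...: the first two increments are nu_s and nu_t - nu_s. *)
pose r (i : nat) := if i is j.+1 then (if j is 0%N then s else t) else 0.
have r_mono : {homo r : i j / (i <= j)%N >-> i <= j}.
  move=> [|[|i]] [|[|j]] //= _; exact: le_trans st.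
have := H r (lexx _) r_mono [:: 0%N; 1%N] (fun i => if i == 0%N then A else B) isT.
have mAB (i : nat) : measurable (if i == 0%N then A else B) by [].
move=> /(_ mAB); rewrite !big_cons big_nil mule1 /=.
rewrite (_ : (fun w => (nu s w - nu 0 w)%N) = nu s); last first.
  by apply/funext => w; rewrite poisson_0 subn0.
move=> <-; congr (P _); apply/seteqP; split => w.
  by move=> [Aw Bw] [|[|i]] //= _; rewrite poisson_0 subn0.
move=> Hw; split; last by have := Hw 1%N isT.
by have := Hw 0%N isT; rewrite /= poisson_0 subn0.
Qed.

Lemma measurable_incr s t : measurable_fun setT (fun w => (nu t w - nu s w)%N).
Proof. exact: (measurable_nat2 (fun m k => m - k)%N). Qed.

Lemma poisson_incr_eq s t k : 0 <= s -> s < t ->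
  \int[P]_w ((nu t w - nu s w)%N == k)%:R =
  (lambda * (t - s)) ^+ k * k`!%:R^-1 * expR (- (lambda * (t - s))).
Proof.
move=> s0 st; have [_ H _] := nu_poisson.
rewrite RE_boolr.
  rewrite (_ : [set w | _] = [set w | (nu t w - nu s w)%N = k]); last first.
    by apply/seteqP; split => w /= /eqP.
  by rewrite H//= /poisson_pmf mulr_gt0// subr_gt0.
exact: (measurable_pre (A := [set j | j == k]) (measurable_incr s t)).
Qed.

Lemma poisson_incr_RE s t (b c : nat -> R) M M' : 0 <= s -> s <= t ->
  (forall k, `|b k| <= M) -> (forall k, `|c k| <= M') ->
  \int[P]_w (b (nu s w) * c (nu t w - nu s w)%N) =
  (\int[P]_w b (nu s w)) * \int[P]_w c (nu t w - nu s w)%N.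
Proof.
move=> s0 st bM cM.
have mi := measurable_incr s t.
have bb : bmf (fun w => b (nu s w)) by exact: bmf_nat bM.
have bc : bmf (fun w => c (nu t w - nu s w)%N) by exact: bmf_nat cM.
have bf : bmf (fun z : nat * nat => b z.1 * c z.2).
  by apply: bmfM; [exact: bmf_nat bM|exact: bmf_nat cM].
rewrite (@RE_indep _ _ _ _ _ _ _ P (nu s) (fun w => nu t w - nu s w)%N (fun z => b z.1 * c z.2))//=; last first.
  exact: poisson_incr_indep.
rewrite [RHS]mulrC -REZ//.
by apply: RE_ext => w; rewrite REZ// mulrC.
Qed.

(** With mu = lambda (t - s), 1 - exp(- mu) (1 + mu) <= 1 - (1 - mu) (1 + mu) = mu^2. *)
Lemma poisson_incr_ge2 s t : 0 <= s -> s < t ->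
  \int[P]_w (2 <= nu t w - nu s w)%N%:R <= (lambda * (t - s)) ^+ 2.
Proof.
move=> s0 st; set mu := lambda * (t - s).
have mu0 : 0 < mu by rewrite mulr_gt0// subr_gt0.
have bE k : bmf (fun w => ((nu t w - nu s w)%N == k)%:R : R).
  apply: (bmf_nat (b := fun j => (j == k)%:R) (M := 1) (measurable_incr s t)) => j.
  by rewrite normr_nat lern1 leq_b1.
have := REcst P (1 : R).
rewrite (RE_ext P (g := fun w => ((nu t w - nu s w)%N == 0)%:R + ((nu t w - nu s w)%N == 1)%:R + (2 <= nu t w - nu s w)%N%:R)); last first.
  by move=> w; case: (nu t w - nu s w)%N => [|[|k]] /=; rewrite ?addr0 ?add0r.
have b2 : bmf (fun w => (2 <= nu t w - nu s w)%N%:R : R).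
  apply: (bmf_nat (b := fun j => (2 <= j)%N%:R) (M := 1) (measurable_incr s t)) => j.
  by rewrite normr_nat lern1 leq_b1.
rewrite RED//; last exact: bmfD.
rewrite RED// !poisson_incr_eq//= fact0 !invr1 expr0 expr1 !mul1r mulr1 -/mu.
move=> E.
have e1 : 1 - mu <= expR (- mu) by have := expR_ge1Dx (- mu).
have e0 := expR_gt0 (- mu).
nra.
Qed.

Section truncated.
Context (b : nat -> R) (M : R) (K : nat).
Hypotheses (b0 : forall k, 0 <= b k) (bM : forall k, b k <= M) (bK : forall k, (K <= k)%N -> b k = 0).

(** B(m + 1) - B(m) = b(m), so B(nu_t) grows by b(nu) at each jump. The truncation [bK] keeps B
    bounded. *)
Let B m := \sum_(k < m) b k.

Let B_le m : B m <= B K.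
Proof.
rewrite /B -!(big_mkord xpredT b); have [mK|/ltnW Km] := leqP m K.
  by rewrite [leRHS](big_cat_nat (leq0n m) mK)//= lerDl sumr_ge0.
rewrite [leLHS](big_cat_nat (leq0n K) Km)//= -[leRHS]addr0 lerD2l le_eqVlt; apply/orP; left; apply/eqP.
by rewrite big_nat; apply: big1 => i /andP[Ki _]; exact: bK.
Qed.

Let B_ge0 m : 0 <= B m. Proof. exact: sumr_ge0. Qed.

(** No jump contributes 0 and a single jump exactly b(nu_s); two jumps or more cost B(K) mu^2.
    Replacing the probability mu exp(- mu) of a single jump by mu costs M mu^2. *)
Lemma poisson_step s t : 0 <= s -> s < t ->
  `|(lambda * (t - s)) * \int[P]_w b (nu s w) - (\int[P]_w B (nu t w) - \int[P]_w B (nu s w))|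
  <= (M + B K) * (lambda * (t - s)) ^+ 2.
Proof.
move=> s0 st; set mu := lambda * (t - s).
have mu0 : 0 < mu by rewrite mulr_gt0// subr_gt0.
have BN m : `|B m| <= B K by rewrite ger0_norm.
have bN m : `|b m| <= M by rewrite ger0_norm.
have bB r : bmf (fun w => B (nu r w)) by exact: bmf_nat BN.
have bb : bmf (fun w => b (nu s w)) by exact: bmf_nat bN.
have M0 : 0 <= M := le_trans (b0 0%N) (bM 0%N).
have b1 : bmf (fun w => ((nu t w - nu s w)%N == 1)%:R : R).
  apply: (bmf_nat (b := fun j => (j == 1)%:R) (M := 1) (measurable_incr s t)) => j.
  by rewrite normr_nat lern1 leq_b1.
have b2 : bmf (fun w => (2 <= nu t w - nu s w)%N%:R : R).
  apply: (bmf_nat (b := fun j => (2 <= j)%N%:R) (M := 1) (measurable_incr s t)) => j.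
  by rewrite normr_nat lern1 leq_b1.
rewrite -REB//.
have E1 : `|\int[P]_w (B (nu t w) - B (nu s w)) - \int[P]_w (b (nu s w) * ((nu t w - nu s w)%N == 1)%:R)| <= B K * mu ^+ 2.
  rewrite -REB//; [|exact: bmfB|exact: bmfM].
  apply: (@le_trans _ _ (\int[P]_w (B K * (2 <= nu t w - nu s w)%N%:R))).
    apply: RE_norm_le.
    - by apply: bmfB; [exact: bmfB|exact: bmfM].
    - by apply: bmfM => //; exact: bmf_cst.
    move=> w; have := poisson_mono w s0 (ltW st).
    move: (nu t w) (nu s w) => m k km; rewrite -{1}(subnKC km).
    case: (m - k)%N => [|[|j]] /=.
    + by rewrite addn0 subrr mulr0 subrr normr0 mulr0.
    + have -> : B (k + 1) - B k - b k * 1 = 0 by rewrite addn1 /B big_ord_recr/=; ring.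
      by rewrite normr0 mulr0.
    rewrite mulr0 subr0 mulr1 ler_norml.
    by have := B_ge0 k; have := B_ge0 (k + j.+2); have := B_le k; have := B_le (k + j.+2); lra.
  by rewrite REZ// ler_wpM2l// poisson_incr_ge2.
rewrite (@poisson_incr_RE s t b (fun j => (j == 1%N)%:R) M 1) // in E1; [|exact: ltW|]; last first.
  by move=> j; rewrite normr_nat lern1 leq_b1.
rewrite poisson_incr_eq//= expr1 invr1 mulr1 -/mu in E1.
have EM : `|\int[P]_w b (nu s w)| <= M by exact: RE_norm_bound.
have e1 : 1 - mu <= expR (- mu) by have := expR_ge1Dx (- mu).
have e2 : expR (- mu) <= 1 by rewrite -expR0 ler_expR; lra.
have e3 : 0 <= mu * (1 - expR (- mu)) <= mu ^+ 2 by nra.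
set x := \int[P]_w b (nu s w) in EM E1 *.
set y := \int[P]_w _ in E1 *.
have E2 : `|x * (mu * (1 - expR (- mu)))| <= M * mu ^+ 2.
  have /andP[e4 e5] := e3; rewrite normrM (ger0_norm e4); exact: ler_pM.
rewrite mulrDl.
have -> : mu * x - y = x * (mu * (1 - expR (- mu))) - (y - x * (mu * expR (- mu))) by ring.
by apply: (le_trans (ler_normB _ _)); exact: lerD.
Qed.

Context (T : R).
Hypothesis (hT : 0 < T).

Lemma poisson_riemann_trunc :
  (\sum_(i < n.+1) lambda * mesh T n * \int[P]_w b (nu (grid T n i) w)) @[n --> \oo] -->
  \int[P]_w B (nu T w).
Proof.
have key n : `|\sum_(i < n.+1) lambda * mesh T n * \int[P]_w b (nu (grid T n i) w) - \int[P]_w B (nu T w)|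
    <= ((M + B K) * (lambda * T) ^+ 2) / n.+1%:R.
  have -> : \int[P]_w B (nu T w) =
      \sum_(i < n.+1) (\int[P]_w B (nu (grid T n i.+1) w) - \int[P]_w B (nu (grid T n i) w)).
    rewrite -(big_mkord xpredT (fun i => \int[P]_w B (nu (grid T n i.+1) w) - \int[P]_w B (nu (grid T n i) w))).
    rewrite (telescope_sumr (fun i => \int[P]_w B (nu (grid T n i) w)))//.
    rewrite gridT grid0 (RE_ext P (f := fun w => B (nu 0 w)) (g := fun=> 0)) ?REcst ?subr0// => w.
    by rewrite poisson_0 /B big_ord0.
  rewrite -sumrB; apply: (le_trans (ler_norm_sum _ _ _)).
  apply: (@le_trans _ _ (\sum_(i < n.+1) (M + B K) * (lambda * mesh T n) ^+ 2)).
    apply: ler_sum => i _.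
    have E : lambda * mesh T n = lambda * (grid T n i.+1 - grid T n i) by rewrite gridS addrC addKr.
    by rewrite E; apply: poisson_step; [exact: grid_ge0|exact: gridS_gt].
  rewrite sumr_const card_ord -mulr_natl /mesh le_eqVlt; apply/orP; left; apply/eqP.
  by field; rewrite nat1r pnatr_eq0.
apply/cvgrPdist_le => e e0.
have /cvgrPdist_le/(_ e e0) := @cvg_invS_0 R ((M + B K) * (lambda * T) ^+ 2).
apply: filterS => n; rewrite sub0r normrN => /(le_trans (ler_norm _)) H.
by rewrite distrC; exact: le_trans (key n) H.
Qed.

End truncated.

Context (T : R).
Hypothesis (hT : 0 < T).

(** This is lambda T times the weight p_(k+1) of the mixture. *)
Definition tail (k : nat) : R := fine (P [set w | (k < nu T w)%N]).

Let tailE k : tail k = \int[P]_w (k < nu T w)%N%:R.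
Proof.
rewrite RE_boolr//.
exact: (measurable_pre (A := [set j | (k < j)%N]) (measurable_funPT (nu T))).
Qed.

Let riemann (b : nat -> R) n := \sum_(i < n.+1) lambda * mesh T n * \int[P]_w b (nu (grid T n i) w).

Let trunc (b : nat -> R) K k := b k * (k < K)%N%:R.

(** The identity E sum_(k < nu_T) b(k) = sum_k b(k) P(nu_T > k) turns the telescoped limit into a
    sum over k. *)
Let riemann_cvg_trunc b M K : (forall k, 0 <= b k) -> (forall k, b k <= M) ->
  riemann (trunc b K) n @[n --> \oo] --> \sum_(k < K) b k * tail k.
Proof.
move=> b0 bM.
have -> : \sum_(k < K) b k * tail k = \int[P]_w (\sum_(k < nu T w) trunc b K k).
  under eq_bigr do rewrite tailE.
  under eq_bigr => k _.
    rewrite -REZ; first over.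
    apply: (bmf_nat (b := fun j => (k < j)%N%:R) (M := 1)) => // j.
    by rewrite normr_nat lern1 leq_b1.
  rewrite -(@RE_sum _ _ _ P K (fun k w => b k * (k < nu T w)%N%:R)); last first.
    move=> k _; apply: (bmf_nat (b := fun j => b k * (k < j)%N%:R) (M := b k)) => // j.
    by rewrite ger0_norm ?mulr_ge0// ler_piMr// lern1 leq_b1.
  apply: RE_ext => w; rewrite /trunc.
  rewrite -(big_mkord xpredT (fun k => b k * (k < K)%N%:R)) -(big_mkord xpredT (fun k => b k * (k < nu T w)%N%:R)).
  have [h|/ltnW h] := leqP K (nu T w).
    rewrite [RHS](big_cat_nat (leq0n K) h)//= [X in _ = _ + X]big_nat [X in _ = _ + X]big1 ?addr0; last first.
      by move=> i /andP[Ki _]; rewrite ltnNge Ki mulr0.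
    rewrite !big_nat; apply: eq_bigr => i /andP[_ iK].
    by rewrite iK (leq_trans iK h).
  rewrite [LHS](big_cat_nat (leq0n (nu T w)) h)//= [X in _ + X = _]big_nat [X in _ + X = _]big1 ?addr0; last first.
    by move=> i /andP[Ki _]; rewrite ltnNge Ki mulr0.
  rewrite !big_nat; apply: eq_bigr => i /andP[_ iK].
  by rewrite iK (leq_trans iK h).
apply: (@poisson_riemann_trunc (trunc b K) M K) => // k.
- by rewrite mulr_ge0.
- by rewrite (le_trans _ (bM k))// ler_piMr// lern1 leq_b1.
- by move=> Kk; rewrite /trunc ltnNge Kk mulr0.
Qed.

Let lT : 0 <= lambda * T. Proof. by rewrite mulr_ge0// ltW. Qed.

Let lm n : 0 <= lambda * mesh T n. Proof. by rewrite mulr_ge0// ltW// mesh_gt0. Qed.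

Let riemann_le b b' : bmf b -> bmf b' -> (forall k, b k <= b' k) -> forall n, riemann b n <= riemann b' n.
Proof.
move=> [_ [M bM]] [_ [M' bM']] bb' n; apply: ler_sum => i _.
apply: ler_wpM2l; first exact: lm.
by apply: RE_le => [||w]; [exact: bmf_nat bM|exact: bmf_nat bM'|exact: bb'].
Qed.

Let riemann_cst c n : riemann (fun=> c) n = lambda * T * c.
Proof.
rewrite /riemann; under eq_bigr do rewrite REcst.
by rewrite sumr_const card_ord -mulr_natl -[in RHS](mesh_mul T n); ring.
Qed.

Let bmf_natT (b : nat -> R) M : (forall k, 0 <= b k) -> (forall k, b k <= M) -> bmf b.
Proof. by move=> b0 bM; split => //; exists M => k; rewrite ger0_norm. Qed.

(** The sum is a limit of Riemann sums, each of which is at most lambda T M. *)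
Lemma tail_sum_le K (b : nat -> R) M : (forall k, 0 <= b k) -> (forall k, b k <= M) ->
  \sum_(k < K) b k * tail k <= lambda * T * M.
Proof.
move=> b0 bM; have c := @riemann_cvg_trunc b M K b0 bM.
rewrite -(cvg_lim _ c)//; apply: limr_le; first by apply/cvg_ex; eexists; exact: c.
have M0 : 0 <= M := le_trans (b0 0%N) (bM 0%N).
near=> n; rewrite -(riemann_cst M n); apply: riemann_le; last 1 first.
- by move=> k; rewrite (le_trans _ (bM k))// ler_piMr// lern1 leq_b1.
- apply: (@bmf_natT _ M) => k; first by rewrite mulr_ge0.
  by rewrite (le_trans _ (bM k))// ler_piMr// lern1 leq_b1.
- exact: (@bmf_natT _ M).
Unshelve. all: by end_near. Qed.

Let tail_ge0 k : 0 <= tail k. Proof. by rewrite fine_ge0. Qed.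

Let tail_mono k j : (k <= j)%N -> tail j <= tail k.
Proof.
have bk i : bmf (fun w => (i < nu T w)%N%:R : R).
  apply: (bmf_nat (b := fun j => (i < j)%N%:R) (M := 1)) => // m.
  by rewrite normr_nat lern1 leq_b1.
move=> kj; rewrite !tailE; apply: RE_le => // w.
by rewrite ler_nat; case: ltnP => // jw; rewrite (leq_ltn_trans kj jw).
Qed.

(** Tails decrease, and the first k + 1 of them add up to at most lambda T by the previous lemma
    with b = 1. *)
Lemma tail_le k : tail k <= lambda * T / k.+1%:R.
Proof.
rewrite ler_pdivlMr// mulr_natr.
have := @tail_sum_le k.+1 (fun=> 1) 1 (fun=> ler01) (fun=> lexx _).
rewrite mulr1; apply: le_trans.
rewrite -[k.+1 in leLHS]card_ord -sumr_const; apply: ler_sum => i _.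
by rewrite mul1r tail_mono// -ltnS.
Qed.

(** On the grid nu <= nu_T, so cutting b above K changes every Riemann sum by at most lambda T M
    P(nu_T > K), uniformly in n. The truncated case and the decay of the tails then suffice. *)
Lemma poisson_riemann b M : (forall k, 0 <= b k) -> (forall k, b k <= M) ->
  exists2 l, (\sum_(0 <= k <oo) (b k * tail k)%:E = l%:E)%E &
    (\sum_(i < n.+1) lambda * mesh T n * \int[P]_w b (nu (grid T n i) w)) @[n --> \oo] --> l.
Proof.
move=> b0 bM; have M0 : 0 <= M := le_trans (b0 0%N) (bM 0%N).
pose s K := \sum_(k < K) b k * tail k.
have sM K : s K <= lambda * T * M by exact: tail_sum_le.
have s_mono : nondecreasing_seq s.
  by apply/nondecreasing_seqP => K; rewrite /s big_ord_recr/= lerDl mulr_ge0.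
have s_ub : has_ubound (range s) by exists (lambda * T * M) => _ [K _ <-].
have cs := nondecreasing_cvgn s_mono s_ub; set l := sup _ in cs.
have sl K : s K <= l by apply: ub_le_sup => //; exists K.
exists l.
  apply: cvg_lim => //.
  rewrite (_ : (fun n => _) = EFin \o s); first by apply: cvg_EFin => //; exact: nearW.
  by apply/funext => n /=; rewrite sumEFin big_mkord.
have bt K : bmf (trunc b K).
  apply: (@bmf_natT _ M) => k; first by rewrite mulr_ge0.
  by rewrite (le_trans _ (bM k))// ler_piMr// lern1 leq_b1.
have bb : bmf b by exact: (@bmf_natT _ M).
have lo K n : riemann (trunc b K) n <= riemann b n.
  by apply: riemann_le => // k; rewrite ler_piMr// lern1 leq_b1.
have hi K n : riemann b n <= riemann (trunc b K.+1) n + lambda * T * (M * tail K).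
  rewrite -(riemann_cst (M * tail K) n) /riemann -big_split/=; apply: ler_sum => i _.
  rewrite -mulrDr; apply: ler_wpM2l; first exact: lm.
  rewrite REcst.
  have bk : bmf (fun w => (K < nu T w)%N%:R : R).
    apply: (bmf_nat (b := fun j => (K < j)%N%:R) (M := 1)) => // m.
    by rewrite normr_nat lern1 leq_b1.
  have bn (f : nat -> R) (r : R) : bmf f -> bmf (fun w => f (nu r w)).
    by move=> [_ [A fA]]; exact: bmf_nat fA.
  rewrite tailE -REZ// -RED; [|exact: bn|by apply: bmfM => //; exact: bmf_cst].
  apply: RE_le => [||w]; [exact: bn|apply: bmfD; [exact: bn|by apply: bmfM => //; exact: bmf_cst]|].
  rewrite /trunc ltnS.
  have nm : (nu (grid T n i) w <= nu T w)%N.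
    by apply: poisson_mono; [exact: grid_ge0|rewrite grid_leT// ltnW].
  case: (leqP (nu (grid T n i) w) K) => [_|Ki]; first by rewrite mulr1 lerDl mulr_ge0.
  by rewrite mulr0 add0r (leq_trans Ki nm) mulr1.
apply/cvgrPdist_le => e e0.
have e3 : 0 < e / 2 by rewrite divr_gt0.
have [K [K1 K2]] : exists K, lambda * T * (M * tail K) <= e / 2 /\ l - e / 2 <= s K.+1.
  have /cvgrPdist_le/(_ _ e3) H1 := @cvg_invS_0 R (lambda * T * M * (lambda * T)).
  have /cvgrPdist_le/(_ _ e3) H2 := cs.
  near \oo => K; exists K; split.
    have : `|0 - lambda * T * M * (lambda * T) / K.+1%:R| <= e / 2 by near: K.
    rewrite sub0r normrN => /(le_trans (ler_norm _)); apply: le_trans.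
    by rewrite [leLHS]mulrA -[leRHS]mulrA; apply: ler_wpM2l; [exact: mulr_ge0|exact: tail_le].
  have : `|l - s K| <= e / 2 by near: K.
  move=> /(le_trans (ler_norm _)) H.
  have : s K <= s K.+1 by exact: s_mono.
  by move: H; set x := s K; set y := s K.+1; lra.
have /cvgrPdist_le/(_ _ e3) := @riemann_cvg_trunc b M K.+1 b0 bM.
apply: filterS => n; rewrite -/(s K.+1) -/(riemann b n) !ler_norml => /andP[H1 H2].
have H3 := lo K.+1 n; have H4 := hi K n; have H5 := sl K.+1.
by apply/andP; split; move: H1 H2 H3 H4 H5 K1 K2; set x := riemann _ _; set y := riemann _ _; set z := s _; lra.
Unshelve. all: by end_near. Qed.

End poisson_increments.

(** * Crossings of a deterministic path *)

Section local_estimates.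
Context (R : realType).
Implicit Types (g : R -> R) (s x c : R).

Lemma derivable_eps g s : derivable g s 1 -> forall e, 0 < e -> exists2 r, 0 < r &
  forall x, `|x - s| < r -> `|g x - g s - derive1 g s * (x - s)| <= e * `|x - s|.
Proof.
move=> dg e e0.
have /cvgrPdist_le/(_ e e0)[r /= r0 H] :
    (fun h => h^-1 *: (g (h *: (1 : R) + s) - g s)) @ 0^' --> derive1 g s.
  by rewrite derive1E; exact: dg.
exists r => // x xr; have [->|xs] := eqVneq x s; first by rewrite !subrr mulr0 subr0 normr0 mulr0.
have xs0 : x - s != 0 by rewrite subr_eq0.
have := H (x - s); rewrite /= sub0r normrN => /(_ xr xs0).
rewrite [(_ - _) *: 1]mulr1 subrK distrC => {}H.
have -> : g x - g s - derive1 g s * (x - s) = ((x - s)^-1 * (g x - g s) - derive1 g s) * (x - s).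
  by rewrite mulrBl mulrAC mulVf// mul1r.
by rewrite normrM ler_wpM2r.
Qed.

Lemma eps_derivable g s c : (forall e, 0 < e -> exists2 r, 0 < r &
  forall x, `|x - s| < r -> `|g x - g s - c * (x - s)| <= e * `|x - s|) ->
  derivable g s 1 /\ derive1 g s = c.
Proof.
move=> H.
have C : (fun h => h^-1 *: (g (h *: (1 : R) + s) - g s)) @ 0^' --> c.
  apply/cvgrPdist_le => e e0; have [r r0 Hr] := H e e0.
  exists r; first exact: r0.
  move=> h /=; rewrite sub0r normrN => hr h0.
  have := Hr (h + s); rewrite addrK => /(_ hr) {}Hr.
  rewrite [h *: 1]mulr1 distrC.
  have -> : h^-1 *: (g (h + s) - g s) - c = h^-1 * (g (h + s) - g s - c * h).
    by rewrite mulrBr (mulrC c) mulrA mulVf// mul1r.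
  by rewrite normrM normfV mulrC ler_pdivrMr ?normr_gt0.
split; first by apply/cvg_ex; exists c.
by rewrite derive1E; apply: cvg_lim.
Qed.

Lemma derivable_cont g s : derivable g s 1 -> {for s, continuous g}.
Proof. by move=> /derivable1_diffP/differentiable_continuous. Qed.

Lemma continuous_eps g s : {for s, continuous g} -> forall e, 0 < e -> exists2 r, 0 < r &
  forall x, `|x - s| < r -> `|g x - g s| < e.
Proof.
move=> cg e e0; have /cvgrPdist_lt/(_ e e0)[r /= r0 H] := cg.
by exists r => // x xr; rewrite distrC; apply: H; rewrite /= distrC.
Qed.

End local_estimates.

Lemma limn_einf_ge (R : realType) (f : nat -> \bar R) (c : \bar R) :
  (\forall n \near \oo, (c <= f n)%E) -> (c <= limn_einf f)%E.
Proof.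
move=> [N _ HN]; rewrite limn_einf_lim; apply: lime_ge; first exact: is_cvg_einfs.
exists N => // n /= Nn; apply: le_ereal_inf_tmp => _ [m /= nm <-].
by apply: HN => /=; exact: leq_trans nm.
Qed.

(** * Counting points by cells of the grid *)

Section cells.
Context (R : realType) (T : R).
Hypothesis (hT : 0 < T).

(** Open on the left and closed on the right: by right-continuity, the effect of a jump at s is
    visible between the two ends of the cell of s. *)
Definition in_cell n (i : nat) (s : R) := grid T n i < s <= grid T n i.+1.

Lemma cell_exists n s : 0 < s <= T -> exists2 i, (i < n.+1)%N & in_cell n i s.
Proof.
move=> /andP[s0 sT].
have ex : exists j, s <= grid T n j by exists n.+1; rewrite gridT.
case: (ex_minnP ex) => -[|i] Hi min; first by move: Hi; rewrite grid0; lra.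
exists i; first by have := min n.+1; rewrite gridT; exact.
rewrite /in_cell Hi andbT ltNge; apply/negP => /min; by rewrite ltnn.
Qed.

Lemma cell_near n i s r : in_cell n i s -> mesh T n < r ->
  s - r < grid T n i < s /\ s <= grid T n i.+1 < s + r.
Proof.
rewrite /in_cell gridS => /andP[h1 h2] hr; rewrite h1 h2 andbT; split; last by lra.
lra.
Qed.

Lemma cell_uniq n i j s : in_cell n i s -> in_cell n j s -> i = j.
Proof.
move=> /andP[h1 h2] /andP[h3 h4].
apply/eqP; case: ltngtP => // /(@grid_le _ _ hT n); lra.
Qed.

Lemma mesh_near r : 0 < r -> \forall n \near \oo, mesh T n < r.
Proof.
move=> r0; have /cvgrPdist_lt/(_ r r0) := cvg_mesh T.
by apply: filterS => n; rewrite sub0r normrN gtr0_norm// mesh_gt0.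
Qed.

Lemma count_cells n (p : nat -> bool) : (\sum_(i < n) p i)%N = size [seq i <- iota 0 n | p i].
Proof.
rewrite -(big_mkord xpredT (fun i => nat_of_bool (p i))) size_filter -sum1_count [RHS]big_mkcond /index_iota subn0.
by apply: eq_bigr => i _; case: (p i).
Qed.

(** Cells are disjoint, so points chosen in different cells are different. *)
Lemma counting_ge_cells (V : set R) n (p : nat -> bool) :
  (forall i, (i < n.+1)%N -> p i -> exists2 s, V s & in_cell n i s) ->
  ((\sum_(i < n.+1) (p i)%:R)%:E <= counting V :> \bar R)%E.
Proof.
move=> H.
rewrite /counting; case: asboolP => [fV|]; last by rewrite leey.
rewrite lee_fin -natr_sum ler_nat.
have /choice[sel Hsel] : forall i, exists s, (i < n.+1)%N -> p i -> V s /\ in_cell n i s.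
  move=> i; have [/andP[h1 h2]|/negP h] := boolP ((i < n.+1)%N && p i).
    by have [s Vs cs] := H i h1 h2; exists s.
  by exists 0 => h1 h2; case: h; rewrite h1 h2.
rewrite count_cells -(size_map sel); apply: uniq_leq_size.
  rewrite map_inj_in_uniq ?filter_uniq ?iota_uniq// => i j.
  rewrite !mem_filter !mem_iota !add0n => /and3P[pi _ ni] /and3P[pj _ nj] E.
  have [_ ci] := Hsel i ni pi; have [_ cj] := Hsel j nj pj.
  by rewrite -E in cj; exact: cell_uniq ci cj.
move=> _ /mapP[i + ->]; rewrite mem_filter mem_iota add0n => /and3P[pi _ ni].
by have [Vi _] := Hsel i ni pi; rewrite in_fset_set// inE.
Qed.

Lemma near_all_seq (I : eqType) (s : seq I) (Q : I -> nat -> Prop) :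
  (forall x, x \in s -> \forall n \near \oo, Q x n) -> \forall n \near \oo, forall x, x \in s -> Q x n.
Proof.
elim: s => [|y s IH] H; first by apply: nearW => n x.
have H1 : \forall n \near \oo, Q y n by apply: H; rewrite inE eqxx.
have H2 : \forall n \near \oo, forall x, x \in s -> Q x n.
  by apply: IH => x xs; apply: H; rewrite inE xs orbT.
near=> n => x; rewrite inE => /predU1P[->|xs]; first by near: n.
by move: x xs; near: n.
Unshelve. all: by end_near. Qed.

(** Once the mesh is below all distances between points of F, different points lie in different
    cells. *)
Lemma cells_ge_size (F : seq R) (p : nat -> nat -> bool) : uniq F ->
  (forall s, s \in F -> \forall n \near \oo, exists2 i, (i < n.+1)%N & p n i /\ in_cell n i s) ->
  \forall n \near \oo, (size F)%:R <= \sum_(i < n.+1) (p n i)%:R :> R.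
Proof.
move=> uF H.
have H1 := near_all_seq H.
have H2 : \forall n \near \oo, forall x, x \in F -> forall y, y \in F -> x != y -> mesh T n < `|x - y|.
  apply: near_all_seq => x xF; apply: near_all_seq => y yF.
  have [->|xy] := eqVneq x y; first by apply: nearW.
  have := @mesh_near `|x - y|; rewrite normr_gt0 subr_eq0 xy => /(_ isT).
  by apply: filterS => n h _.
near=> n.
have /choice[idx Hidx] : forall x, exists i, x \in F -> (i < n.+1)%N /\ p n i /\ in_cell n i x.
  move=> x; have [xF|/negP xF] := boolP (x \in F); last by exists 0%N => h; case: xF.
  have : exists2 i, (i < n.+1)%N & p n i /\ in_cell n i x by move: x xF; near: n.
  by move=> [i h1 h2]; exists i.
rewrite -natr_sum ler_nat count_cells -(size_map idx); apply: uniq_leq_size.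
  rewrite map_inj_in_uniq// => x y xF yF E; apply/eqP; apply: contraT => xy.
  have m : mesh T n < `|x - y| by move: x xF y yF xy {E}; near: n.
  have [_ [_ cx]] := Hidx x xF; have [_ [_ cy]] := Hidx y yF; rewrite -E in cy.
  move: cx cy m; rewrite /in_cell gridS => /andP[h1 h2] /andP[h3 h4].
  by rewrite ltNge ler_norml => /negP[]; apply/andP; split; lra.
move=> _ /mapP[x xF ->]; have [h1 [h2 _]] := Hidx x xF.
by rewrite mem_filter mem_iota h2.
Unshelve. all: by end_near. Qed.

(** Applied to every finite subset of V, so that an infinite V forces an infinite lower limit. *)
Lemma counting_le_cells (V : set R) (p : nat -> nat -> bool) :
  (forall s, V s -> \forall n \near \oo, exists2 i, (i < n.+1)%N & p n i /\ in_cell n i s) ->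
  (counting V <= limn_einf (fun n => (\sum_(i < n.+1) (p n i)%:R)%:E) :> \bar R)%E.
Proof.
move=> H.
have key (F : seq R) : uniq F -> (forall s, s \in F -> V s) ->
    ((size F)%:R%:E <= limn_einf (fun n => (\sum_(i < n.+1) (p n i)%:R)%:E) :> \bar R)%E.
  move=> uF FV; have [N _ HN] := cells_ge_size uF (fun s sF => H s (FV s sF)).
  apply: limn_einf_ge; exists N => // n /= Nn; rewrite lee_fin; exact: HN.
rewrite /counting; case: asboolP => [fV|iV].
  apply: key; first exact: finmap.fset_uniq.
  by move=> s; rewrite in_fset_set// inE.
rewrite leye_eq; apply/eqP/eqyP => M M0.
have [B BV BM] := infinite_set_fset (Num.truncn M).+1 iV.
apply: (@le_trans _ _ ((size (finmap.enum_fset B))%:R%:E)); last first.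
  apply: key; first exact: finmap.fset_uniq.
  by move=> s sB; apply: BV.
rewrite lee_fin (le_trans (ltW (truncnS_gt M)))// ler_nat; exact: BM.
Qed.

End cells.

Section real_line.
Context (R : realType).
Implicit Types (a b c r s t u x T : R).

Lemma dist_left s r c x : s - r < x < s -> r <= c -> `|x - s| < c.
Proof. by move=> /andP[h1 h2] rc; rewrite ltr_distl; apply/andP; split; lra. Qed.

Lemma dist_right s r c x : s <= x < s + r -> r <= c -> `|x - s| < c.
Proof. by move=> /andP[h1 h2] rc; rewrite ltr_distl; apply/andP; split; lra. Qed.

Lemma near_half s r x : s < x -> x <= s + r / 2 -> `|x - s| < r.
Proof. by move=> h1 h2; rewrite ltr_distl; apply/andP; split; lra. Qed.

Lemma mid_left s r c : 0 < r -> r <= c -> s - c < s - r / 2 < s.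
Proof. by move=> h1 h2; apply/andP; split; lra. Qed.

Lemma dist_gt s r x : `|s - x| < r -> s - r < x.
Proof. by rewrite ltr_distl => /andP[h1 h2]; lra. Qed.

Lemma dist_itv a b s x : `|x - s| < s - a -> `|x - s| < b - s -> a <= x <= b.
Proof. by rewrite !ltr_distl => /andP[h1 h2] /andP[h3 h4]; apply/andP; split; lra. Qed.

Lemma itv_trans T a b s x : 0 <= a -> a <= s -> s < x -> x <= b -> b <= T -> 0 <= x <= T.
Proof. by move=> h1 h2 h3 h4 h5; apply/andP; split; lra. Qed.

Lemma lt_near a b u : `|a - b| < `|b - u| -> (a < u) = (b < u) /\ (u < a) = (u < b).
Proof.
have [bu|bu|->] := ltgtP b u; last by rewrite subrr normr0 normr_lt0.
  rewrite (ltr0_norm (_ : b - u < 0)) ?subr_lt0// ltr_distl => /andP[h1 h2].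
  by split; [apply/idP|apply/negbTE; rewrite -leNgt]; lra.
rewrite (gtr0_norm (_ : 0 < b - u)) ?subr_gt0// ltr_distl => /andP[h1 h2].
by split; [apply/negbTE; rewrite -leNgt|apply/idP]; lra.
Qed.

End real_line.

(** * Crossings of a path and crossed cells *)

Section path.
Context (R : realType) (T u : R) (z : R -> R) (f : R -> nat) (S : nat -> R).
Hypotheses (hT : 0 < T) (z_C1 : C1_on `[0, T] z) (f_counting : counting_path f).

Let X t := z t + S (f t).

Definition jump_at s := forall x, 0 <= x -> x < s -> (f x < f s)%N.

Definition path_derivative (s c : R) : Prop := (z x - z s) / (x - s) @[x --> within `[0, T] s^'] --> (c : R).

Lemma path_derivative_ex s : 0 <= s <= T -> exists c, path_derivative s c.
Proof. by move=> sT; have [df [_ H]] := z_C1; exists (df s); apply: H; rewrite /= in_itv. Qed.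

Lemma path_eps s c : path_derivative s c -> forall e, 0 < e -> exists2 r, 0 < r &
  forall x, 0 <= x <= T -> `|x - s| < r -> `|z x - z s - c * (x - s)| <= e * `|x - s|.
Proof.
move=> /cvgrPdist_le H e e0; have [r /= r0 Hr] := H e e0.
exists r => // x xT xr; have [->|xs] := eqVneq x s; first by rewrite !subrr mulr0 subr0 normr0 mulr0.
have xs0 : x - s != 0 by rewrite subr_eq0.
have := Hr x; rewrite /= distrC in_itv => /(_ xr xs xT); rewrite distrC => {}Hr.
have -> : z x - z s - c * (x - s) = ((z x - z s) / (x - s) - c) * (x - s).
  by rewrite mulrBl divfK.
by rewrite normrM ler_wpM2r.
Qed.

Lemma path_cont s : 0 <= s <= T -> forall e, 0 < e -> exists2 r, 0 < r &
  forall x, 0 <= x <= T -> `|x - s| < r -> `|z x - z s| < e.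
Proof.
move=> sT e e0; have [c Hc] := path_derivative_ex sT.
have [r r0 Hr] := path_eps Hc ltr01.
have c1 : 0 < 1 + `|c| by rewrite ltr_pwDl.
exists (Num.min r (e / (1 + `|c|))); first by rewrite lt_min r0 divr_gt0.
move=> x xT; rewrite lt_min => /andP[xr xe].
have -> : z x - z s = (z x - z s - c * (x - s)) + c * (x - s) by rewrite subrK.
apply: (le_lt_trans (ler_normD _ _)); apply: (@le_lt_trans _ _ ((1 + `|c|) * `|x - s|)).
  by rewrite mulrDl lerD// ?normrM//; exact: Hr.
by rewrite mulrC -ltr_pdivlMr.
Qed.

Lemma counting_path_mono s t : 0 <= s -> s <= t -> (f s <= f t)%N.
Proof. by have [_ H _ _] := f_counting; exact: H. Qed.

Lemma counting_path_right s : 0 <= s -> exists2 r, 0 < r & forall x, s <= x < s + r -> f x = f s.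
Proof.
move=> s0; have [_ _ H _] := f_counting; have [r /= r0 Hr] := H s s0.
exists r => // x; rewrite le_eqVlt => /andP[/predU1P[->//|sx] xr].
by apply: Hr => //=; rewrite ltr_norml; apply/andP; split; lra.
Qed.

Lemma counting_path_left s : 0 < s -> jump_at s -> exists2 r, 0 < r & forall x, 0 <= x -> s - r < x < s -> f x = (f s).-1.
Proof.
move=> s0 js; have [_ _ _ H] := f_counting; have [r /= r0 Hr] := H s s0.
exists r => // x x0 /andP[h1 h2].
have := js x x0 h2; have : (f s <= (f x).+1)%N.
  by apply: Hr => //=; rewrite ltr_norml; apply/andP; split; lra.
by case: (f s) => // k; rewrite !ltnS /= => h3 h4; apply/eqP; rewrite eqn_leq h4 h3.
Qed.

Lemma counting_path_const s : 0 < s -> ~ jump_at s -> exists2 r, 0 < r & forall x, 0 <= x -> `|x - s| < r -> f x = f s.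
Proof.
move=> s0 /existsNP[x0 /not_implyP[x00 /not_implyP[x0s /negP]]].
rewrite -leqNgt => fx0.
have [r r0 Hr] := counting_path_right (ltW s0).
exists (Num.min r (s - x0)); first by rewrite lt_min r0 subr_gt0.
move=> x xx0; rewrite lt_min !ltr_norml => /andP[/andP[h1 h2] /andP[h3 h4]].
have [sx|xs] := leP s x; first by apply: Hr; apply/andP; split; lra.
apply/eqP; rewrite eqn_leq counting_path_mono ?(ltW xs)//=.
apply: leq_trans fx0 _; apply: counting_path_mono => //; lra.
Qed.

Lemma jump_pred s : 0 < s -> jump_at s -> (f s).-1.+1 = f s.
Proof. by move=> s0 /(_ 0 (lexx _) s0); case: (f s). Qed.

Hypotheses (X_grid : forall n i, (i <= n.+1)%N -> X (grid T n i) <> u)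
  (no_tangency : forall s, 0 <= s <= T -> X s = u -> ~ path_derivative s 0)
  (S_inj : injective S)
  (jump_levels : forall s, 0 < s <= T -> jump_at s -> X s <> u /\ z s + S (f s).-1 <> u).

Definition cont_upcross := [set s | [/\ 0 < s < T, {for s, continuous X}, X s = u,
                        derivable X s 1 & 0 < derive1 X s]].

Definition disc_upcross := [set s | 0 < s <= T /\
              exists l : R, X x @[x --> s^'-] --> l /\ l < u < X s].

(** The test compares values of J rather than of nu, so that it depends only on Z and J at the ends
    of the cell. *)
Definition cont_cell n i := [&& S (f (grid T n i)) == S (f (grid T n i.+1)),
  X (grid T n i) < u & u < X (grid T n i.+1)].

Definition disc_cell n i := [&& S (f (grid T n i)) != S (f (grid T n i.+1)),
  X (grid T n i) < u & u < X (grid T n i.+1)].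

(** The crossing is the last time s of the cell with X <= u. Continuity gives X = u at s, the values
    above u afterwards exclude a negative derivative, and tangency is excluded by hypothesis. *)
Lemma cont_cell_upcross n i : (i < n.+1)%N -> cont_cell n i -> exists2 s, cont_upcross s & in_cell T n i s.
Proof.
move=> ni /and3P[/eqP/S_inj fE Xa Xb].
have ab := gridS_gt hT n i; have a0 := grid_ge0 hT n i; have bT := grid_leT hT ni.
set a := grid T n i in fE Xa ab a0 *; set b := grid T n i.+1 in fE Xb ab bT *.
have fab x : a <= x <= b -> f x = f a.
  move=> /andP[ax xb]; apply/eqP; rewrite eqn_leq [in X in _ && X]counting_path_mono// andbT fE counting_path_mono//; lra.
pose E := [set x | a <= x <= b /\ X x <= u].
have Ea : E a by split; [rewrite lexx ltW|exact: ltW].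
have Eb : ubound E b by move=> x [/andP[]].
pose s := sup E.
have Es : has_sup E by split; [exists a|exists b].
have as_ : a <= s by apply: ub_le_sup => //; exists b.
have sb : s <= b by apply: sup_le_ub => //; exists a.
have sT : 0 <= s <= T by apply/andP; split; lra.
have fs : f s = f a by apply: fab; rewrite as_.
have XE x : a <= x <= b -> X x - X s = z x - z s by move=> xab; rewrite /X fs (fab x xab); ring.
have Xr x : s < x <= b -> u < X x.
  move=> /andP[sx xb]; rewrite ltNge; apply/negP => Xu.
  have : x <= s by apply: ub_le_sup; [exists b|split => //; apply/andP; split; lra].
  lra.
have Xs1 : X s <= u.
  rewrite leNgt; apply/negP => Xu.
  have eu : 0 < X s - u by rewrite subr_gt0.
  have [r r0 Hr] := path_cont sT eu.
  have [x Ex sx] := sup_adherent r0 Es.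
  have [/andP[ax xb] xu] := Ex; rewrite -/s in sx.
  have xs : x <= s by apply: ub_le_sup => //; exists b.
  have := Hr x; rewrite -XE ?ax// => H.
  have {}H : `|X x - X s| < X s - u.
    by apply: H; rewrite ?ltr_distl ?sx ?(le_lt_trans xs) ?ltrDl// (le_trans a0 ax) (le_trans xb).
  by move: H; rewrite ltr_norml => /andP[H _]; lra.
have sb' : s < b by rewrite lt_neqAle sb andbT; apply/eqP => sbE; move: Xs1; rewrite sbE; lra.
have Xs : X s = u.
  apply/eqP; rewrite eq_le Xs1 leNgt; apply/negP => Xu.
  have eu : 0 < u - X s by rewrite subr_gt0.
  have [r r0 Hr] := path_cont sT eu.
  pose x := Num.min b (s + r / 2).
  have sx : s < x by rewrite /x lt_min sb' ltrDl divr_gt0.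
  have xb : x <= b by rewrite /x ge_min lexx.
  have xr : x <= s + r / 2 by rewrite /x ge_min lexx orbT.
  have ux : u < X x by apply: Xr; rewrite sx.
  have := Hr x; rewrite -XE; last by rewrite xb (le_trans as_ (ltW sx)).
  have xT : 0 <= x <= T by exact: itv_trans a0 as_ sx xb bT.
  have xsr := near_half sx xr.
  by move=> /(_ xT xsr); rewrite ltr_norml => /andP[_ H]; lra.
have as' : a < s by rewrite lt_neqAle as_ andbT; apply/eqP => aE; move: Xs Xa; rewrite -aE; lra.
have [c Hc] := path_derivative_ex sT.
have c0 : c != 0 by apply/eqP => c0; apply: (no_tangency sT Xs); rewrite -c0.
have c_pos : 0 < c.
  rewrite lt_neqAle eq_sym c0 leNgt; apply/negP => cneg.
  have ec : 0 < - c / 2 by lra.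
  have [r r0 Hr] := path_eps Hc ec.
  pose x := Num.min b (s + r / 2).
  have sx : s < x by rewrite /x lt_min sb' ltrDl divr_gt0.
  have xb : x <= b by rewrite /x ge_min lexx.
  have xr : x <= s + r / 2 by rewrite /x ge_min lexx orbT.
  have ux : u < X x by apply: Xr; rewrite sx.
  have := Hr x; rewrite -XE; last by rewrite xb (le_trans as_ (ltW sx)).
  have xT : 0 <= x <= T by exact: itv_trans a0 as_ sx xb bT.
  have xsr := near_half sx xr.
  move=> /(_ xT xsr); rewrite (gtr0_norm (_ : 0 < x - s)) ?subr_gt0// ler_norml => /andP[_ H].
  by nra.
have [dX dXc] : derivable X s 1 /\ derive1 X s = c.
  apply: eps_derivable => e e0; have [r r0 Hr] := path_eps Hc e0.
  exists (Num.min r (Num.min (s - a) (b - s))); first by rewrite !lt_min r0 !subr_gt0 as'.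
  move=> x; rewrite !lt_min => /and3P[xr xa xb].
  have xab := dist_itv xa xb; have /andP[ax xb'] := xab.
  by rewrite XE//; apply: Hr => //; rewrite (le_trans a0 ax) (le_trans xb').
exists s; last by apply/andP; split; [|exact: sb].
split => //; [by rewrite (le_lt_trans a0 as') (lt_le_trans sb' bT)|exact: derivable_cont|by rewrite dXc].
Qed.

(** Continuity of X at s excludes a jump there, since the left limit at a jump differs from u. The
    positive derivative then puts the two ends of a small cell on opposite sides of u. *)
Lemma cont_upcross_cell s : cont_upcross s ->
  \forall n \near \oo, exists2 i, (i < n.+1)%N & cont_cell n i /\ in_cell T n i s.
Proof.
move=> [/andP[s0 sT] cX Xs dX c0]; set c := derive1 X s in c0.
have sT' : 0 <= s <= T by apply/andP; split; lra.
have [r1 r10 H1] : exists2 r, 0 < r & forall x, 0 <= x -> `|x - s| < r -> f x = f s.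
  have [js|njs] := pselect (jump_at s); last exact: counting_path_const.
  have sT2 : 0 < s <= T by rewrite s0 ltW.
  have [_ lu] := jump_levels sT2 js; exfalso.
  have e0 : 0 < `|z s + S (f s).-1 - u| / 2 by rewrite divr_gt0// normr_gt0 subr_eq0; exact/eqP.
  have [ra ra0 Ha] := continuous_eps cX e0.
  have [rb rb0 Hb] := path_cont sT' e0.
  have [rc rc0 Hc] := counting_path_left s0 js.
  pose r := Num.min (Num.min ra rb) (Num.min rc s).
  have r0 : 0 < r by rewrite /r !lt_min ra0 rb0 rc0.
  have [rra rrb rrc rs] : [/\ r <= ra, r <= rb, r <= rc & r <= s].
    by rewrite /r !ge_min !lexx !orbT.
  pose x := s - r / 2.
  have xr := mid_left s r0 (lexx r); have /andP[_ xs] := xr.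
  have x0 : 0 <= x by have /andP[h _] := mid_left s r0 rs; rewrite subrr in h; exact: ltW.
  have fx : f x = (f s).-1 by apply: Hc => //; exact: mid_left.
  have Hxa : `|x - s| < ra by exact: dist_left xr rra.
  have Hxb : `|x - s| < rb by exact: dist_left xr rrb.
  have xT : 0 <= x <= T by rewrite x0 (ltW (lt_trans xs sT)).
  have := Ha x Hxa; have := Hb x xT Hxb; rewrite Xs /X fx distrC => h1 h2.
  have := ler_normD (z s - z x) (z x + S (f s).-1 - u).
  have -> : z s - z x + (z x + S (f s).-1 - u) = z s + S (f s).-1 - u by ring.
  lra.
have c2 : 0 < c / 2 by lra.
have [r2 r20 H2] := derivable_eps dX c2.
pose r := Num.min r1 r2.
have r0 : 0 < r by rewrite /r lt_min r10.
have [rr1 rr2] : r <= r1 /\ r <= r2 by rewrite /r !ge_min !lexx orbT.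
have Xgt x : s < x -> x < s + r -> u < X x.
  move=> sx xr; have := H2 x; rewrite -/c Xs (gtr0_norm (_ : 0 < x - s)) ?subr_gt0//.
  have xr2 : x - s < r2 by lra.
  by move=> /(_ xr2); rewrite ler_norml => /andP[H _]; nra.
have Xlt x : s - r < x -> x < s -> X x < u.
  move=> sx xr; have := H2 x; rewrite -/c Xs (ltr0_norm (_ : x - s < 0)) ?subr_lt0//.
  have xr2 : - (x - s) < r2 by lra.
  by move=> /(_ xr2); rewrite ler_norml => /andP[_ H]; nra.
apply: filterS (mesh_near hT r0) => n hn.
have sT2 : 0 < s <= T by rewrite s0 ltW.
have [i ni ci] := cell_exists n sT2; exists i => //; split => //.
have [/andP[a1 a2] /andP[b1 b2]] := cell_near ci hn.
have a0 := grid_ge0 hT n i; have b0 := grid_ge0 hT n i.+1.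
(* A cell contains its right end, where X would be equal to u; this is ruled out because X avoids u
   on the grid. *)
have b1' : s < grid T n i.+1.
  rewrite lt_neqAle b1 andbT; apply/eqP => sE; apply: (@X_grid n i.+1 ni); by rewrite -sE.
have fa : f (grid T n i) = f s by apply: H1 => //; apply: dist_left rr1; rewrite a1.
have fb : f (grid T n i.+1) = f s by apply: H1 => //; apply: dist_right rr1; rewrite b1.
by rewrite /cont_cell fa fb eqxx Xlt// Xgt.
Qed.

Lemma path_left_limit s : 0 < s <= T -> jump_at s -> X x @[x --> s^'-] --> z s + S (f s).-1.
Proof.
move=> /andP[s0 sT] js; apply/cvgrPdist_lt => e e0.
have sT' : 0 <= s <= T by apply/andP; split; lra.
have [rb rb0 Hb] := path_cont sT' e0.
have [rc rc0 Hc] := counting_path_left s0 js.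
exists (Num.min (Num.min rb rc) s); first by rewrite /= !lt_min rb0 rc0.
move=> x /=; rewrite !lt_min => /andP[/andP[xb xc] x_s] xs.
have x0 : 0 <= x by have := dist_gt x_s; rewrite subrr => /ltW.
rewrite /X (Hc x x0) ?(dist_gt xc)//.
have -> : z s + S (f s).-1 - (z x + S (f s).-1) = z s - z x by ring.
by rewrite distrC; apply: Hb; rewrite 1?distrC// x0 (le_trans (ltW xs)).
Qed.

Lemma disc_upcross_jump s : disc_upcross s -> [/\ 0 < s <= T, jump_at s & z s + S (f s).-1 < u < X s].
Proof.
move=> [sT [l [cl lu]]]; have /andP[s0 sT1] := sT.
have js : jump_at s.
  apply: contrapT => njs; have [r1 r10 H1] := counting_path_const s0 njs.
  have cX : X x @[x --> s^'-] --> X s.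
    apply/cvgrPdist_lt => e e0.
    have sT' : 0 <= s <= T by apply/andP; split; lra.
    have [rb rb0 Hb] := path_cont sT' e0.
    exists (Num.min (Num.min rb r1) s); first by rewrite /= !lt_min rb0 r10.
    move=> x /=; rewrite !lt_min => /andP[/andP[xb xc] x_s] xs.
    have x0 : 0 <= x by have := dist_gt x_s; rewrite subrr => /ltW.
    rewrite /X (H1 x x0); last by rewrite distrC.
    have -> : z s + S (f s) - (z x + S (f s)) = z s - z x by ring.
    by rewrite distrC; apply: Hb; rewrite 1?distrC// x0 (le_trans (ltW xs)).
  have lE : l = X s by rewrite -(cvg_lim _ cl)// -(cvg_lim _ cX).
  by move: lu; rewrite lE => /andP[]; lra.
split => //; have cX := path_left_limit sT js.
by have <- : l = z s + S (f s).-1 by rewrite -(cvg_lim _ cl)// -(cvg_lim _ cX).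
Qed.

(** The signs are stable near s because neither the left limit of X at the jump nor its value there
    is u. *)
Lemma jump_local s : 0 < s <= T -> jump_at s -> exists2 r, 0 < r & forall a b, 0 <= a -> s - r < a < s ->
  s <= b < s + r -> b <= T -> [/\ f a = (f s).-1, f b = f s,
    (X a < u) = (z s + S (f s).-1 < u) & (u < X b) = (u < X s)].
Proof.
move=> sT js; have /andP[s0 sT1] := sT; have [nu1 nu2] := jump_levels sT js.
have sT' : 0 <= s <= T by apply/andP; split; lra.
have e0 : 0 < `|z s + S (f s).-1 - u| by rewrite normr_gt0 subr_eq0; exact/eqP.
have e1 : 0 < `|X s - u| by rewrite normr_gt0 subr_eq0; exact/eqP.
have [ra ra0 Ha] := path_cont sT' e0.
have [rb rb0 Hb] := path_cont sT' e1.
have [rc rc0 Hc] := counting_path_left s0 js.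
have [rd rd0 Hd] := counting_path_right (ltW s0).
pose r := Num.min (Num.min ra rb) (Num.min rc rd).
have r0 : 0 < r by rewrite /r !lt_min ra0 rb0 rc0.
have [rra rrb rrc rrd] : [/\ r <= ra, r <= rb, r <= rc & r <= rd].
  by rewrite /r !ge_min !lexx !orbT.
exists r => // a b a0 /andP[h1 h2] /andP[h3 h4] bT.
have fa : f a = (f s).-1.
  by apply: Hc => //; rewrite h2 andbT (le_lt_trans _ h1)// lerD2l lerN2.
have fb : f b = f s by apply: Hd; rewrite h3 (lt_le_trans h4)// lerD2l.
have HA : `|z a - z s| < `|z s + S (f s).-1 - u|.
  apply: Ha; first by rewrite a0 (le_trans (ltW h2) sT1).
  by apply: dist_left rra; rewrite h1.
have HB : `|z b - z s| < `|X s - u|.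
  apply: Hb; first by rewrite bT (le_trans (ltW s0) h3).
  by apply: dist_right rrb; rewrite h3.
have HA' : `|(z a + S (f s).-1) - (z s + S (f s).-1)| < `|z s + S (f s).-1 - u|.
  by rewrite opprD addrACA subrr addr0.
have HB' : `|(z b + S (f s)) - X s| < `|X s - u| by rewrite /X opprD addrACA subrr addr0.
split => //; rewrite /X ?fa ?fb; first by have [] := lt_near HA'.
by have [_] := lt_near HB'.
Qed.

Lemma disc_upcross_cell s : disc_upcross s ->
  \forall n \near \oo, exists2 i, (i < n.+1)%N & disc_cell n i /\ in_cell T n i s.
Proof.
move=> /disc_upcross_jump[sT js /andP[lu uX]]; have /andP[s0 _] := sT.
have [r r0 Hr] := jump_local sT js.
apply: filterS (mesh_near hT r0) => n hn.
have [i ni ci] := cell_exists n sT; exists i => //; split => //.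
have [a12 b12] := cell_near ci hn.
have [fa fb Xa Xb] := Hr _ _ (grid_ge0 hT n i) a12 b12 (grid_leT hT ni).
rewrite /disc_cell Xa Xb lu uX fa fb !andbT; apply/eqP => /S_inj.
by rewrite -[in RHS](jump_pred s0 js) => /n_Sn.
Qed.

(** The time of the (k + 1)-st jump, when k < f T. *)
Let jump_time k := sup [set x | 0 <= x <= T /\ (f x <= k)%N].

Lemma jump_timeP k : (k < f T)%N -> [/\ 0 < jump_time k <= T, jump_at (jump_time k),
  (k < f (jump_time k))%N & forall x, 0 <= x -> x < jump_time k -> (f x <= k)%N].
Proof.
move=> kT; have [f0 _ _ _] := f_counting.
pose E := [set x | 0 <= x <= T /\ (f x <= k)%N]; set s := jump_time k.
have E0 : E 0 by split; [rewrite lexx ltW|rewrite f0].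
have ET : ubound E T by move=> x [/andP[]].
have Es : has_sup E by split; [exists 0|exists T].
have s0 : 0 <= s by apply: ub_le_sup => //; exists T.
have sT : s <= T by apply: sup_le_ub => //; exists 0.
have left x : 0 <= x -> x < s -> (f x <= k)%N.
  move=> x0 xs; have sx : 0 < s - x by rewrite subr_gt0.
  have [y [/andP[y0 yT] fy] sy] := sup_adherent sx Es.
  have xy : x <= y by move: sy; rewrite -/(jump_time k) -/s; lra.
  exact: leq_trans (counting_path_mono x0 xy) fy.
have fs : (k < f s)%N.
  rewrite ltnNge; apply/negP => fsk.
  have sT' : s < T by rewrite lt_neqAle sT andbT; apply/eqP => sE; rewrite sE leqNgt kT in fsk.
  have [r r0 Hr] := counting_path_right s0.
  pose x := Num.min T (s + r / 2).
  have sx : s < x by rewrite /x lt_min sT' ltrDl divr_gt0.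
  have xT : x <= T by rewrite /x ge_min lexx.
  have xr : x <= s + r / 2 by rewrite /x ge_min lexx orbT.
  have : x <= s.
    apply: ub_le_sup; first by exists T.
    by split; [apply/andP; split; lra|rewrite (Hr x)//; apply/andP; split; lra].
  lra.
have s0' : 0 < s by rewrite lt_neqAle s0 andbT; apply/eqP => sE; move: fs; rewrite -sE f0.
split => //; first by rewrite s0'.
by move=> x x0 xs; exact: leq_ltn_trans (left x x0 xs) fs.
Qed.

(** The threshold for n has to be common to all cells. A cell over which the count leaves the value
    k contains the jump time of index k, so the finitely many indices k < f T decide. *)
Lemma disc_cell_upcross : \forall n \near \oo, forall i, (i < n.+1)%N -> disc_cell n i ->
  exists2 s, disc_upcross s & in_cell T n i s.
Proof.
have : \forall n \near \oo, forall k, k \in iota 0 (f T) -> forall i, (i < n.+1)%N -> disc_cell n i ->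
    f (grid T n i) = k -> exists2 s, disc_upcross s & in_cell T n i s.
  apply: near_all_seq => k; rewrite mem_iota add0n /= => kT.
  have [sT js fs left] := jump_timeP kT; set s := jump_time k in sT js fs left.
  have /andP[s0 sT1] := sT.
  have [r r0 Hr] := jump_local sT js.
  apply: filterS (mesh_near hT r0) => n hn i ni /and3P[Sab Xa Xb] fa.
  have fab : (f (grid T n i) < f (grid T n i.+1))%N.
    rewrite ltn_neqAle counting_path_mono ?grid_ge0 ?grid_le// andbT.
    by apply: contra Sab => /eqP ->.
  have ci : in_cell T n i s.
    apply/andP; split; rewrite ltNge || rewrite leNgt; apply/negP => h.
      have := counting_path_mono (ltW s0) h; rewrite fa leqNgt fs; exact/negP.
    by have := left _ (grid_ge0 hT n i.+1) h; rewrite -fa leqNgt fab.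
  exists s => //.
  have [a12 b12] := cell_near ci hn.
  have [_ _ Xa' Xb'] := Hr _ _ (grid_ge0 hT n i) a12 b12 (grid_leT hT ni).
  split => //; exists (z s + S (f s).-1); split; first exact: path_left_limit.
  by rewrite -Xa' -Xb' Xa Xb.
apply: filterS => n H i ni di; apply: (H (f (grid T n i))) => //.
have /and3P[Sab _ _] := di.
rewrite mem_iota add0n /=; apply: (@leq_trans (f (grid T n i.+1))).
  rewrite ltn_neqAle counting_path_mono ?grid_ge0 ?grid_le// andbT.
  by apply: contra Sab => /eqP ->.
by apply: counting_path_mono; [exact: grid_ge0|exact: grid_leT].
Qed.

End path.

Section bad_paths.
Context (R : realType) (T u : R) (z : R -> R) (f : R -> nat) (S : nat -> R).
Hypotheses (hT : 0 < T) (z_C1 : C1_on `[0, T] z) (f_counting : counting_path f).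

Let X t := z t + S (f t).

(** The first grid point after s is within one mesh of s, and there X has moved by at most e times
    the mesh. The condition at T gives s < T, so that such a grid point exists. *)
Lemma tangency_near_grid s : 0 <= s <= T -> X s = u -> path_derivative T z s 0 -> X T <> u ->
  forall e, 0 < e -> \forall n \near \oo, exists2 i, (i <= n.+1)%N & `|X (grid T n i) - u| <= mesh T n * e.
Proof.
move=> sT Xs ds XT e e0; have /andP[s0 sT1] := sT.
have sT' : s < T by rewrite lt_neqAle sT1 andbT; apply/eqP => sE; apply: XT; rewrite -sE.
have [r1 r10 H1] := path_eps ds e0.
have [r2 r20 H2] := counting_path_right f_counting s0.
have r0 : 0 < Num.min r1 r2 by rewrite lt_min r10.
apply: filterS (mesh_near hT r0) => n; rewrite lt_min => /andP[h1 h2].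
have ex : exists j, s < grid T n j by exists n.+1; rewrite gridT.
case: (ex_minnP ex) => -[|i] Hi min; first by move: Hi; rewrite grid0; lra.
have ni : (i <= n)%N by have := min n.+1; rewrite gridT ltnS; exact.
have ss : grid T n i <= s by rewrite leNgt; apply/negP => /min; rewrite ltnn.
exists i.+1; first by rewrite ltnS.
have bT := grid_leT hT (ni : (i.+1 <= n.+1)%N).
have b0 := grid_ge0 hT n i.+1.
move: Hi bT b0 ; set x := grid T n i.+1 => sx xT x0.
have xm : x - s <= mesh T n by move: ss; rewrite /x gridS; lra.
have fx : f x = f s by apply: H2; rewrite (ltW sx)/=; lra.
have x0T : 0 <= x <= T by rewrite x0.
have xs0 : 0 < x - s by rewrite subr_gt0.
have := H1 x x0T; rewrite mul0r subr0 (gtr0_norm xs0) => H.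
have -> : X x - u = z x - z s by rewrite -Xs /X fx; ring.
apply: le_trans (H _) _; first exact: le_lt_trans xm h1.
by rewrite mulrC ler_wpM2r// ltW.
Qed.

Lemma jump_near_grid s : injective S -> 0 < s <= T -> jump_at f s -> X s = u \/ z s + S (f s).-1 = u ->
  forall e, 0 < e -> \forall n \near \oo, exists2 i, (i < n.+1)%N &
    S (f (grid T n i)) != S (f (grid T n i.+1)) /\
    (`|X (grid T n i) - u| <= e \/ `|X (grid T n i.+1) - u| <= e).
Proof.
move=> S_inj sT js Xs e e0; have /andP[s0 sT1] := sT.
have sT' : 0 <= s <= T by rewrite (ltW s0).
have [r1 r10 H1] := path_cont z_C1 sT' e0.
have [r2 r20 H2] := counting_path_left f_counting s0 js.
have [r3 r30 H3] := counting_path_right f_counting (ltW s0).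
have r0 : 0 < Num.min r1 (Num.min r2 r3) by rewrite !lt_min r10 r20.
apply: filterS (mesh_near hT r0) => n; rewrite !lt_min => /and3P[h1 h2 h3].
have [i ni ci] := cell_exists n sT.
have [a1 b1] := cell_near ci h1; have [a2 _] := cell_near ci h2; have [_ b3] := cell_near ci h3.
have fa : f (grid T n i) = (f s).-1 by apply: H2 => //; exact: grid_ge0.
have fb : f (grid T n i.+1) = f s by exact: H3.
exists i => //; rewrite /X fa fb; split.
  by apply/eqP => /S_inj; rewrite -[in RHS](jump_pred s0 js) => /n_Sn.
case: Xs => Xs; [right|left].
  have -> : z (grid T n i.+1) + S (f s) - u = z (grid T n i.+1) - z s by rewrite -Xs /X; ring.
  by apply/ltW/H1; [rewrite grid_ge0// grid_leT|exact: dist_right b1 (lexx _)].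
have -> : z (grid T n i) + S (f s).-1 - u = z (grid T n i) - z s by rewrite -Xs; ring.
by apply/ltW/H1; [rewrite grid_ge0// grid_leT// ltnW|exact: dist_left a1 (lexx _)].
Qed.

End bad_paths.

(** * Enclosing events of probability zero *)

Section null_events.
Context d (Om : measurableType d) (R : realType) (P : probability Om R).

Lemma null_bigcup (F : nat -> set Om) : (forall k, measurable (F k)) -> (forall k, P (F k) = 0%E) ->
  P (\bigcup_k F k) = 0%E.
Proof.
move=> mF F0; apply/negligibleP; first exact: bigcupT_measurable.
by apply: negligible_bigcup => k; apply/negligibleP => //; exact: F0.
Qed.

Lemma measurable_ge1 (g : Om -> R) : measurable_fun setT g -> measurable [set w | (1 <= g w)%R].
Proof. by move=> mg; have := measurable_fun_le measurableT (measurable_cst (1 : R)) mg; rewrite setTI. Qed.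

Lemma markov_ge1 (g : Om -> R) : bmf g -> (forall w, 0 <= g w) ->
  (P [set w | (1 <= g w)%R] <= (\int[P]_w g w)%:E)%E.
Proof.
move=> bg g0; have mA : measurable [set w | 1 <= g w].
  by have [mg _] := bg; exact: measurable_ge1.
rewrite -[leLHS]fineK ?fin_num_measure// lee_fin -RE_indic//.
apply: RE_le => //; first exact: bmf_indic.
by move=> w; rewrite indicE; have [|_] := boolP (w \in _); rewrite ?inE.
Qed.

(** An enclosure for bad paths: for every m, g m n >= 1 for all large n. It is a countable
    combination of events with n fixed, unlike a union over all times. *)
Definition eventually_ge1 (g : nat -> nat -> Om -> R) : set Om :=
  \bigcap_m \bigcup_k \bigcap_(n in [set n | (k <= n)%N]) [set w | (1 <= g m n w)%R].

(** Markov's inequality gives c / (m + 1) for each fixed n; the increasing union over the thresholds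
    keeps this bound, and m is arbitrary. *)
Lemma eventually_ge1_null (g : nat -> nat -> Om -> R) (c : R) :
  (forall m n, bmf (g m n)) -> (forall m n w, 0 <= g m n w) ->
  (forall m n, \int[P]_w g m n w <= c / m.+1%:R) ->
  measurable (eventually_ge1 g) /\ P (eventually_ge1 g) = 0%E.
Proof.
move=> bg g0 gc.
have mA m n : measurable [set w | (1 <= g m n w)%R].
  by have [mg _] := bg m n; exact: measurable_ge1.
pose C m k := \bigcap_(n in [set n | (k <= n)%N]) [set w | (1 <= g m n w)%R].
have mC m k : measurable (C m k) by apply: bigcap_measurableType => n _; exact: mA.
have mU m : measurable (\bigcup_k C m k) by exact: bigcupT_measurable.
have mN : measurable (eventually_ge1 g) by apply: bigcap_measurableType => m _; exact: mU.
split => //.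
have key m : (P (eventually_ge1 g) <= (c / m.+1%:R)%:E)%E.
  apply: (@le_trans _ _ (P (\bigcup_k C m k))).
    by apply: le_measure; rewrite ?inE// => w; apply.
  have nd : nondecreasing_seq (C m).
    apply/nondecreasing_seqP => k; apply/subsetPset => w Cw n /= kn; apply: Cw => /=; exact: ltnW.
  have := nondecreasing_cvg_mu (mC m) (mU m) nd (mu := P).
  move=> /cvg_lim <-//; apply: lime_le.
    by apply/cvg_ex; eexists; exact: (nondecreasing_cvg_mu (mC m) (mU m) nd (mu := P)).
  apply: nearW => k /=; apply: (@le_trans _ _ (P [set w | (1 <= g m k w)%R])).
    by apply: le_measure; rewrite ?inE// => w; apply => /=.
  by apply: (le_trans (markov_ge1 (bg m k) (g0 m k))); rewrite lee_fin.
apply/eqP; rewrite eq_le measure_ge0 andbT.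
have cv : (c / m.+1%:R)%:E @[m --> \oo] --> (0%:E : \bar R).
  by apply: cvg_EFin; [exact: nearW|exact: cvg_invS_0].
have -> : (0%E : \bar R) = limn (fun m => (c / m.+1%:R)%:E) by exact/esym/cvg_lim.
apply: lime_ge; first by apply/cvg_ex; eexists; exact: cv.
by apply: nearW => m; exact: key.
Qed.

End null_events.

(** * Cell probabilities *)

Lemma cvg_approx (R : realType) (x y b : nat -> R) (l : R) :
  (\forall n \near \oo, `|x n - y n| <= b n) -> y n @[n --> \oo] --> l ->
  b n @[n --> \oo] --> 0 -> x n @[n --> \oo] --> l.
Proof.
move=> xy yl b0; rewrite (_ : x = (fun n => y n + (x n - y n))); last by apply/funext => n; rewrite addrC subrK.
rewrite -[l]addr0; apply: cvgD => //; apply: norm_cvg0.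
by apply: (squeeze_cvgr _ (cvg_cst 0) b0); apply: filterS xy => n ->; rewrite normr_ge0.
Qed.

Section jump_diffusion.
Context d (Om : measurableType d) (R : realType) (P : probability Om R) (T lambda u : R).
Context (Z : R -> {RV P >-> R}) (nu : R -> {RV P >-> nat}) (xi : nat -> {RV P >-> R}).
Hypotheses (hT : 0 < T) (hlambda : 0 < lambda)
    (Z_gaussian : gaussian_process P `[0, T] Z)
    (Z_centered : centered_process P `[0, T] Z)
    (Z_stationary : stationary_process P `[0, T] Z)
    (Z_C1 : forall w, C1_on `[0, T] (fun t => Z t w))
    (Z_var : covariance_function P Z 0 = 1)
    (nu_poisson : poisson_process P lambda nu)
    (xi_gaussian : forall n, standard_gaussian P (xi n))
    (xi_indep : independent_family P xi)
    (nu_xi_indep : independent_systems P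
       (sigma_family [set t | 0 <= t] nu) (sigma_family [set: nat] xi))
    (Z_J_indep : independent_systems P
       (sigma_family `[0, T] Z) (sigma_family `[0, T] (compound nu xi))).

Local Notation J := (compound nu xi).
Local Notation S := (partial_sum xi).
Local Notation Gamma := (covariance_function P Z).
Local Notation prob := (pair_prob xi Z).
Local Notation incr s t w := ((Z s w, Z t w), (J s w, J t w)).
Local Notation cell_incr n i w := (incr (grid T n i) (grid T n i.+1) w).

Lemma bmf_pair_prob_in (f : (R * R) * (R * R) -> R) s t k m : bmf f ->
  bmf (fun z : Om * Om => f ((Z s z.2, Z t z.2), (S k z.1, S m z.1))).
Proof.
move=> bf; apply: (bmf_comp bf); apply: measurable_fun_pair.
  by apply: measurable_fun_pair; apply: measurableT_comp.
by apply: measurable_fun_pair; apply: measurableT_comp => //; exact: measurable_partial_sum.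
Qed.

Lemma bmf_inner (f : (R * R) * (R * R) -> R) s t k m w' : bmf f ->
  bmf (fun w => f ((Z s w, Z t w), (S k w', S m w'))).
Proof.
move=> bf; apply: (bmf_comp (bmf_pair_prob_in s t k m bf) (g := fun w => (w', w))).
exact: measurable_fun_pair.
Qed.

Lemma bmf_outer (f : (R * R) * (R * R) -> R) s t k m : bmf f ->
  bmf (fun w' => \int[P]_w f ((Z s w, Z t w), (S k w', S m w'))).
Proof. by move=> bf; exact: (bmf_fubini1 P P (bmf_pair_prob_in s t k m bf)). Qed.

Lemma pair_prob_stationary f s t k m : bmf f -> 0 <= s -> s <= t -> t <= T ->
  prob f s t k m = prob f 0 (t - s) k m.
Proof.
move=> bf s0 st tT; apply: RE_ext => w'.
apply: (@RE_law _ _ _ _ _ _ _ P P (fun w => (Z s w, Z t w)) (fun w => (Z 0 w, Z (t - s) w))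
  (fun z => f (z, (S k w', S m w')))).
- exact: measurable_fun_pair.
- exact: measurable_fun_pair.
- exact: (stationary_pair hT Z_stationary).
- by apply: (bmf_comp bf); exact: measurable_fun_pair.
Qed.

Lemma pair_prob_bound f s t k m : bmf f -> (forall z, 0 <= f z <= 1) -> 0 <= prob f s t k m <= 1.
Proof.
move=> bf f01.
have in01 w' : 0 <= \int[P]_w f ((Z s w, Z t w), (S k w', S m w')) <= 1.
  rewrite -[X in X <= _ <= _](REcst P 0) -[X in _ <= _ <= X](REcst P 1).
  by apply/andP; split; apply: RE_le => [||w]; try exact: bmf_cst; try exact: bmf_inner;
     have /andP[] := f01 ((Z s w, Z t w), (S k w', S m w')).
rewrite /pair_prob -[X in X <= _ <= _](REcst P 0) -[X in _ <= _ <= X](REcst P 1).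
by apply/andP; split; apply: RE_le => [||w]; try exact: bmf_cst; try exact: bmf_outer;
  have /andP[] := in01 w.
Qed.

Lemma pair_prob_norm f s t k m : bmf f -> (forall z, 0 <= f z <= 1) -> `|prob f s t k m| <= 1.
Proof. by move=> bf f01; have /andP[p0 p1] := pair_prob_bound s t k m bf f01; rewrite ger0_norm. Qed.

Lemma indic01 (A : set ((R * R) * (R * R))) z : 0 <= (\1_A z : R) <= 1.
Proof. by rewrite indicE; case: (_ \in _); rewrite /= ?lexx ?ler01. Qed.

Definition same_jump (z : (R * R) * (R * R)) : bool := z.2.1 == z.2.2.

Lemma bmf_same_jump : bmf (fun z => (same_jump z)%:R : R).
Proof.
rewrite (_ : (fun z => _) = \1_[set z | z.2.1 = z.2.2]).
  apply: bmf_indic; apply: measurable_eq_set.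
    exact: (measurableT_comp measurable_fst measurable_snd).
  exact: (measurableT_comp measurable_snd measurable_snd).
apply/funext => z; rewrite indicE; congr (_%:R); congr nat_of_bool.
by apply/eqP/idP; rewrite inE.
Qed.

Definition cont_cross z : R := (same_jump z)%:R * \1_(crossing u) z.

Definition disc_cross z : R := (~~ same_jump z)%:R * \1_(crossing u) z.

Lemma bmf_crossing : bmf (\1_(crossing u) : _ -> R).
Proof. by apply: bmf_indic; exact: measurable_crossing. Qed.

Lemma bmf_cont_cross : bmf cont_cross.
Proof. by apply: bmfM; [exact: bmf_same_jump|exact: bmf_crossing]. Qed.

Lemma bmf_disc_cross : bmf disc_cross.
Proof.
apply: bmfM; last exact: bmf_crossing.
rewrite (_ : (fun z => _) = (fun z => 1 - (same_jump z)%:R)).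
  by apply: bmfB; [exact: bmf_cst|exact: bmf_same_jump].
by apply/funext => z; case: (same_jump z); rewrite /= ?subrr ?subr0.
Qed.

(** Outside the null event S_k = S_m, f and f' are only evaluated where the two values of J
    differ. *)
Lemma pair_prob_off f f' s t k m : bmf f -> bmf f' -> k != m ->
  (forall z, ~~ same_jump z -> f z = f' z) -> prob f s t k m = prob f' s t k m.
Proof.
move=> bf bf' km ff'; rewrite /pair_prob.
apply: (@RE_ae _ _ _ P _ _ [set w | S k w = S m w]).
- exact: bmf_outer.
- exact: bmf_outer.
- by apply: measurable_eq_set; exact: measurable_partial_sum.
- exact: partial_sum_inj_ae.
- by move=> w' /= H; apply: RE_ext => w; apply: ff'; exact/eqP.
Qed.

Lemma pair_prob_on f f' s t k : (forall z, same_jump z -> f z = f' z) ->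
  prob f s t k k = prob f' s t k k.
Proof. by move=> ff'; apply: RE_ext => w'; apply: RE_ext => w; apply: ff'; exact: eqxx. Qed.

Lemma pair_prob0 s t k m : prob (fun=> 0) s t k m = 0.
Proof. by rewrite /pair_prob (RE_ext P (g := fun=> 0)) ?REcst// => w; rewrite REcst. Qed.

(** Up to a null event the indicator asks for no jump between s and t, which is independent of nu_s
    and has probability exp(- lambda (t - s)). Stationarity moves the cell to the origin. *)
Lemma cont_cross_transition s t : 0 <= s -> s < t -> t <= T ->
  \int[P]_w cont_cross (incr s t w) =
  expR (- (lambda * (t - s))) * \int[P]_w prob (\1_(crossing u)) 0 (t - s) (nu s w) (nu s w).
Proof.
move=> s0 st tT; have st' := ltW st.
rewrite (RE_increment nu_xi_indep Z_J_indep); [|by apply/andP; split => //; lra|by apply/andP; split => //; lra|exact: bmf_cont_cross].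
rewrite (RE_ext P (g := fun w => prob (\1_(crossing u)) 0 (t - s) (nu s w) (nu s w) * ((nu t w - nu s w)%N == 0%N)%:R)).
  rewrite (@poisson_incr_RE _ _ _ _ _ nu nu_poisson s t (fun k => prob (\1_(crossing u)) 0 (t - s) k k) (fun j => (j == 0%N)%:R) 1 1)//.
  - by rewrite (poisson_incr_eq hlambda nu_poisson)//= expr0 invr1 mul1r mul1r mulrC.
  - by move=> k; apply: pair_prob_norm; [exact: bmf_crossing|exact: indic01].
  - by move=> j; rewrite normr_nat lern1 leq_b1.
move=> w; rewrite subn_eq0.
have le := poisson_mono nu_poisson w s0 st'.
have [H|H] := eqVneq (nu s w) (nu t w).
  rewrite -H leqnn mulr1 (@pair_prob_stationary cont_cross s t (nu s w) (nu s w) bmf_cont_cross s0 st' tT).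
  by apply: pair_prob_on => z zz; rewrite /cont_cross zz mul1r.
rewrite leqNgt ltn_neqAle H le mulr0 -(pair_prob0 s t (nu s w) (nu t w)).
apply: pair_prob_off => //; [exact: bmf_cont_cross|exact: bmf_cst|].
by move=> z /negbTE zz; rewrite /cont_cross zz mul0r.
Qed.

(** With mu = lambda (t - s): two jumps or more cost mu^2, and replacing the probability mu exp(-
    mu) of a single jump by mu costs another mu^2. *)
Lemma disc_cross_transition s t : 0 <= s -> s < t -> t <= T ->
  `|\int[P]_w disc_cross (incr s t w) -
  lambda * (t - s) * \int[P]_w prob (\1_(crossing u)) 0 (t - s) (nu s w) (nu s w).+1|
  <= 2 * (lambda * (t - s)) ^+ 2.
Proof.
move=> s0 st tT; have st' := ltW st.
set mu := lambda * (t - s); have mu0 : 0 < mu by rewrite mulr_gt0// subr_gt0.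
rewrite (RE_increment nu_xi_indep Z_J_indep); [|by apply/andP; split => //; lra|by apply/andP; split => //; lra|exact: bmf_disc_cross].
have c01 := indic01 (crossing u).
have d01 z : 0 <= disc_cross z <= 1.
  by have := c01 z; rewrite /disc_cross; case: (same_jump z); rewrite /= ?mul1r ?mul0r ?lexx ?ler01.
set x := \int[P]_w prob (\1_(crossing u)) 0 (t - s) (nu s w) (nu s w).+1.
have Ex : \int[P]_w (prob (\1_(crossing u)) 0 (t - s) (nu s w) (nu s w).+1 * ((nu t w - nu s w)%N == 1%N)%:R) = x * (mu * expR (- mu)).
  rewrite (@poisson_incr_RE _ _ _ _ _ nu nu_poisson s t (fun k => prob (\1_(crossing u)) 0 (t - s) k k.+1) (fun j => (j == 1%N)%:R) 1 1)//.
  - by rewrite (poisson_incr_eq hlambda nu_poisson)//= expr1 invr1 mulr1.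
  - by move=> k; apply: pair_prob_norm => //; exact: bmf_crossing.
  - by move=> j; rewrite normr_nat lern1 leq_b1.
have x1 : 0 <= x <= 1.
  have bx : bmf (fun w => prob (\1_(crossing u)) 0 (t - s) (nu s w) (nu s w).+1).
    by apply: (bmf_nat (b := fun k => prob (\1_(crossing u)) 0 (t - s) k k.+1) (M := 1)) => // k; apply: pair_prob_norm => //; exact: bmf_crossing.
  rewrite -[X in X <= _ <= _](REcst P 0) -[X in _ <= _ <= X](REcst P 1).
  by apply/andP; split; apply: RE_le => [||w]; try exact: bmf_cst; try exact: bx;
    have /andP[] := @pair_prob_bound (\1_(crossing u)) 0 (t - s) (nu s w) (nu s w).+1 bmf_crossing c01.
have bd : bmf (fun w => prob disc_cross s t (nu s w) (nu t w)).
  split; last by exists 1 => w; apply: pair_prob_norm => //; exact: bmf_disc_cross.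
  exact: (measurable_nat2 (fun k m => prob disc_cross s t k m)).
have bn (b : nat -> R) : (forall k, `|b k| <= 1) -> bmf (fun w => b (nu t w - nu s w)%N).
  by move=> b1; apply: (bmf_nat (b := b) (M := 1)) => //; exact: measurable_incr.
have b2 : bmf (fun w => (2 <= nu t w - nu s w)%N%:R : R).
  by apply: (bn (fun j => (2 <= j)%N%:R)) => j; rewrite normr_nat lern1 leq_b1.
have be : bmf (fun w => prob (\1_(crossing u)) 0 (t - s) (nu s w) (nu s w).+1 * ((nu t w - nu s w)%N == 1%N)%:R).
  apply: bmfM; last by apply: (bn (fun j => (j == 1%N)%:R)) => j; rewrite normr_nat lern1 leq_b1.
  by apply: (bmf_nat (b := fun k => prob (\1_(crossing u)) 0 (t - s) k k.+1) (M := 1)) => // k; apply: pair_prob_norm => //; exact: bmf_crossing.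
have E1 : `|\int[P]_w prob disc_cross s t (nu s w) (nu t w) - x * (mu * expR (- mu))| <= mu ^+ 2.
  rewrite -Ex -REB//; apply: le_trans (poisson_incr_ge2 hlambda nu_poisson s0 st).
  apply: RE_norm_le => //; first exact: bmfB.
  move=> w; have := poisson_mono nu_poisson w s0 st'.
  move: (nu s w) (nu t w) => k m km; rewrite -{1}(subnKC km).
  case: (m - k)%N => [|[|j]] /=.
  - rewrite addn0 mulr0 subr0 (_ : prob _ _ _ _ _ = 0) ?normr0// -(pair_prob0 s t k k).
    by apply: pair_prob_on => z zz; rewrite /disc_cross zz mul0r.
  - rewrite addn1 mulr1 -(@pair_prob_stationary (\1_(crossing u)))//; last exact: bmf_crossing.
    have -> : prob disc_cross s t k k.+1 = prob (\1_(crossing u)) s t k k.+1; last by rewrite subrr normr0.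
    apply: pair_prob_off => //; [exact: bmf_disc_cross|exact: bmf_crossing|by rewrite ltn_eqF|].
    by move=> z zz; rewrite /disc_cross zz mul1r.
  - by rewrite mulr0 subr0; apply: pair_prob_norm => //; exact: bmf_disc_cross.
have e1 : 1 - mu <= expR (- mu) by have := expR_ge1Dx (- mu).
have e2 : expR (- mu) <= 1 by rewrite -expR0 ler_expR; lra.
have e3 : 0 <= mu * (1 - expR (- mu)) <= mu ^+ 2 by nra.
move: E1; set y := \int[P]_w _ => E1.
have E2 : `|x * (mu * (1 - expR (- mu)))| <= mu ^+ 2.
  have /andP[e4 e5] := e3; have /andP[x2 x3] := x1.
  rewrite normrM (ger0_norm e4) (ger0_norm x2) -[leRHS]mul1r; exact: ler_pM.
have -> : y - mu * x = (y - x * (mu * expR (- mu))) - x * (mu * (1 - expR (- mu))) by ring.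
apply: (le_trans (ler_normB _ _)); rewrite (_ : 2 * mu ^+ 2 = mu ^+ 2 + mu ^+ 2); last by ring.
exact: lerD.
Qed.

Lemma gp_charN1 t : `[0, T]%classic t -> charN P (Z t) 1.
Proof.
move=> Dt; have [v Hv] := gp_comb3 Z_gaussian Z_centered 1 0 0 Dt Dt Dt.
have := gp_comb3_var Z_gaussian Z_centered Dt Dt Dt Hv.
rewrite (mean_prod_diag hT Z_gaussian Z_centered Z_stationary Z_var Dt).
have [_ v0 _] := Hv => E.
have v1 : v = 1.
  by apply/eqP; rewrite -(@eqrXn2 _ 2)//; apply/eqP; rewrite E; ring.
by rewrite -v1; apply: charN_ext Hv => w; rewrite mul1r !mul0r !addr0.
Qed.

(** The standard deviation of D = (Z_h - Z_0) / 2. *)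
Let sd h := Num.sqrt ((1 - Gamma h) / 2).

Lemma cont_cross_approx h k : 0 < h <= T -> 0 <= Gamma h ->
  `|prob (\1_(crossing u)) 0 h k k - 2 * (sd h * normal_peak 1) * normal_pdf 0 (Num.sqrt k.+1%:R) u|
  <= 4 * sd h ^+ 2 + 4 * (1 + 2 * `|u|) * sd h ^+ 3.
Proof.
move=> hh G0; have [HS HD G1 iSD] := gp_sum_diff_indep hT Z_gaussian Z_centered Z_stationary Z_var hh.
have G1' : Gamma h <= 1 by move: G1; rewrite ger0_norm.
have e2 : sd h ^+ 2 = (1 - Gamma h) / 2 by rewrite sqr_sqrtr//; lra.
have <- : \int[P]_w' \int[P]_w (\1_(slab u) (((Z 0 w + Z h w) / 2, S k w'), (Z h w - Z 0 w) / 2) : R) =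
    prob (\1_(crossing u)) 0 h k k; last first.
  exact: (slab_approx u G0 G1' (sqrtr_ge0 _) e2 HS HD iSD (partial_sum_charN xi_gaussian xi_indep k)).
apply: RE_ext => w'; apply: RE_ext => w; rewrite !indicE; congr (_%:R); congr nat_of_bool.
rewrite /slab /crossing; apply/idP/idP; rewrite !inE/= ltr_norml.
  by move=> /andP[h1 h2]; split; lra.
by move=> [h1 h2]; apply/andP; split; lra.
Qed.

(** Z is frozen at its value at the start of the cell. The increment Z_h - Z_0 has standard
    deviation 2 [sd h], and the perturbation bound has the factor 4, whence 8. *)
Lemma disc_cross_approx h k : 0 < h <= T ->
  `|prob (\1_(crossing u)) 0 h k k.+1 - jump_prob u k| <= 8 * sd h.
Proof.
move=> hh; have [_ HD _ _] := gp_sum_diff_indep hT Z_gaussian Z_centered Z_stationary Z_var hh.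
have HD2 : charN P (fun w => Z h w - Z 0 w) (2 * sd h).
  have := charN_scale 2 HD; rewrite ger0_norm//; apply: charN_ext => w; by field.
have D0 : `[0, T]%classic (0 : R) by rewrite /= in_itv/= lexx ltW.
have HS := partial_sum_charN xi_gaussian xi_indep.
have mS := measurable_partial_sum xi k.
have k1 : 1 <= Num.sqrt k.+1%:R :> R by rewrite -[leLHS]sqrtr1 ler_wsqrtr// ler1n.
have := crossing_perturb u (measurable_funPT (Z 0)) (measurable_funPT (Z h)) mS HD2 (HS k.+1) k1.
have := jump_crossing_prob u (gp_charN1 D0) (HS k) (xi_charN xi_gaussian k) (partial_sum_indep xi_indep k).
rewrite (_ : \int[P]_w' \int[P]_w \1_(crossing u) (Z 0 w, Z 0 w, (S k w', S k w' + xi k w')) =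
  \int[P]_w' \int[P]_w \1_(crossing u) (Z 0 w, Z 0 w, (S k w', S k.+1 w'))); last first.
  by apply: RE_ext => w'; apply: RE_ext => w; rewrite partial_sumS.
by move=> ->; rewrite mulrA; have -> : 4 * 2 = 8 :> R by ring.
Qed.

(** * Limits of the mean cell counts *)

Section mean_limits.

Let h n := mesh T n.

Let hh n : 0 < h n <= T. Proof. by rewrite mesh_gt0//= mesh_le. Qed.

Context (a : R).
Hypotheses (a0 : 0 <= a) (Gamma_a : forall h : nat -> R, (forall n, 0 < h n <= T) -> h n @[n --> \oo] --> 0 ->
    2 * (1 - Gamma (h n)) / h n ^+ 2 @[n --> \oo] --> a ^+ 2).

(** The standard deviation of (Z_h - Z_0) / h, with limit a; thus [sd (h n)] is h rho / 2. *)
Let rho n := Num.sqrt (2 * (1 - Gamma (h n)) / h n ^+ 2).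

Let sdE n : sd (h n) = h n * rho n / 2.
Proof.
have [_ _ G1 _] := gp_sum_diff_indep hT Z_gaussian Z_centered Z_stationary Z_var (hh n).
have h0 : 0 < h n by have /andP[] := hh n.
have G2 : 0 <= 1 - Gamma (h n) by rewrite subr_ge0 (le_trans (ler_norm _)).
apply/eqP; rewrite -(@eqrXn2 _ 2)//; last 2 first.
- exact: sqrtr_ge0.
- by rewrite divr_ge0// mulr_ge0 ?sqrtr_ge0// ltW.
rewrite sqr_sqrtr; last by rewrite divr_ge0.
have E : rho n ^+ 2 = 2 * (1 - Gamma (h n)) / h n ^+ 2.
  by rewrite sqr_sqrtr//; apply: divr_ge0; [exact: mulr_ge0|exact: sqr_ge0].
have -> : (h n * rho n / 2) ^+ 2 = h n ^+ 2 * rho n ^+ 2 / 4 by field.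
by rewrite E; apply/eqP; field; rewrite gt_eqF.
Qed.

Let rho_cvg : rho n @[n --> \oo] --> a.
Proof.
rewrite -[a]ger0_norm// -sqrtr_sqr.
apply: (cvg_comp _ _ (Gamma_a hh (cvg_mesh T))).
exact: sqrt_continuous.
Qed.

Let h_cvg : h n @[n --> \oo] --> 0. Proof. exact: cvg_mesh. Qed.

Let exp_cvg : expR (- (lambda * h n)) @[n --> \oo] --> (1 : R).
Proof.
have c : - (lambda * h n) @[n --> \oo] --> (- (lambda * 0) : R) by apply: cvgN; apply: cvgMr.
rewrite mulr0 oppr0 in c; rewrite -expR0.
by apply: (@continuous_cvg _ _ _ _ _ (fun n => - (lambda * h n)) expR) => //; exact: continuous_expR.
Qed.

(** 1 - Gamma(h) = h^2 rho^2 / 2 tends to 0; the slab estimate asks for Gamma(h) >= 0. *)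
Let Gamma_pos : \forall n \near \oo, 0 <= Gamma (h n).
Proof.
have c : h n ^+ 2 * rho n ^+ 2 / 2 @[n --> \oo] --> (0 ^+ 2 * a ^+ 2 / 2 : R).
  by apply: cvgMl; apply: cvgM; apply: cvgrX.
rewrite expr0n/= mul0r mul0r in c.
have /cvgrPdist_le/(_ 1 ltr01) := c.
apply: filterS => n; rewrite sub0r normrN => /(le_trans (ler_norm _)).
have [_ _ G1 _] := gp_sum_diff_indep hT Z_gaussian Z_centered Z_stationary Z_var (hh n).
have h0 : 0 < h n by have /andP[] := hh n.
have G2 : 0 <= 1 - Gamma (h n) by rewrite subr_ge0 (le_trans (ler_norm _)).
rewrite (@sqr_sqrtr _ (2 * _ / _)); last by apply: divr_ge0; [exact: mulr_ge0|exact: sqr_ge0].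
have -> : h n ^+ 2 * (2 * (1 - Gamma (h n)) / h n ^+ 2) / 2 = 1 - Gamma (h n) by field; rewrite gt_eqF.
lra.
Qed.

(** Up to a factor tending to 1, a cell contributes 2 sd(h) phi(0) E b(nu) = h rho phi(0) E b(nu)
    with an error of order h^2, and n + 1 such errors add up to order h. The Riemann sums carry
    lambda h instead of h, whence l / lambda. *)
Lemma mean_cont_cross_cvg (l : R) :
  (\sum_(i < n.+1) lambda * mesh T n * \int[P]_w normal_pdf 0 (Num.sqrt (nu (grid T n i) w).+1%:R) u) @[n --> \oo] --> l ->
  (\sum_(i < n.+1) \int[P]_w cont_cross (cell_incr n i w)) @[n --> \oo] -->
  (a * normal_peak 1 * (l / lambda) : R).
Proof.
set r := (fun n => _ : R) => rl.
pose b k : R := normal_pdf 0 (Num.sqrt k.+1%:R) u.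
have b01 k : `|b k| <= 1.
  rewrite ger0_norm ?normal_pdf_ge0// (le_trans (normal_pdf_ub _ _ _))//.
  by apply: normal_peak_le1; rewrite -[leLHS]sqrtr1 ler_wsqrtr// ler1n.
have bb t : bmf (fun w => b (nu t w)) by exact: bmf_nat b01.
(* The bound collects n + 1 errors 4 sd^2 + 4 (1 + 2 |u|) sd^3, with sd = h rho / 2 and (n + 1) h =
   T. *)
apply: (@cvg_approx _ _ (fun n => expR (- (lambda * h n)) * (rho n * normal_peak 1) * (r n / lambda))
  (fun n => T * (h n * rho n ^+ 2 + 4 * (1 + 2 * `|u|) * (h n ^+ 2 * rho n ^+ 3 / 8)))); last 2 first.
- rewrite -[a]mul1r -[1 * a * _]mulrA; apply: cvgM; last by apply: cvgMl.
  by apply: cvgM => //; apply: cvgMl.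
- rewrite [X in _ --> X](_ : _ = T * (0 * a ^+ 2 + 4 * (1 + 2 * `|u|) * (0 ^+ 2 * a ^+ 3 / 8))); last by ring.
  apply: cvgMr; apply: cvgD; first by apply: cvgM => //; exact: cvgrX.
  by apply: cvgMr; apply: cvgMl; apply: cvgM; exact: cvgrX.
apply: filterS Gamma_pos => n G0.
have h0 : 0 < h n by have /andP[] := hh n.
have EQ (i : 'I_n.+1) : \int[P]_w cont_cross (cell_incr n i w) =
  expR (- (lambda * h n)) * \int[P]_w prob (\1_(crossing u)) 0 (h n) (nu (grid T n i) w) (nu (grid T n i) w).
  have := cont_cross_transition (grid_ge0 hT n i) (gridS_gt hT n i) (grid_leT hT (ltn_ord i)).
  by have -> : grid T n i.+1 - grid T n i = h n by rewrite gridS addrC addKr.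
under eq_bigr => i _ do rewrite EQ.
rewrite -mulr_sumr.
have -> : expR (- (lambda * h n)) * (rho n * normal_peak 1) * (r n / lambda) =
  expR (- (lambda * h n)) * \sum_(i < n.+1) 2 * (sd (h n) * normal_peak 1) * \int[P]_w b (nu (grid T n i) w).
  have -> : r n = lambda * h n * \sum_(i < n.+1) \int[P]_w b (nu (grid T n i) w) by rewrite mulr_sumr.
  by rewrite -mulr_sumr sdE; field; rewrite gt_eqF.
rewrite -mulrBr -sumrB normrM (ger0_norm (expR_ge0 _)).
apply: (@le_trans _ _ (1 * \sum_(i < n.+1) (4 * sd (h n) ^+ 2 + 4 * (1 + 2 * `|u|) * sd (h n) ^+ 3))).
  apply: ler_pM => //; first by rewrite -expR0 ler_expR oppr_le0 mulr_ge0 ?ltW.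
  apply: (le_trans (ler_norm_sum _ _ _)); apply: ler_sum => i _.
  have bq : bmf (fun w => prob (\1_(crossing u)) 0 (h n) (nu (grid T n i) w) (nu (grid T n i) w)).
    apply: (bmf_nat (b := fun k => prob (\1_(crossing u)) 0 (h n) k k) (M := 1)) => // k.
    by apply: pair_prob_norm => [|z]; [exact: bmf_crossing|exact: indic01].
  rewrite -REZ// -REB//; last by apply: bmfM => //; exact: bmf_cst.
  apply: RE_norm_bound => [|w]; first by apply: bmfB => //; apply: bmfM => //; exact: bmf_cst.
  exact: cont_cross_approx.
rewrite mul1r sumr_const card_ord -mulr_natl sdE -[in X in _ <= X](mesh_mul T n) -/(h n).
rewrite le_eqVlt; apply/orP; left; apply/eqP; by field.
Qed.

Lemma mean_disc_cross_cvg (l : R) :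
  (\sum_(i < n.+1) lambda * mesh T n * \int[P]_w jump_prob u (nu (grid T n i) w)) @[n --> \oo] --> l ->
  (forall k, `|jump_prob u k : R| <= 1) ->
  (\sum_(i < n.+1) \int[P]_w disc_cross (cell_incr n i w)) @[n --> \oo] --> l.
Proof.
set r := (fun n => _ : R) => rl b01.
have bb t : bmf (fun w => jump_prob u (nu t w) : R) by exact: (bmf_nat (b := jump_prob u) _ b01).
(* The bound collects, over n + 1 cells, 2 (lambda h)^2 from the transition estimate and lambda h
   times 8 sd from freezing Z. *)
apply: (cvg_approx (y := r) (b := fun n => T * (2 * lambda ^+ 2 * h n + 4 * lambda * (h n * rho n)))) rl _; last first.
- rewrite [X in _ --> X](_ : _ = T * (2 * lambda ^+ 2 * 0 + 4 * lambda * (0 * a))); last by ring.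
  by apply: cvgMr; apply: cvgD; apply: cvgMr => //; apply: cvgM.
apply: nearW => n; have h0 : 0 < h n by have /andP[] := hh n.
rewrite -sumrB; apply: (le_trans (ler_norm_sum _ _ _)).
apply: (@le_trans _ _ (\sum_(i < n.+1) (2 * (lambda * h n) ^+ 2 + lambda * h n * (8 * sd (h n))))).
  apply: ler_sum => i _.
  have := disc_cross_transition (grid_ge0 hT n i) (gridS_gt hT n i) (grid_leT hT (ltn_ord i)).
  have -> : grid T n i.+1 - grid T n i = h n by rewrite gridS addrC addKr.
  set x := \int[P]_w disc_cross _; set y := \int[P]_w prob _ _ _ _ _; set z := \int[P]_w _ => E1.
  have E2 : `|y - z| <= 8 * sd (h n).
    have bq : bmf (fun w => prob (\1_(crossing u)) 0 (h n) (nu (grid T n i) w) (nu (grid T n i) w).+1).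
      apply: (bmf_nat (b := fun k => prob (\1_(crossing u)) 0 (h n) k k.+1) (M := 1)) => // k.
      by apply: pair_prob_norm => [|v]; [exact: bmf_crossing|exact: indic01].
    rewrite /y /z -REB//; apply: RE_norm_bound => [|w]; first exact: bmfB.
    exact: disc_cross_approx.
  rewrite -/(h n) (_ : x - _ = (x - lambda * h n * y) + lambda * h n * (y - z)); last by ring.
  apply: (le_trans (ler_normD _ _)); apply: lerD => //.
  have lh : 0 <= lambda * h n by rewrite mulr_ge0 ?ltW.
  by rewrite normrM (ger0_norm lh) ler_wpM2l.
rewrite sumr_const card_ord -mulr_natl sdE -[in X in _ <= X](mesh_mul T n) -/(h n).
rewrite le_eqVlt; apply/orP; left; apply/eqP; by field.
Qed.

End mean_limits.

(** * Exceptional paths *)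

Definition level (b : bool) (e : R) : set ((R * R) * (R * R)) :=
  [set z | `|(if b then z.1.2 + z.2.2 else z.1.1 + z.2.1) - u| <= e].

Lemma measurable_level b e : measurable (level b e).
Proof.
rewrite (_ : level b e = ~` [set z : (R * R) * (R * R) | e < `|(if b then z.1.2 + z.2.2 else z.1.1 + z.2.1) - u|]).
  apply: measurableC; apply: (@measurable_lt_set _ _ _ (fun=> e)) => //.
  apply: measurableT_comp; first exact: normr_measurable.
  apply: measurable_funB => //; case: b; apply: measurable_funD.
  - exact: (measurableT_comp measurable_snd measurable_fst).
  - exact: (measurableT_comp measurable_snd measurable_snd).
  - exact: (measurableT_comp measurable_fst measurable_fst).
  - exact: (measurableT_comp measurable_fst measurable_snd).
by apply/seteqP; split => z /=; [rewrite /level/= => h; rewrite ltNge h|move=> /negP; rewrite -leNgt].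
Qed.

Let bl b e : bmf (\1_(level b e) : _ -> R). Proof. exact: (bmf_indic R (measurable_level b e)). Qed.

Lemma Z_level_prob t a e : 0 <= t <= T -> 0 <= e -> (P [set w | (`|Z t w + a - u| <= e)%R] <= (2 * e)%:E)%E.
Proof.
move=> tT e0; have Dt : `[0, T]%classic t by rewrite /= in_itv.
have HZ := gp_charN1 Dt.
have mI : measurable `[((u - a) - e)%R, ((u - a) + e)%R]%classic by exact: measurable_itv.
rewrite (_ : [set w | _] = Z t @^-1` `[((u - a) - e)%R, ((u - a) + e)%R]%classic).
  by rewrite (charN_normal_prob ltr01 HZ mI); exact: normal_prob_itv_le.
apply/seteqP; split => w /=; rewrite in_itv/= ler_norml => /andP[h1 h2]; apply/andP; split; lra.
Qed.

Lemma level_pair_prob b s t k m e : 0 <= s <= T -> 0 <= t <= T -> 0 <= e ->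
  prob (\1_(level b e)) s t k m <= 2 * e.
Proof.
move=> sT tT e0; rewrite -[leRHS](REcst P); apply: RE_le; [exact: bmf_outer|exact: bmf_cst|] => w'.
have -> : \int[P]_w \1_(level b e) (Z s w, Z t w, (S k w', S m w')) =
    \int[P]_w \1_[set w | `|(if b then Z t w + S m w' else Z s w + S k w') - u| <= e] w :> R.
  by apply: RE_ext => w; rewrite !indicE; congr (_%:R); congr nat_of_bool; apply/idP/idP; rewrite !inE; case: (b).
rewrite RE_indic.
  rewrite -lee_fin fineK ?fin_num_measure//.
    by case: (b); exact: Z_level_prob.
  all: have := measurable_level b e.
  all: move=> mL; have mp : measurable_fun setT (fun w : Om => ((Z s w, Z t w), (S k w', S m w'))) by
    apply: measurable_fun_pair => //; exact: measurable_fun_pair.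
  all: by have := measurable_pre mp mL; rewrite /level; case: (b).
Qed.

(** Z at the chosen end is independent of J and has a density bounded by 1; the value of J only
    shifts the level. *)
Lemma level_prob b s t e : 0 <= s <= T -> 0 <= t <= T -> 0 <= e ->
  \int[P]_w \1_(level b e) (incr s t w) <= 2 * e.
Proof.
move=> sT tT e0; rewrite (RE_increment nu_xi_indep Z_J_indep)//.
rewrite -[leRHS](REcst P); apply: RE_le => [||w]; [|exact: bmf_cst|exact: level_pair_prob].
split; last by exists 1 => w; apply: pair_prob_norm => // z; exact: indic01.
exact: (measurable_nat2 (fun k m => prob (\1_(level b e)) s t k m)).
Qed.

Definition jump_level b e (z : (R * R) * (R * R)) : R := (~~ same_jump z)%:R * \1_(level b e) z.

Let bjl b e : bmf (jump_level b e).
Proof.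
apply: bmfM => //; rewrite (_ : (fun z => _) = (fun z => 1 - (same_jump z)%:R)).
  by apply: bmfB; [exact: bmf_cst|exact: bmf_same_jump].
by apply/funext => z; case: (same_jump z); rewrite /= ?subrr ?subr0.
Qed.

Lemma jump_level01 b e z : 0 <= jump_level b e z <= 1.
Proof.
have := indic01 (level b e) z.
by rewrite /jump_level; case: (same_jump z); rewrite /= ?mul1r ?mul0r ?lexx ?ler01.
Qed.

(** Given the counts, closeness to u still has probability at most 2 e, and a jump occurs between s
    and t with probability at most lambda (t - s). *)
Lemma jump_level_prob b s t e : 0 <= s -> s < t -> t <= T -> 0 <= e ->
  \int[P]_w jump_level b e (incr s t w) <= 2 * e * (lambda * (t - s)).
Proof.
move=> s0 st tT e0; have sT : 0 <= s <= T by rewrite s0 (le_trans (ltW st)).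
have tT' : 0 <= t <= T by rewrite tT (le_trans s0 (ltW st)).
rewrite (RE_increment nu_xi_indep Z_J_indep)//.
have bn : bmf (fun w => ((nu t w - nu s w)%N == 0%N)%:R : R).
  apply: (bmf_nat (b := fun j => (j == 0%N)%:R) (M := 1) (measurable_incr nu s t)) => j.
  by rewrite normr_nat lern1 leq_b1.
apply: (@le_trans _ _ (\int[P]_w (2 * e * (1 - ((nu t w - nu s w)%N == 0%N)%:R)))).
  apply: RE_le => [||w].
  - split; last by exists 1 => w; apply: pair_prob_norm => // z; exact: jump_level01.
    exact: (measurable_nat2 (fun k m => prob (jump_level b e) s t k m)).
  - by apply: bmfM; [exact: bmf_cst|apply: bmfB => //; exact: bmf_cst].
  rewrite subn_eq0; have le := poisson_mono nu_poisson w s0 (ltW st).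
  have [H|H] := eqVneq (nu s w) (nu t w).
    rewrite -H leqnn subrr mulr0 (@pair_prob_on (jump_level b e) (fun=> 0)) ?pair_prob0// => z zz.
    by rewrite /jump_level zz mul0r.
  rewrite leqNgt ltn_neqAle H le subr0 mulr1.
  rewrite (@pair_prob_off (jump_level b e) (\1_(level b e)))//; first exact: level_pair_prob.
  by move=> z zz; rewrite /jump_level zz mul1r.
rewrite REZ; last by apply: bmfB => //; exact: bmf_cst.
rewrite ler_wpM2l ?mulr_ge0// REB//; last exact: bmf_cst.
rewrite REcst (poisson_incr_eq hlambda nu_poisson)//= expr0 invr1 !mul1r.
by have := expR_ge1Dx (- (lambda * (t - s))); lra.
Qed.

(** Counts the grid points at which |X - u| <= mesh / (m + 1). There are n + 2 of them, each with
    probability of the order of the mesh over m + 1, so the mean is O(1 / (m + 1)) uniformly in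
    n. *)
Let tangency m n w := \sum_(i < n.+2) \1_(level false (mesh T n * m.+1%:R^-1))
  (incr (grid T n i) (grid T n i) w) : R.

Let bpath s t (f : (R * R) * (R * R) -> R) : bmf f -> bmf (fun w => f (incr s t w)).
Proof.
move=> bf; apply: (bmf_comp bf); apply: measurable_fun_pair; apply: measurable_fun_pair => //.
- exact: (measurable_compound nu xi).
- exact: (measurable_compound nu xi).
Qed.

Lemma tangency_null : measurable (eventually_ge1 tangency) /\ P (eventually_ge1 tangency) = 0%E.
Proof.
(* The constant: (n + 2) mesh <= 2 T, and each grid point has probability at most 2 mesh / (m +
   1). *)
apply: (@eventually_ge1_null _ _ _ _ _ (4 * T)) => [m n|m n w|m n].
- by apply: (bmf_sum (f := fun i w => \1_(level false (mesh T n * m.+1%:R^-1)) (incr (grid T n i) (grid T n i) w))) => i _; exact: bpath.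
- by apply: sumr_ge0 => i _; have /andP[] := indic01 (level false (mesh T n / m.+1%:R)) (incr (grid T n i) (grid T n i) w).
rewrite (RE_sum P (f := fun i w => \1_(level false (mesh T n * m.+1%:R^-1)) (incr (grid T n i) (grid T n i) w))); last first.
  by move=> i _; exact: bpath.
have m0 : 0 < mesh T n by exact: mesh_gt0.
apply: (@le_trans _ _ (\sum_(i < n.+2) 2 * (mesh T n * m.+1%:R^-1))).
  apply: ler_sum => i _; have iT : 0 <= grid T n i <= T by rewrite grid_ge0// grid_leT// -ltnS.
  by apply: level_prob => //; rewrite mulr_ge0// ltW.
rewrite sumr_const card_ord -[leLHS]mulr_natl.
have -> : n.+2%:R * (2 * (mesh T n * m.+1%:R^-1)) = n.+2%:R * 2 * mesh T n * m.+1%:R^-1 :> R by rewrite !mulrA.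
rewrite ler_pM2r ?invr_gt0//.
have Tn := mesh_mul T n; rewrite -[n.+1]addn1 natrD in Tn.
rewrite -[in leRHS]Tn -[n.+2]addn2 natrD.
have n0 : 0 <= n%:R :> R by [].
by have := mulr_ge0 n0 (ltW m0); lra.
Qed.

(** Counts the ends with |X - u| <= 1 / (m + 1) of cells over which J changes. The width carries no
    factor mesh, because a change of J already has probability of that order. *)
Let near_jump m n w := \sum_(i < n.+1) (jump_level false m.+1%:R^-1 (cell_incr n i w)
  + jump_level true m.+1%:R^-1 (cell_incr n i w)).

Lemma near_jump_null : measurable (eventually_ge1 near_jump) /\ P (eventually_ge1 near_jump) = 0%E.
Proof.
pose f m n i w := jump_level false m.+1%:R^-1 (cell_incr n i w)
  + jump_level true m.+1%:R^-1 (cell_incr n i w).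
have bf m n i : bmf (f m n i) by apply: bmfD; exact: bpath.
apply: (@eventually_ge1_null _ _ _ _ _ (4 * (lambda * T))) => [m n|m n w|m n].
- exact: (bmf_sum (f := f m n)).
- apply: sumr_ge0 => i _; apply: addr_ge0.
    by have /andP[] := jump_level01 false m.+1%:R^-1 (cell_incr n i w).
  by have /andP[] := jump_level01 true m.+1%:R^-1 (cell_incr n i w).
rewrite (RE_sum P (f := f m n))//.
have m0 : 0 <= m.+1%:R^-1 :> R by [].
apply: (@le_trans _ _ (\sum_(i < n.+1) (4 * m.+1%:R^-1 * (lambda * mesh T n)))).
  apply: ler_sum => i _; rewrite /f RED; [|exact: bpath|exact: bpath].
  have H b := jump_level_prob b (grid_ge0 hT n i) (gridS_gt hT n i) (grid_leT hT (ltn_ord i)) m0.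
  have E : grid T n i.+1 - grid T n i = mesh T n by rewrite gridS addrC addKr.
  rewrite E in H; apply: (le_trans (lerD (H false) (H true))).
  by rewrite le_eqVlt; apply/orP; left; apply/eqP; ring.
rewrite sumr_const card_ord -[leLHS]mulr_natl -[in leRHS](mesh_mul T n).
by rewrite le_eqVlt; apply/orP; left; apply/eqP; ring.
Qed.

(** The exceptional set is the union of four measurable null events, one for each kind of bad path:
    tangency, coincidence of partial sums, level met on the grid, level met on either side of a
    jump. These conditions are the hypotheses of the path lemmas. *)
Lemma almost_sure_paths : exists N : set Om, [/\ measurable N, P N = 0%E & forall w, ~ N w ->
  [/\ forall n i, (i <= n.+1)%N -> Z (grid T n i) w + S (nu (grid T n i) w) w <> u,
      forall s, 0 <= s <= T -> Z s w + S (nu s w) w = u -> ~ path_derivative T (Z ^~ w) s 0,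
      injective (S ^~ w) &
      forall s, 0 < s <= T -> jump_at (nu ^~ w) s ->
        Z s w + S (nu s w) w <> u /\ Z s w + S (nu s w).-1 w <> u]].
Proof.
have [m1 n1] := tangency_null; have [m2 n2] := near_jump_null.
pose N3 := \bigcup_k \bigcup_m (if k == m then set0 else [set w | S k w = S m w]).
have mS k m : measurable [set w | S k w = S m w] by apply: measurable_eq_set; exact: measurable_partial_sum.
have m3' k m : measurable (if k == m then set0 else [set w | S k w = S m w]) by case: ifP.
have m3 : measurable N3 by apply: bigcupT_measurable => k; exact: bigcupT_measurable.
have n3 : P N3 = 0%E.
  apply: null_bigcup => k; first exact: bigcupT_measurable.
  apply: null_bigcup => m //; case: ifPn => [_|km]; first exact: measure0.
  exact: partial_sum_inj_ae.
pose G n i := if (i <= n.+1)%N then [set w | Z (grid T n i) w + J (grid T n i) w = u] else set0.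
have mG n i : measurable (G n i).
  rewrite /G; case: ifP => // _; apply: measurable_eq_set => //; apply: measurable_funD => //.
  exact: (measurable_compound nu xi).
have nG n i : P (G n i) = 0%E.
  rewrite /G; case: ifPn => [ni|_]; last exact: measure0.
  have iT : 0 <= grid T n i <= T by rewrite grid_ge0// grid_leT.
  apply/eqP; rewrite eq_le measure_ge0 andbT; apply/lee_addgt0Pr => e e0; rewrite add0e.
  have e20 : 0 <= e / 2 by rewrite divr_ge0// ltW.
  have := level_prob false iT iT e20.
  have -> : 2 * (e / 2) = e by field.
  rewrite -lee_fin; apply: le_trans.
  have -> : [set w | Z (grid T n i) w + J (grid T n i) w = u] = G n i by rewrite /G ni.
  rewrite -[leLHS]fineK ?fin_num_measure// lee_fin -RE_indic//.
  apply: RE_le => [||w]; [exact: (bmf_indic R (mG n i))|exact: bpath|].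
  rewrite !indicE ler_nat; have [|_] := boolP (w \in G n i) => //.
  rewrite inE /G ni /= => E; rewrite mem_set//= /level/= E subrr normr0//.
pose N4 := \bigcup_n \bigcup_i G n i.
have m4 : measurable N4 by apply: bigcupT_measurable => k; exact: bigcupT_measurable.
have n4 : P N4 = 0%E.
  apply: null_bigcup => k; first exact: bigcupT_measurable.
  by apply: null_bigcup => m.
exists (eventually_ge1 tangency `|` eventually_ge1 near_jump `|` N3 `|` N4).
have m12 := measurableU _ _ m1 m2; have m123 := measurableU _ _ m12 m3.
split; first exact: measurableU.
  by rewrite measureU0// measureU0// measureU0.
move=> w Nw.
have c_nu : counting_path (nu ^~ w) by case: nu_poisson.
have w1 : ~ eventually_ge1 tangency w by move=> h; apply: Nw; left; left; left.
have w2 : ~ eventually_ge1 near_jump w by move=> h; apply: Nw; left; left; right.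
have w3 : ~ N3 w by move=> h; apply: Nw; left; right.
have w4 : ~ N4 w by move=> h; apply: Nw; right.
have g1 n i : (i <= n.+1)%N -> Z (grid T n i) w + S (nu (grid T n i) w) w <> u.
  by move=> ni h; apply: w4; exists n => //; exists i => //; rewrite /G ni.
have Sinj : injective (S ^~ w).
  move=> k m km; apply/eqP/negPn/negP => kmn; apply: w3; exists k => //; exists m => //.
  by rewrite (negbTE kmn).
have sum_ge n (f : nat -> R) i : (i < n)%N -> (forall j, 0 <= f j) -> f i <= \sum_(j < n) f j.
  move=> ni f0; rewrite (bigD1 (Ordinal ni))//= lerDl; exact: sumr_ge0.
split => //.
- move=> s sT Xs ds; apply: w1 => m _.
  have XT : Z T w + S (nu T w) w <> u by have := g1 0%N 1%N isT; rewrite gridT.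
  have m0 : 0 < m.+1%:R^-1 :> R by rewrite invr_gt0.
  have [k _ Hk] := @tangency_near_grid R T u (Z ^~ w) (nu ^~ w) (S ^~ w) hT c_nu s sT Xs ds XT _ m0.
  exists k => // n /= kn; have [i ni Hi] := Hk n kn.
  rewrite /tangency; apply: le_trans (sum_ge n.+2 (fun i => \1_(level false (mesh T n / m.+1%:R)) (incr (grid T n i) (grid T n i) w)) i ni _).
    by rewrite indicE mem_set.
  by move=> j; have /andP[] := indic01 (level false (mesh T n / m.+1%:R)) (incr (grid T n j) (grid T n j) w).
- move=> s sT js; apply: contrapT => bad; apply: w2 => m _.
  have {}bad : Z s w + S (nu s w) w = u \/ Z s w + S (nu s w).-1 w = u.
    by move/not_andP: bad => [/contrapT|/contrapT]; [left|right].
  have m0 : 0 < m.+1%:R^-1 :> R by rewrite invr_gt0.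
  have [k _ Hk] := @jump_near_grid R T u (Z ^~ w) (nu ^~ w) (S ^~ w) hT (Z_C1 w) c_nu s Sinj sT js bad _ m0.
  exists k => // n /= kn; have [i ni [Sd Hi]] := Hk n kn.
  have h0 b j : 0 <= jump_level b m.+1%:R^-1 (cell_incr n j w).
    by have /andP[] := jump_level01 b m.+1%:R^-1 (cell_incr n j w).
  rewrite /near_jump; apply: le_trans (sum_ge n.+1 (fun i => jump_level false m.+1%:R^-1 (cell_incr n i w)
    + jump_level true m.+1%:R^-1 (cell_incr n i w)) i ni _); last first.
    by move=> j; exact: addr_ge0.
  have Sd' : ~~ same_jump (cell_incr n i w) by [].
  have E b : level b m.+1%:R^-1 (cell_incr n i w) ->
    jump_level b m.+1%:R^-1 (cell_incr n i w) = 1.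
    by move=> H; rewrite /jump_level Sd' mul1r indicE mem_set.
  case: Hi => Hi.
    by rewrite [X in X + _](E false) // lerDl.
  by rewrite [X in _ + X](E true) // lerDr.
Qed.

End jump_diffusion.

(** * Passage to the limit *)

Import HBNNSimple.

Section nonmeasurable_integrals.
Context d (S : measurableType d) (R : realType) (mu : {measure set S -> \bar R}).

(* The integral of an arbitrary nonnegative function is its lower integral, so [f] and [g] need
   not be measurable. *)
Lemma integral_le_off_null (f g : S -> \bar R) (N : set S) : (forall x, (0 <= f x)%E) ->
  (forall x, (0 <= g x)%E) -> measurable N -> mu N = 0%E -> (forall x, ~ N x -> (f x <= g x)%E) ->
  (\int[mu]_x f x <= \int[mu]_x g x)%E.
Proof.
move=> f0 g0 mN N0 fg; rewrite !ge0_integralTE//.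
apply: ge_ereal_sup => _ [h /= hf <-].
have mNC := measurableC mN.
apply: ereal_sup_ubound; exists (proj_nnsfun h mNC) => [x|] /=.
  rewrite mindicE; have [|] := boolP (x \in ~` N); last by rewrite mulr0.
  by rewrite inE mulr1 => Nx; exact: le_trans (hf x) (fg x Nx).
rewrite -!integralT_nnsfun; apply: ge0_ae_eq_integral => //.
- by apply/measurable_EFinP; exact: measurable_funP.
- by apply/measurable_EFinP; exact: measurable_funP.
- by move=> x _; rewrite lee_fin.
- by move=> x _; rewrite lee_fin.
exists N; split => // x /=; apply: contra_notP => Nx _.
by rewrite mindicE mem_set//= mulr1.
Qed.

End nonmeasurable_integrals.

Section cell_counts.
Context (R : realType) (T : R).
Hypothesis (hT : 0 < T).

(** The bound K excludes an infinite V. For a finite V the lower bound by its size and the upper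
    bound by choosing points in cells meet for large n. *)
Lemma counting_cvg_cells (V : set R) (p : nat -> nat -> bool) (K : R) :
  (forall s, V s -> \forall n \near \oo, exists2 i, (i < n.+1)%N & p n i /\ in_cell T n i s) ->
  (\forall n \near \oo, forall i, (i < n.+1)%N -> p n i -> exists2 s, V s & in_cell T n i s) ->
  (forall n, \sum_(i < n.+1) (p n i)%:R <= K) ->
  (\sum_(i < n.+1) (p n i)%:R)%:E @[n --> \oo] --> (counting V : \bar R).
Proof.
move=> H1 H2 H3.
have fV : finite_set V.
  apply: contrapT => iV.
  have := counting_le_cells hT H1; rewrite /counting asboolF// leye_eq => /eqP E.
  have : (limn_einf (fun n => (\sum_(i < n.+1) (p n i)%:R)%:E) <= K%:E)%E.
    rewrite limn_einf_lim; apply: lime_le; first exact: is_cvg_einfs.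
    apply: nearW => n; apply: (@le_trans _ _ (\sum_(i < n.+1) (p n i)%:R)%:E); last by rewrite lee_fin.
    by apply: ereal_inf_lbound; exists n => /=.
  by rewrite E leye_eq.
have cV : counting V = (size (finmap.enum_fset (fset_set V)))%:R%:E :> \bar R by rewrite /counting asboolT.
have H4 : \forall n \near \oo, (size (finmap.enum_fset (fset_set V)))%:R <= \sum_(i < n.+1) (p n i)%:R :> R.
  apply: (cells_ge_size hT) => [|s]; first exact: finmap.fset_uniq.
  by rewrite in_fset_set// inE; exact: H1.
apply: cvg_near_cst; near=> n.
apply/eqP; rewrite eq_le; apply/andP; split.
  by apply: (counting_ge_cells hT); near: n.
by rewrite cV lee_fin; near: n.
Unshelve. all: by end_near. Qed.

End cell_counts.

Section limits_of_means.
Context d (Om : measurableType d) (R : realType) (P : probability Om R).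

Lemma RE_cvg_EFin (f : nat -> Om -> R) (L : R) : (forall n, bmf (f n)) ->
  \int[P]_w f n w @[n --> \oo] --> L -> (\int[P]_w (f n w)%:E)%E @[n --> \oo] --> L%:E.
Proof.
move=> bf cL.
rewrite (_ : (fun n => _) = (fun n => (\int[P]_w f n w)%:E)); last by apply/funext => n; rewrite REFin.
by apply: cvg_EFin; [exact: nearW|exact: cL].
Qed.

(* [U] may be nonmeasurable: the upper bound is Fatou's lemma and the lower one monotonicity. *)
Lemma integral_eq_limit_below (U : Om -> \bar R) (f : nat -> Om -> R) (N : set Om) (L : R) :
  (forall n, bmf (f n)) -> (forall n w, 0 <= f n w) -> measurable N -> P N = 0%E ->
  (forall w, (0 <= U w)%E) ->
  (forall w, ~ N w -> (U w <= limn_einf (fun n => (f n w)%:E))%E) ->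
  (forall n w, ~ N w -> ((f n w)%:E <= U w)%E) ->
  \int[P]_w f n w @[n --> \oo] --> L -> (\int[P]_w U w = L%:E)%E.
Proof.
move=> bf f0 mN N0 U0 Ule Uge cL.
have cL' : (\int[P]_w (f n w)%:E)%E @[n --> \oo] --> L%:E.
  exact: RE_cvg_EFin.
apply/eqP; rewrite eq_le; apply/andP; split.
  apply: (@le_trans _ _ (\int[P]_w limn_einf (fun n => (f n w)%:E))%E).
    apply: (integral_le_off_null _ _ mN N0) => // w.
    by apply: limn_einf_ge; apply: nearW => n; rewrite lee_fin.
  rewrite -(cvg_limn_einf_sup cL').1.
  apply: (@fatou _ _ _ P setT measurableT (fun n w => (f n w)%:E)) => [n|n w _].
    by apply/measurable_EFinP; case: (bf n).
  by rewrite lee_fin.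
rewrite -(cvg_lim _ cL')//; apply: lime_le; first by apply/cvg_ex; eexists; exact: cL'.
apply: nearW => n; apply: (integral_le_off_null _ _ mN N0) => // w; first by rewrite lee_fin.
exact: Uge.
Qed.

(** For small n the functions f n may exceed U, so a dominating variable replaces monotonicity.
    Setting everything to 0 on N makes the limit measurable without changing the lower integral of
    U. *)
Lemma integral_eq_dominated_limit (U : Om -> \bar R) (f : nat -> Om -> R) (g : Om -> R) (N : set Om) (L : R) :
  (forall n, bmf (f n)) -> (forall n w, 0 <= f n w) -> measurable N -> P N = 0%E ->
  (forall w, (0 <= U w)%E) ->
  (forall w, ~ N w -> (f n w)%:E @[n --> \oo] --> U w) ->
  (forall n w, f n w <= g w) -> P.-integrable setT (EFin \o g) ->
  \int[P]_w f n w @[n --> \oo] --> L -> (\int[P]_w U w = L%:E)%E.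
Proof.
move=> bf f0 mN N0 U0 fU fg ig cL.
have mNC := measurableC mN.
pose f' n w := (f n w * \1_(~` N) w)%:E.
pose U' w := (U w * (\1_(~` N) w)%:E)%E.
have f'U w : f' n w @[n --> \oo] --> U' w.
  rewrite /f' /U' indicE; have [|] := boolP (w \in ~` N).
    rewrite inE => Nw; rewrite mule1; under eq_fun do rewrite mulr1; exact: fU.
  by move=> _; rewrite mule0; under eq_fun do rewrite mulr0; exact: cvg_cst.
have bf' n : bmf (fun w => f n w * \1_(~` N) w) by apply: bmfM => //; exact: bmf_indic.
have mf' n : measurable_fun setT (f' n) by apply/measurable_EFinP; case: (bf' n).
have mU' : measurable_fun setT U'.
  by apply: (@emeasurable_fun_cvg _ _ _ _ f') => // w _; exact: f'U.
have i01 w : 0 <= (\1_(~` N) w : R) <= 1 by rewrite indicE; case: (_ \in _); rewrite /= ?lexx ?ler01.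
have U'0 w : (0 <= U' w)%E by apply: mule_ge0 => //; rewrite lee_fin; have /andP[] := i01 w.
have -> : (\int[P]_w U w = \int[P]_w U' w)%E.
  have E w : ~ N w -> U' w = U w by move=> Nw; rewrite /U' indicE mem_set// mule1.
  by apply/eqP; rewrite eq_le; apply/andP; split; apply: (integral_le_off_null _ _ mN N0) => // w Nw; rewrite E.
have dom : {ae P, forall w n, setT w -> (`|f' n w| <= (EFin \o g) w)%E}.
  apply: aeW => w n _; have /andP[i0 i1] := i01 w.
  rewrite lee_fin normrM (ger0_norm (f0 n w)) (ger0_norm i0).
  by rewrite (le_trans _ (fg n w))// ler_piMr.
have fU' : {ae P, forall w, setT w -> f' ^~ w @ \oo --> U' w} by apply: aeW => w _; exact: f'U.
have [_ _ c] := dominated_convergence measurableT mf' mU' fU' ig dom.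
have -> : (\int[P]_w U' w = limn (fun n => \int[P]_w f' n w))%E by exact/esym/cvg_lim.
apply: cvg_lim => //.
have := RE_cvg_EFin bf' (_ : \int[P]_w (f n w * \1_(~` N) w) @[n --> \oo] --> L); apply.
rewrite (_ : (fun n => _) = (fun n => \int[P]_w f n w))//; apply/funext => n.
by apply: (RE_ae (bf' n) (bf n) mN N0) => w Nw; rewrite indicE mem_set// mulr1.
Qed.

End limits_of_means.

Section expected_intensities.
Context (R : realType).

Lemma jump_prob_spec (u : R) k :
  (\int[lebesgue_measure]_(x in `]-oo, u]) (std_normal_ccdf (u - x) * normal_pdf 0 (Num.sqrt k.+1%:R) x)%:E =
   (jump_prob u k)%:E)%E /\ 0 <= jump_prob u k <= 1.
Proof.
have m1 : measurable_fun setT (fun x : R => std_normal_ccdf (u - x)).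
  by apply: measurableT_comp; [exact: measurable_std_normal_ccdf|exact: measurable_funB].
have m2 : measurable_fun setT (fun x : R => std_normal_ccdf (u - x) * normal_pdf 0 (Num.sqrt k.+1%:R) x).
  by apply: measurable_funM => //; exact: measurable_normal_pdf.
have p0 x : 0 <= std_normal_ccdf (u - x) * normal_pdf 0 (Num.sqrt k.+1%:R) x.
  by rewrite mulr_ge0 ?normal_pdf_ge0//; have /andP[] := std_normal_ccdf_itv (u - x).
set I := (\int[_]_(x in _) _)%E.
have I0 : (0 <= I)%E by apply: integral_ge0 => x _; rewrite lee_fin.
have I1 : (I <= 1)%E.
  rewrite -(integral_normal_pdf (0 : R) (Num.sqrt k.+1%:R)).
  apply: (@le_trans _ _ (\int[lebesgue_measure]_x (std_normal_ccdf (u - x) * normal_pdf 0 (Num.sqrt k.+1%:R) x)%:E)%E).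
    apply: ge0_subset_integral => //; last by move=> x _; rewrite lee_fin.
    exact/measurable_EFinP.
  apply: ge0_le_integral => //.
  - by move=> x _; rewrite lee_fin.
  - exact/measurable_EFinP.
  - by apply/measurable_EFinP; exact: measurable_normal_pdf.
  - by move=> x _; rewrite lee_fin ler_piMl ?normal_pdf_ge0//; have /andP[] := std_normal_ccdf_itv (u - x).
have IE : I = (jump_prob u k)%:E.
  by rewrite /jump_prob fineK// ge0_fin_numE// (le_lt_trans I1)// ltry.
by split => //; rewrite -!lee_fin -IE I0.
Qed.

Context d (Om : measurableType d) (P : probability Om R) (lambda T : R) (nu : R -> {RV P >-> nat}).
Hypotheses (hT : 0 < T) (hlambda : 0 < lambda).

Let lT : 0 < lambda * T. Proof. exact: mulr_gt0. Qed.

Let tail0 k : 0 <= tail nu T k. Proof. by rewrite fine_ge0. Qed.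

Let p_coefS k : p_coef P lambda T nu k.+1 = (lambda * T)^-1 * tail nu T k.
Proof. by []. Qed.

(** The shift n = k + 1: p_(k+1) involves P(nu_T >= k + 1), the tail at k. *)
Lemma mixture_pdfE x : mixture_pdf P lambda T nu x =
  (\sum_(0 <= k <oo) ((lambda * T)^-1 * tail nu T k * normal_pdf 0 (Num.sqrt k.+1%:R) x)%:E)%E.
Proof.
rewrite /mixture_pdf -nneseries_addn.
  by apply: eq_eseriesr => k _; rewrite addn1 p_coefS.
move=> [|k]; rewrite lee_fin mulr_ge0 ?normal_pdf_ge0//.
  by rewrite mulr_ge0 ?fine_ge0 ?invr_ge0// ltW.
by rewrite mulr_ge0 ?fine_ge0 ?invr_ge0// ltW.
Qed.

Lemma mixture_pdf_series x (l : R) :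
  (\sum_(0 <= k <oo) (normal_pdf 0 (Num.sqrt k.+1%:R) x * tail nu T k)%:E = l%:E)%E ->
  mixture_pdf P lambda T nu x = (l / (lambda * T))%:E.
Proof.
move=> E; have -> : l / (lambda * T) = (lambda * T)^-1 * l by rewrite mulrC.
rewrite mixture_pdfE EFinM -E -nneseriesZl; last first.
  by move=> k _; rewrite lee_fin mulr_ge0 ?normal_pdf_ge0.
by apply: eq_eseriesr => k _; rewrite -EFinM mulrA mulrAC.
Qed.

(** Series and integral are exchanged by nonnegativity, and lambda T cancels the normalization of
    p. *)
Lemma jump_mixture_series u (l : R) :
  (\sum_(0 <= k <oo) (jump_prob u k * tail nu T k)%:E = l%:E)%E ->
  ((lambda * T)%:E * \int[lebesgue_measure]_(x in `]-oo, u])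
     ((std_normal_ccdf (u - x))%:E * mixture_pdf P lambda T nu x) = l%:E)%E.
Proof.
move=> E.
have mI : measurable `]-oo, u]%classic by exact: measurable_itv.
have lTi : 0 <= (lambda * T)^-1 by rewrite invr_ge0 ltW.
have c0 x : 0 <= std_normal_ccdf (u - x) :> R by have /andP[] := std_normal_ccdf_itv (u - x).
have m1 : measurable_fun setT (fun x : R => std_normal_ccdf (u - x)).
  by apply: measurableT_comp; [exact: measurable_std_normal_ccdf|exact: measurable_funB].
pose f k (x : R) := (std_normal_ccdf (u - x) * normal_pdf 0 (Num.sqrt k.+1%:R) x)%:E.
have f0 k x : (0 <= f k x)%E by rewrite lee_fin mulr_ge0 ?normal_pdf_ge0.
have mf k : measurable_fun setT (f k).
  by apply/measurable_EFinP; apply: measurable_funM => //; exact: measurable_normal_pdf.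
have -> : (\int[lebesgue_measure]_(x in `]-oo, u]) ((std_normal_ccdf (u - x))%:E * mixture_pdf P lambda T nu x) =
    \int[lebesgue_measure]_(x in `]-oo, u]) (\sum_(0 <= k <oo) (((lambda * T)^-1 * tail nu T k)%:E * f k x)))%E.
  apply: eq_integral => x _; rewrite mixture_pdfE -nneseriesZl.
    by apply: eq_eseriesr => k _; rewrite /f -!EFinM mulrCA.
  by move=> k _; rewrite lee_fin !mulr_ge0 ?normal_pdf_ge0.
rewrite integral_nneseries//; last 2 first.
- move=> k; apply: (measurable_funS measurableT) => //.
  by apply: emeasurable_funM => //; exact: mf.
- by move=> k x _; rewrite mule_ge0// lee_fin mulr_ge0.
rewrite -nneseriesZl; last first.
  by move=> k _; apply: integral_ge0 => x _; rewrite mule_ge0// lee_fin mulr_ge0.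
rewrite -E; apply: eq_eseriesr => k _.
rewrite ge0_integralZl//; last 2 first.
- by apply: (measurable_funS measurableT) => //; exact: mf.
- by rewrite lee_fin mulr_ge0.
rewrite /f (jump_prob_spec u k).1 -!EFinM; congr (_%:E); field; by rewrite !gt_eqF.
Qed.

End expected_intensities.

Section poisson_mean.
Context d (Om : measurableType d) (R : realType) (P : probability Om R).
Context (lambda T : R) (nu : R -> {RV P >-> nat}).
Hypotheses (hT : 0 < T) (hlambda : 0 < lambda) (nu_poisson : poisson_process P lambda nu).

Lemma nneseries_ltn m : (\sum_(0 <= k <oo) ((k < m)%N%:R : R)%:E = m%:R%:E)%E.
Proof.
apply: cvg_lim => //; apply: cvg_near_cst; exists m => // n /= mn.
rewrite sumEFin; congr (_%:E).
rewrite (big_cat_nat (leq0n m) mn)/= big_nat (eq_bigr (fun=> 1)); last by move=> i /andP[_ ->].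
rewrite -big_nat sumr_const_nat subn0 [X in _ + X]big_nat [X in _ + X]big1 ?addr0// => i /andP[mi _].
by rewrite ltnNge mi.
Qed.

(** E nu_T = sum_k P(nu_T > k), which is finite by [poisson_riemann] with b = 1. *)
Lemma poisson_integrable : P.-integrable setT (EFin \o (fun w => (nu T w)%:R : R)).
Proof.
have [l El _] := poisson_riemann hlambda nu_poisson hT (fun=> ler01) (fun=> lexx (1 : R)).
apply: (@ge0_integrable _ _ _ _ _ l) => //.
  by apply: (measurableT_comp (f := fun k : nat => k%:R : R)).
under eq_integral do rewrite -nneseries_ltn.
have mk k : measurable_fun setT (fun w => ((k < nu T w)%N%:R : R)).
  by apply: (measurableT_comp (f := fun j : nat => (k < j)%N%:R : R)).
rewrite integral_nneseries//.
- rewrite -El; apply: eq_eseriesr => k _.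
  have bk : bmf (fun w => ((k < nu T w)%N%:R : R)).
    by split => //; exists 1 => w; rewrite normr_nat lern1 leq_b1.
  rewrite mul1r -REFin//; congr (_%:E); apply: RE_boolr.
  exact: (measurable_pre (A := [set j | (k < j)%N]) (measurable_funPT (nu T))).
- by move=> k; apply/measurable_EFinP.
Qed.

End poisson_mean.

Theorem theorem8 (R : realType) (d : measure_display) (Om : measurableType d)
    (P : probability Om R) (T u lambda : R)
    (Z : R -> {RV P >-> R}) (nu : R -> {RV P >-> nat}) (xi : nat -> {RV P >-> R})
    (hT : 0 < T) (hlambda : 0 < lambda)
    (Z_gaussian : gaussian_process P `[0, T] Z)
    (Z_centered : centered_process P `[0, T] Z)
    (Z_stationary : stationary_process P `[0, T] Z)
    (Z_C1 : forall w, C1_on `[0, T] (fun t => Z t w))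
    (Z_var : covariance_function P Z 0 = 1)
    (nu_poisson : poisson_process P lambda nu)
    (xi_gaussian : forall n, standard_gaussian P (xi n))
    (xi_indep : independent_family P xi)
    (nu_xi_indep : independent_systems P
       (sigma_family [set t | 0 <= t] nu) (sigma_family [set: nat] xi))
    (Z_J_indep : independent_systems P
       (sigma_family `[0, T] Z) (sigma_family `[0, T] (compound nu xi))) :
  let X := fun (w : Om) (t : R) => Z t w + compound nu xi t w in
  let p := mixture_pdf P lambda T nu in
  let Gamma := covariance_function P Z in
  (\int[P]_w continuous_upcrossings T u (X w) =
     (T * Num.sqrt (- derive1n 2 Gamma 0%R / (2 * pi)))%:E * p u)%E
  /\
  (\int[P]_w discontinuous_upcrossings T u (X w) =
     (lambda * T)%:E *
     \int[lebesgue_measure]_(x in `]-oo, u]) ((std_normal_ccdf (u - x))%:E * p x))%E.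
Proof.
move=> X p Gamma.
have [N [mN N0 HN]] := @almost_sure_paths _ Om R P T lambda u Z nu xi hT hlambda Z_gaussian Z_centered
  Z_stationary Z_C1 Z_var nu_poisson xi_gaussian xi_indep nu_xi_indep Z_J_indep.
have c_nu w : counting_path (nu ^~ w) by case: nu_poisson.
pose increment n i w := ((Z (grid T n i) w, Z (grid T n i.+1) w),
  (compound nu xi (grid T n i) w, compound nu xi (grid T n i.+1) w)).
have b_inc (f : (R * R) * (R * R) -> R) n i : bmf f -> bmf (fun w => f (increment n i w)).
  move=> bf; apply: (bmf_comp bf); apply: measurable_fun_pair; apply: measurable_fun_pair => //.
  - exact: (measurable_compound nu xi).
  - exact: (measurable_compound nu xi).
have indE w n i : (\1_(crossing u) (increment n i w) : R) =
    ((X w (grid T n i) < u) && (u < X w (grid T n i.+1)))%:R.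
  rewrite indicE; congr (_%:R); congr nat_of_bool.
  by apply/idP/andP; rewrite inE.
pose S w k := partial_sum xi k w.
pose pc w n i := cont_cell T u (Z ^~ w) (nu ^~ w) (S w) n i.
pose pd w n i := disc_cell T u (Z ^~ w) (nu ^~ w) (S w) n i.
have pcE w n i : cont_cross u (increment n i w) = (pc w n i)%:R :> R.
  by rewrite /cont_cross indE -natrM mulnb.
have pdE w n i : disc_cross u (increment n i w) = (pd w n i)%:R :> R.
  by rewrite /disc_cross indE -natrM mulnb.
pose Uc n w : R := \sum_(i < n.+1) cont_cross u (increment n i w).
pose Ud n w : R := \sum_(i < n.+1) disc_cross u (increment n i w).
have UcE n w : Uc n w = \sum_(i < n.+1) (pc w n i)%:R by apply: eq_bigr => i _.
have UdE n w : Ud n w = \sum_(i < n.+1) (pd w n i)%:R by apply: eq_bigr => i _.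
have bc n i : bmf (fun w => cont_cross u (increment n i w)) by apply: b_inc; exact: bmf_cont_cross.
have bd n i : bmf (fun w => disc_cross u (increment n i w)) by apply: b_inc; exact: bmf_disc_cross.
have bUc n : bmf (Uc n) by apply: (bmf_sum (f := fun i w => cont_cross u (increment n i w))).
have bUd n : bmf (Ud n) by apply: (bmf_sum (f := fun i w => disc_cross u (increment n i w))).
have [a Ga [a0 Gamma_a]] := Gamma_second_derivative hT Z_gaussian Z_centered Z_stationary Z_C1 Z_var.
split.
- have b0 k : 0 <= normal_pdf 0 (Num.sqrt k.+1%:R) u :> R by exact: normal_pdf_ge0.
  have b1 k : normal_pdf 0 (Num.sqrt k.+1%:R) u <= 1 :> R.
    rewrite (le_trans (normal_pdf_ub _ _ _))//.
    by apply: normal_peak_le1; rewrite -[leLHS]sqrtr1 ler_wsqrtr// ler1n.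
  have [l El cl] := poisson_riemann hlambda nu_poisson hT b0 b1.
  have cU := mean_cont_cross_cvg hT hlambda Z_gaussian Z_centered Z_stationary Z_var nu_poisson
    xi_gaussian xi_indep nu_xi_indep Z_J_indep a0 Gamma_a cl.
  rewrite /p /Gamma (mixture_pdf_series hT hlambda El) -EFinM Ga opprK.
  (* Both sides are a l / (lambda (2 pi)^(1/2)), as [normal_peak 1] is (2 pi)^(-1/2). *)
  have -> : T * Num.sqrt (a ^+ 2 / (2 * pi)) * (l / (lambda * T)) = a * normal_peak 1 * (l / lambda).
    have p2 : 0 <= 2 * pi :> R by rewrite mulr_ge0// pi_ge0.
    rewrite sqrtrM ?sqr_ge0// sqrtr_sqr ger0_norm// sqrtrV// /normal_peak expr1n mul1r -[pi *+ 2]mulr_natl.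
    by field; rewrite !gt_eqF// sqrtr_gt0 mulr_gt0// pi_gt0.
  apply: (@integral_eq_limit_below _ _ _ _ _ Uc N) => //.
  + by move=> n w; rewrite UcE sumr_ge0.
  + move=> w Nw; have [g1 g2 g3 g4] := HN w Nw.
    under eq_fun do rewrite UcE.
    by apply: (counting_le_cells hT) => s; exact: (cont_upcross_cell hT (Z_C1 w) (c_nu w) g1 g4).
  + move=> n w Nw; have [g1 g2 g3 g4] := HN w Nw; rewrite UcE.
    by apply: (counting_ge_cells hT) => i ni; exact: (cont_cell_upcross hT (Z_C1 w) (c_nu w) g2 g3 ni).
  + rewrite (_ : (fun n => _) = (fun n => \sum_(i < n.+1) \int[P]_w cont_cross u (increment n i w)))//.
    by apply/funext => n; rewrite (RE_sum P (f := fun i w => cont_cross u (increment n i w))).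
- have b0 k : 0 <= jump_prob u k :> R by have [_ /andP[]] := jump_prob_spec u k.
  have b1 k : jump_prob u k <= 1 :> R by have [_ /andP[]] := jump_prob_spec u k.
  have [l El cl] := poisson_riemann hlambda nu_poisson hT b0 b1.
  have b01 k : `|jump_prob u k : R| <= 1 by rewrite ger0_norm.
  have cU := mean_disc_cross_cvg hT hlambda Z_gaussian Z_centered Z_stationary Z_var nu_poisson
    xi_gaussian xi_indep nu_xi_indep Z_J_indep a0 Gamma_a cl b01.
  rewrite (jump_mixture_series hT hlambda El).
  (* A cell is counted only if nu increases over it, and the increments telescope to nu_T. *)
  have UdT n w : Ud n w <= (nu T w)%:R.
    rewrite UdE; apply: (@le_trans _ _ (\sum_(0 <= i < n.+1) ((nu (grid T n i.+1) w)%:R - (nu (grid T n i) w)%:R))).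
      rewrite big_mkord; apply: ler_sum => i _.
      have m : (nu (grid T n i) w <= nu (grid T n i.+1) w)%N.
        by apply: (poisson_mono nu_poisson); [exact: grid_ge0|exact: grid_le].
      rewrite -natrB// ler_nat /pd /disc_cell.
      case: eqP => //= Sne; apply: (leq_trans (leq_b1 _)); rewrite subn_gt0 ltn_neqAle m andbT.
      by apply/eqP => E; apply: Sne; rewrite E.
    rewrite (telescope_sumr (fun i => (nu (grid T n i) w)%:R : R))// gridT grid0.
    by rewrite (poisson_0 nu_poisson) subr0.
  apply: (@integral_eq_dominated_limit _ _ _ _ _ Ud (fun w => (nu T w)%:R) N) => //.
  + by move=> n w; rewrite UdE sumr_ge0.
  + move=> w Nw; have [g1 g2 g3 g4] := HN w Nw.
    under eq_fun do rewrite UdE.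
    apply: (@counting_cvg_cells _ _ hT _ _ (nu T w)%:R) => [s||n].
    * exact: (disc_upcross_cell hT (Z_C1 w) (c_nu w) g3 g4).
    * exact: (disc_cell_upcross hT (Z_C1 w) (c_nu w) g4).
    * by rewrite -UdE.
  + exact: (poisson_integrable hT hlambda nu_poisson).
  + rewrite (_ : (fun n => _) = (fun n => \sum_(i < n.+1) \int[P]_w disc_cross u (increment n i w)))//.
    by apply/funext => n; rewrite (RE_sum P (f := fun i w => disc_cross u (increment n i w))).
Qed.
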